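(* Let $d, k \ge 1$ be integers. There exists a constant $C > 0$, depending on $k$ and $d$, such that for every $u \in W^{k,1}(\mathbb{R}^d)$ there exist non-negative functions $u^\oplus, u^\ominus \in W^{k,1}(\mathbb{R}^d)$ such that $$u = u^\oplus - u^\ominus \ \text{ almost everywhere in } \mathbb{R}^d \quad\text{and}\quad \|u^\oplus\|_{W^{k,1}(\mathbb{R}^d)} + \|u^\ominus\|_{W^{k,1}(\mathbb{R}^d)} \leq C\|u\|_{W^{k,1}(\mathbb{R}^d)}.$$
   Context: Functions are real-valued. $W^{k,1}(\mathbb{R}^d)$ is the space of weakly differentiable functions $u \in L^1(\mathbb{R}^d)$ such that $D^i u \in L^1(\mathbb{R}^d, \mathbb{R}^{d^i})$ for $i \in \{1,\ldots,k\}$, where $D^i u$ is the tensor of all weak partial derivatives of order $i$, with norm $\|u\|_{W^{k,1}(\mathbb{R}^d)} := \sum_{i=0}^{k} \|D^i u\|_{L^1(\mathbb{R}^d)}$, where $D^0 u := u$. *)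

(* Defs.v *)
From HB Require Import structures.
From mathcomp Require Import all_boot all_order all_algebra.
From mathcomp Require Import all_classical all_reals all_analysis.

Set Implicit Arguments.
Unset Strict Implicit.
Unset Printing Implicit Defensive.
Import Order.TTheory GRing.Theory Num.Theory.
Import numFieldNormedType.Exports.

Local Open Scope classical_set_scope.
Local Open Scope ring_scope.

Definition measure_rV_display : measure_display. Proof. exact. Qed.

(* Product sigma-algebra on row vectors, as the library does for tuples; over
   a realType it is the Borel sigma-algebra of R^n. *)
Section measurable_rV.
Context {R : realType} (n : nat).

Let coord (i : 'I_n) (x : 'rV[R]_n) : measurableTypeR R := x ord0 i.

Let rV_set0 : g_sigma_preimage coord set0.
Proof. exact: sigma_algebra0. Qed.

Let rV_setC A : g_sigma_preimage coord A -> g_sigma_preimage coord (~` A).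
Proof. exact: sigma_algebraC. Qed.

Let rV_bigcup (F : _^nat) : (forall i, g_sigma_preimage coord (F i)) ->
  g_sigma_preimage coord (\bigcup_i (F i)).
Proof. exact: sigma_algebra_bigcup. Qed.

HB.instance Definition _ := @isMeasurable.Build measure_rV_display
  'rV[R]_n (g_sigma_preimage coord) rV_set0 rV_setC rV_bigcup.

Lemma measurable_coord (i : 'I_n) :
  measurable_fun [set: 'rV[R]_n] (fun x => x ord0 i : measurableTypeR R).
Proof.
move=> _ Y mY; rewrite setTI; apply: sub_sigma_algebra => /=.
rewrite -bigcup_seq/=; exists i => /=; first by rewrite mem_index_enum.
by exists Y => //; rewrite setTI.
Qed.

Lemma measurable_fun_rVP d (T : measurableType d) (f : T -> 'rV[R]_n) :
  measurable_fun [set: T] f <->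
  forall i, measurable_fun [set: T] (fun t => f t ord0 i : measurableTypeR R).
Proof.
split=> [mf i|mf].
  exact: (measurableT_comp (measurable_coord i) mf).
have : g_sigma_preimage (fun i => coord i \o f) `<=` measurable.
  apply: smallest_sub; first exact: sigma_algebra_measurable.
  move=> A; rewrite -bigcup_seq/= => -[i _] [B mB <-].
  exact: mf.
rewrite g_sigma_preimage_comp => prefS _ A mA.
by apply: prefS; exists A.
Qed.

End measurable_rV.

(* One induction step: the product of the measure of R with mu, carried from
   R * R^n to R^(n+1). *)
Section lebesgue_cons.
Context {R : realType} (n : nat).
Variable mu : {sigma_finite_measure set 'rV[R]_n -> \bar R}.

Definition rV_cons (p : measurableTypeR R * 'rV[R]_n) : 'rV[R]_n.+1 :=
  row_mx (p.1 : R)%:M p.2.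

Let rV_consl p (j : 'I_1) : rV_cons p ord0 (lshift n j) = p.1.
Proof. by rewrite [LHS]row_mxEl (ord1 j) mxE eqxx. Qed.

Let rV_consr p (j : 'I_n) : rV_cons p ord0 (rshift 1 j) = p.2 ord0 j.
Proof. by rewrite [LHS]row_mxEr. Qed.

Lemma rV_cons0 p : rV_cons p ord0 ord0 = p.1.
Proof. by rewrite -(rV_consl p ord0); congr (rV_cons _ _ _); exact/val_inj. Qed.

Lemma rV_consS p j : rV_cons p ord0 (lift ord0 j) = p.2 ord0 j.
Proof. by rewrite -(rV_consr p j); congr (rV_cons _ _ _); exact/val_inj. Qed.

Lemma measurable_rV_cons : measurable_fun setT rV_cons.
Proof.
apply/measurable_fun_rVP => i; have [j ->|->] := unliftP ord0 i.
  under eq_fun do rewrite rV_consS.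
  exact: (measurableT_comp (measurable_coord j) measurable_snd).
by under eq_fun do rewrite rV_cons0; exact: measurable_fst.
Qed.

Definition lebesgue_cons : set 'rV[R]_n.+1 -> \bar R :=
  pushforward (@lebesgue_measure R \x mu)%E rV_cons.

Let lebesgue_cons0 : lebesgue_cons set0 = 0%E.
Proof. by apply: measure0; exact: measurable_rV_cons. Qed.

Let lebesgue_cons_ge0 A : (0 <= lebesgue_cons A)%E.
Proof. by apply: measure_ge0; exact: measurable_rV_cons. Qed.

Let lebesgue_cons_sigma_additive : semi_sigma_additive lebesgue_cons.
Proof.
by apply: measure_semi_sigma_additive; exact: measurable_rV_cons.
Qed.

HB.instance Definition _ := isMeasure.Build _ _ _ lebesgue_cons
  lebesgue_cons0 lebesgue_cons_ge0 lebesgue_cons_sigma_additive.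

Let rV_uncons (x : 'rV[R]_n.+1) : measurableTypeR R * 'rV[R]_n :=
  (x ord0 ord0, \row_j x ord0 (lift ord0 j)).

Let measurable_rV_uncons : measurable_fun setT rV_uncons.
Proof.
apply: measurable_fun_pair; first exact: measurable_coord.
apply/measurable_fun_rVP => i; under eq_fun do rewrite mxE.
exact: measurable_coord.
Qed.

Let rV_consK : cancel rV_cons rV_uncons.
Proof.
move=> [a x]; congr pair; first exact: rV_cons0.
by apply/rowP => j; rewrite mxE rV_consS.
Qed.

Let lebesgue_cons_sigma_finite : sigma_finite setT lebesgue_cons.
Proof.
have /sigma_finiteP[F [FT ndF Foo]] := sigma_finiteT (@lebesgue_measure R).
have /sigma_finiteP[G [GT ndG Goo]] := sigma_finiteT mu.
exists (fun k => rV_uncons @^-1` (F k `*` G k)).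
  rewrite -preimage_bigcup -[LHS](preimage_setT rV_uncons); congr (_ @^-1` _).
  rewrite -setXTT FT GT; apply/seteqP; split=> [[a x]|[a x] [k _ []]]; last first.
    by split; exists k.
  move=> [[k _ Fa] [l _ Gx]]; exists (maxn k l) => //; split.
  - by have /subsetPset := ndF _ _ (leq_maxl k l); exact.
  - by have /subsetPset := ndG _ _ (leq_maxr k l); exact.
move=> k; have [mF Fk] := Foo k; have [mG Gk] := Goo k; split.
  by rewrite -[X in measurable X]setTI; apply: measurable_rV_uncons => //;
    exact: measurableX.
rewrite /lebesgue_cons /pushforward -comp_preimage.
rewrite (_ : rV_uncons \o rV_cons = id); last first.
  by apply/funext => p; exact: rV_consK.
by rewrite preimage_id product_measure1E// lte_mul_pinfty// ge0_fin_numE.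
Qed.

HB.instance Definition _ := Measure_isSigmaFinite.Build _ _ _
  lebesgue_cons lebesgue_cons_sigma_finite.

End lebesgue_cons.

(* Lebesgue measure on R^n; R^0 is a point, of mass 1. *)
Fixpoint lebesgue_rV {R : realType} (n : nat) :
    {sigma_finite_measure set 'rV[R]_n -> \bar R} :=
  if n is n'.+1 then lebesgue_cons (lebesgue_rV n') else \d_(0 : 'rV[R]_0).

Lemma lebesgue_rV_box {R : realType} (n : nat)
    (A : 'I_n -> set (measurableTypeR R)) : (forall i, measurable (A i)) ->
  lebesgue_rV n [set x : 'rV[R]_n | forall i, A i (x ord0 i)] =
  (\prod_(i < n) lebesgue_measure (A i))%E.
Proof.
elim: n A => [|n IHn] A mA.
  by rewrite big_ord0 /= diracE mem_set// => -[].
rewrite big_ord_recl -IHn//= /lebesgue_cons /pushforward.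
rewrite -product_measure1E//; last first.
  rewrite (_ : mkset _ = \bigcap_(i in [set: 'I_n])
      ((fun x : 'rV[R]_n => x ord0 i) @^-1` A (lift ord0 i))).
    apply: fin_bigcap_measurable => // i _.
    by rewrite -[X in measurable X]setTI; exact: measurable_coord.
  by apply/seteqP; split => [x Ax i _|x Ax i]; exact: Ax.
congr ((_ \x _)%E _); apply/seteqP; split => -[a x] /= Aax.
  split=> [|j]; first by have := Aax ord0; rewrite rV_cons0.
  by have := Aax (lift ord0 j); rewrite rV_consS.
move=> i; case: Aax => Aa Ax.
by have [j ->|->] := unliftP ord0 i; [rewrite rV_consS|rewrite rV_cons0].
Qed.

Section weak_derivatives.
Context {R : realType} {d : nat}.
Local Notation rV := 'rV[R]_d.
Local Notation mu := (@lebesgue_rV R d).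
Implicit Types (u v phi : rV -> R) (s : seq 'I_d).

(* Iterated classical partial derivative along the multi-index s, a list of
   coordinate directions. *)
Definition partial s phi : rV -> R :=
  foldr (fun i f => 'D_(delta_mx ord0 i) f) phi s.

Definition smooth phi := forall s,
  continuous (partial s phi) /\
  forall x i, derivable (partial s phi) x (delta_mx ord0 i).

Definition test_function phi :=
  smooth phi /\ compact (closure [set x | phi x != 0]).

Definition locally_integrable_rV u :=
  measurable_fun setT u /\
  forall K, compact K -> (\int[mu]_(x in K) `|u x|%:E < +oo)%E.

Definition is_weak_partial u s v :=
  [/\ locally_integrable_rV u, locally_integrable_rV v &
      forall phi, test_function phi ->
        \int[mu]_x (u x * partial s phi x) =
        (-1) ^+ size s * \int[mu]_x (v x * phi x)].

(* The weak partial derivative, which is unique almost everywhere; junk value 0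
   when it does not exist. *)
Definition weak_partial u s : rV -> R :=
  xget (fun=> 0) [set v | is_weak_partial u s v].

(* Pointwise Euclidean norm of the order-i tensor of weak partial derivatives,
   an element of R^(d^i). *)
Definition weak_tensor_norm u (i : nat) (x : rV) : R :=
  Num.sqrt (\sum_(s : i.-tuple 'I_d) weak_partial u s x ^+ 2).

Definition sobolev_W1 (k : nat) u :=
  mu.-integrable setT (EFin \o u) /\
  forall s, (1 <= size s <= k)%N ->
    (exists v, is_weak_partial u s v) /\
    mu.-integrable setT (EFin \o weak_partial u s).

Definition sobolev_W1_norm (k : nat) u : \bar R :=
  ('N[mu]_1[EFin \o u] +
   \sum_(1 <= i < k.+1) 'N[mu]_1[EFin \o weak_tensor_norm u i])%E.

End weak_derivatives.

(* Main.v *)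
(** Idea. Cut R^d into dyadic boxes of volume 2^-n, halving one coordinate at a
    time; with q = 2^(-1/d), the sides of a box of level n are comparable to
    q^n. Say that u is dominated to order k at cost A if |u| <= sum_n g_n almost
    everywhere, where g_n >= 0 is constant on the boxes of level n and
    sum_n q^(-nk) int g_n <= A. Replacing the value c of g_n on each box by c
    times a smooth bump adapted to that box gives a majorant v >= |u| whose
    W^(k,1) norm is at most C A, and then u = v - (v - u). So it suffices that
    u is dominated to order k at a cost bounded by its W^(k,1) norm, which goes
    by induction on k.

    For k = 1, take for g_n the increments of the running maximum of a quantile
    of |u| on the boxes of level n. Where such an increment is positive, |u|
    truncated between the two successive maxima is small on half of the box and
    large on a quarter of it, so the increment is bounded by the oscillation of
    the truncated function there; the oscillations of the different layers add
    up to at most those of |u|, which the gradient controls at every scale.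

    For the induction step, telescoping the averages E_n u over the boxes gives
    |u| <= E_0 |u| + 2 sum_n q^n E_n |grad u|, in which the gradient is replaced
    by its own layers g_m: for m <= n averaging does nothing and the factors q^n
    sum to a multiple of q^m, while for m > n the average E_n g_m is a layer of
    level n. *)

Require Import Defs.
From HB Require Import structures.
From mathcomp Require Import all_boot all_order all_algebra.
From mathcomp Require Import all_classical all_reals all_analysis.
From mathcomp Require Import measurable_realfun zify ring lra.
Import Order.TTheory GRing.Theory Num.Theory.
Import numFieldNormedType.Exports.
Set Implicit Arguments.
Unset Strict Implicit.
Unset Printing Implicit Defensive.

Local Open Scope classical_set_scope.
Local Open Scope ring_scope.

(** For k = 1 the positive and negative parts of u already answer the question; from order 2 on,
    truncation produces derivatives that need not be functions, hence the detour through a smooth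
    majorant of |u|. Domination is a stronger property than the decomposition, and order 1 is where
    the induction has to start. Coarsening a layer of level m to every level n < m costs sum_(n<m)
    q^(-nk): this is geometric, of size q^(-mk), when k >= 1, but equals m when k = 0. The averaging
    step therefore cannot lead from order 0 to order 1. At order 1 quantiles replace averages
    because they survive truncation: a jump of the running maximum from a to b is still visible once
    |u| is cut to the values between a and b. Each level is thus charged to its own slice of |u|,
    and slices with disjoint ranges have oscillations that add up. Halving one coordinate at a time
    turns the passage from level n to n + 1 into the comparison of two neighbouring half boxes, for
    which one family of test functions is enough: a tent across the cut, nearly an indicator in the
    other directions. *)

Arguments lebesgue_rV {R} n : simpl never.

(** * Smooth functions of one variable *)

Section smooth_line.
Context {R : realType}.
Implicit Types (f g : R -> R) (P : {poly R}).

Variant smooth1 f : Prop :=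
  Smooth1 of (forall n (t : R), derivable (derive1n n f) t 1).

Lemma smooth1_der f n (t : R) : smooth1 f -> derivable (derive1n n f) t 1.
Proof. by case. Qed.

(** A coinduction principle: a class of differentiable functions that is stable under derivation
    contains all the iterated derivatives of its members. *)
Lemma smooth1P (K : (R -> R) -> Prop) :
  (forall f, K f -> (forall t : R, derivable f t 1) /\ K (derive1 f)) ->
  forall f, K f -> smooth1 f.
Proof.
move=> KP f Kf; split=> n; suff Kn : K ((derive1n n f)) by case: (KP _ Kn).
elim: n => [//|n IH]; rewrite derive1nS; by case: (KP _ IH).
Qed.

Lemma smooth1_derive f : smooth1 f -> smooth1 (derive1 f).
Proof. by move=> sf; split=> n t; rewrite -derive1Sn; exact: smooth1_der. Qed.

Lemma smooth1_derivable f (t : R) : smooth1 f -> derivable f t 1.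
Proof. exact: (@smooth1_der _ 0%N t). Qed.

Lemma smooth1_is_derive f (t : R) : smooth1 f -> is_derive t 1 f ((derive1 f) t).
Proof.
by move=> /(@smooth1_derivable _ t) /derivableP; rewrite derive1E.
Qed.

Lemma smooth1_continuous f n : smooth1 f -> continuous ((derive1n n f)).
Proof.
move=> sf t; apply: differentiable_continuous; apply/derivable1_diffP; exact: smooth1_der.
Qed.

(** The closure of the smooth functions under the operations used below. The first-order derivation
    rules stay inside it, so it can serve as the class [K] of [smooth1P]. *)
Inductive smooth_gen : (R -> R) -> Prop :=
| SmoothBase f of smooth1 f : smooth_gen f
| SmoothAdd f g of smooth_gen f & smooth_gen g : smooth_gen (fun t => f t + g t)
| SmoothMul f g of smooth_gen f & smooth_gen g : smooth_gen (fun t => f t * g t)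
| SmoothAff f (a b : R) of smooth_gen f : smooth_gen (fun t => f (a * t + b)).

Lemma smooth1_cst (c : R) : smooth1 (cst c).
Proof.
apply: (@smooth1P (fun f => exists c, f = cst c)); last by exists c.
move=> _ [e ->]; split=> [t|]; first exact: derivable_cst.
by exists 0; apply/funext => t; rewrite derive1_cst.
Qed.

Lemma is_derive_affine f (a b t : R) df : is_derive (a * t + b) 1 f df ->
  is_derive t 1 (fun t => f (a * t + b)) (a * df).
Proof.
move=> h.
have hg : is_derive t 1 (fun t : R => a * t + b) a.
  rewrite (_ : (fun t : R => a * t + b) = (a *: id) + cst b); last exact/funext.
  by apply: is_derive_eq; rewrite addr0 /GRing.scale/= mulr1.
have hc := @is_derive1_comp _ f (fun t : R => a * t + b) t df a h hg.
by apply: is_derive_eq; rewrite mulrC.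
Qed.

Lemma smooth_genP f : smooth_gen f ->
  (forall t : R, derivable f t 1) /\ smooth_gen (derive1 f).
Proof.
elim=> {f} [f sf|f g sf [df sf'] sg [dg sg']|f g sf [df sf'] sg [dg sg']|f a b sf [df sf']].
- split; first by move=> t; exact: smooth1_derivable.
  exact/SmoothBase/smooth1_derive.
- have h (t : R) : is_derive t 1 (fun t => f t + g t) ((derive1 f) t + (derive1 g) t).
    have := df t; have := dg t; move=> /derivableP hg /derivableP hf.
    by rewrite !derive1E; exact: is_deriveD.
  split; first by move=> t; have [] := h t.
  rewrite (_ : (derive1 _) = fun t => (derive1 f) t + (derive1 g) t); first exact: SmoothAdd.
  by apply/funext => t; rewrite derive1E derive_val.
- have h (t : R) : is_derive t 1 (fun t => f t * g t) (f t * (derive1 g) t + g t * (derive1 f) t).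
    have := df t; have := dg t; move=> /derivableP hg /derivableP hf.
    by rewrite !derive1E; exact: is_deriveM.
  split; first by move=> t; have [] := h t.
  rewrite (_ : (derive1 _) = fun t => f t * (derive1 g) t + g t * (derive1 f) t).
    by apply: SmoothAdd; apply: SmoothMul.
  by apply/funext => t; rewrite derive1E derive_val.
- have h (t : R) : is_derive t 1 (fun t => f (a * t + b)) (a * (derive1 f) (a * t + b)).
    apply: is_derive_affine; have := df (a * t + b) => /derivableP.
    by rewrite derive1E.
  split; first by move=> t; have [] := h t.
  rewrite (_ : (derive1 _) = fun t => cst a t * (derive1 f) (a * t + b)).
    by apply: SmoothMul; [exact/SmoothBase/smooth1_cst|apply: (SmoothAff a b)].
  by apply/funext => t; rewrite derive1E derive_val.
Qed.

Lemma smooth_gen1 f : smooth_gen f -> smooth1 f.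
Proof. exact/smooth1P/smooth_genP. Qed.

Lemma smooth1D f g : smooth1 f -> smooth1 g -> smooth1 (fun t => f t + g t).
Proof. by move=> *; apply: smooth_gen1; apply: SmoothAdd; exact: SmoothBase. Qed.

Lemma smooth1M f g : smooth1 f -> smooth1 g -> smooth1 (fun t => f t * g t).
Proof. by move=> *; apply: smooth_gen1; apply: SmoothMul; exact: SmoothBase. Qed.

Lemma smooth1_affine f a b : smooth1 f -> smooth1 (fun t => f (a * t + b)).
Proof. by move=> *; apply: smooth_gen1; apply: SmoothAff; exact: SmoothBase. Qed.

Lemma smooth1X f n : smooth1 f -> smooth1 (fun t => f t ^+ n).
Proof.
move=> sf; elim: n => [|n IH].
  by rewrite (_ : (fun _ => _) = cst 1); [exact: smooth1_cst|apply/funext].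
by rewrite (_ : (fun _ => _) = (fun t => f t * f t ^+ n));
  [exact: smooth1M|apply/funext => t; rewrite exprS].
Qed.

Lemma derive1n_affine f a b n : smooth1 f ->
  derive1n n (fun t => f (a * t + b)) = (fun t => a ^+ n * (derive1n n f) (a * t + b)).
Proof.
move=> sf; elim: n => [|n IH].
  by apply/funext => t; rewrite !derive1n0 expr0 mul1r.
apply/funext => t; rewrite derive1nS IH derive1E.
have h : is_derive t 1 (fun t => (derive1n n f) (a * t + b)) (a * (derive1n n.+1 f) (a * t + b)).
  apply: is_derive_affine; have := @smooth1_der _ n (a * t + b) sf => /derivableP.
  by rewrite derive1nS derive1E.
have -> : (fun t => a ^+ n * (derive1n n f) (a * t + b)) =
  a ^+ n *: (fun t => (derive1n n f) (a * t + b)) by apply/funext.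
by rewrite derive_val /GRing.scale/= mulrA -exprSr.
Qed.

(* The functions t |-> P(1/t) exp(-1/t), extended by 0 to t <= 0: this family is
   closed under derivation. *)
Definition flat P (t : R) : R := if 0 < t then P.[t^-1] * expR (- t^-1) else 0.

(** With [n] the size of [P], the exponential beats [y ^+ n.+2] for [y = t^-1]; the polynomial grows
    at most like [y ^+ n], so [t ^+ 2] is left over. This makes the difference quotient of [flat P]
    at 0 tend to 0. *)
Lemma flat_bound P : exists2 C : R, 0 <= C &
  forall t, 0 < t <= 1 -> `|flat P t| <= C * t ^+ 2.
Proof.
pose S := \sum_(i < size P) `|P`_i|; pose n := size P.
exists (S * (n.+2)`!%:R); first by rewrite mulr_ge0// sumr_ge0.
move=> t /andP[t0 t1]; rewrite /flat t0 normrM; set y := t^-1.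
have y1 : 1 <= y by rewrite invf_ge1.
have y0 : 0 < y by rewrite invr_gt0.
have hP : `|P.[y]| <= S * y ^+ n.
  rewrite horner_coef (le_trans (ler_norm_sum _ _ _))// mulr_suml ler_sum// => i _.
  rewrite normrM ler_wpM2l// normrX gtr0_norm// ler_weXn2l// ltnW//.
have he : `|expR (- y)| <= (n.+2)`!%:R * y ^- n.+2.
  rewrite gtr0_norm ?expR_gt0// expRN -[leRHS]invrK lef_pV2 ?posrE ?expR_gt0//; last first.
    by rewrite invr_gt0 mulr_gt0 ?invr_gt0 ?exprn_gt0// ltr0n fact_gt0.
  rewrite invfM invrK mulrC.
  by apply: le_trans (expR_ge1Dxn n.+1 (ltW y0)); rewrite lerDr.
apply: (le_trans (ler_pM _ _ hP he)) => //.
rewrite mulrACA.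
rewrite ler_wpM2l//; first by rewrite mulr_ge0// sumr_ge0.
rewrite -addn2 exprD invfM mulrA divff ?gt_eqF ?exprn_gt0//.
by rewrite mul1r /y exprVn invrK.
Qed.

Lemma is_derive_flat P (t : R) : is_derive t 1 (flat P) (flat ('X^2 * (P - (P^`()))) t).
Proof.
have [t0|t0|->] := ltgtP t 0.
- rewrite /(flat _ t) ltNge ltW//=.
  apply: (@near_eq_is_derive _ _ _ (cst 0)).
  near=> s; rewrite /flat ifF//; apply/negbTE; rewrite -leNgt ltW//.
  by near: s; exact: lt_nbhsl.
- apply: (@near_eq_is_derive _ _ _ ((horner P \o GRing.inv) * (fun s => expR (- s^-1)))).
    near=> s; rewrite /flat ifT//; near: s; exact: lt_nbhsr.
  have hi : is_derive t 1 (@GRing.inv R) (- t ^- 2).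
    apply: is_derive_eq; first exact: (@is_deriveV _ id t 1 1 (lt0r_neq0 t0)).
    by rewrite /GRing.scale/= mulr1.
  have h1 := is_derive1_comp (is_derive_poly P t^-1) hi.
  have h2 : is_derive t 1 (fun s => - s^-1) (t ^- 2).
    by apply: is_derive_eq; rewrite opprK.
  have h3 := @is_derive1_comp _ expR (fun s : R => - s^-1) t _ _ (is_derive_expR (- t^-1)) h2.
  have h4 := is_deriveM h1 h3.
  refine (@is_derive_eq _ _ _ _ _ _ _ _ h4 _).
  rewrite /flat t0 !hornerE /= /GRing.scale/= exprVn.
  rewrite /comp; ring.
- have -> : flat ('X^2 * (P - (P^`()))) 0 = 0 by rewrite /flat ltxx.
  have [C C0 HC] := flat_bound P.
  have hl : (fun h : R => h^-1 *: (flat P (h *: 1 + 0) - flat P 0)) @ 0^' --> (0 : R).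
    apply/cvgr0Pnorm_le => e e0; near=> h.
    have h1 : `|h| <= 1 by near: h; exact: dnbhs0_le.
    have h2 : `|h| <= e / (C + 1).
      by near: h; apply: dnbhs0_le; rewrite divr_gt0// ltr_wpDl.
    rewrite addr0 {2}/flat ltxx subr0 /GRing.scale/= mulr1 normrM normfV.
    have [h0|h0] := leP h 0.
      by rewrite /flat ltNge h0/= normr0 mulr0 ltW.
    rewrite (gtr0_norm h0) in h1 h2 *.
    rewrite mulrC ler_pdivrMr//.
    apply: (le_trans (HC h _)); first by rewrite h0.
    rewrite expr2 mulrA ler_pM2r//; move: h2; rewrite ler_pdivlMr ?ltr_wpDl//.
    by nra.
  split; last exact/cvg_lim.
  by apply/cvg_ex; exists 0.
Unshelve. all: by end_near. Qed.

Lemma smooth1_flat P : smooth1 (flat P).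
Proof.
apply: (@smooth1P (fun f => exists P, f = flat P)); last by exists P.
move=> _ [Q ->]; split=> [t|].
  by have [] := is_derive_flat Q t.
exists ('X^2 * (Q - (Q^`()))); apply/funext => t.
by rewrite derive1E; have [_ ->] := is_derive_flat Q t.
Qed.

Lemma smooth1_eq f g : f =1 g -> smooth1 f -> smooth1 g.
Proof. by move=> /funext ->. Qed.

Definition bell (a b t : R) : R := flat 1 (t - a) * flat 1 (b - t).

Lemma smooth1_bump a b : smooth1 (bell a b).
Proof.
have h1 : smooth1 (fun t => flat 1 (t - a)).
  by apply: (@smooth1_eq _ _ _ (@smooth1_affine _ 1 (- a) (smooth1_flat _))) => t; rewrite mul1r.
have h2 : smooth1 (fun t => flat 1 (b - t)).
  by apply: (@smooth1_eq _ _ _ (@smooth1_affine _ (-1) b (smooth1_flat _))) => t; rewrite mulN1r addrC.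
exact: smooth1M h1 h2.
Qed.

Lemma flat1_ge0 t : 0 <= flat 1 t.
Proof. by rewrite /flat; case: ifP => // _; rewrite hornerC mul1r expR_ge0. Qed.

Lemma flat1_gt0 t : 0 < t -> 0 < flat 1 t.
Proof. by move=> t0; rewrite /flat t0 hornerC mul1r expR_gt0. Qed.

Lemma flat1_lt1 t : flat 1 t < 1.
Proof.
by rewrite /flat; case: ifP => // t0; rewrite hornerC mul1r expR_lt1 oppr_lt0 invr_gt0.
Qed.

Lemma flat1_le0 t : t <= 0 -> flat 1 t = 0.
Proof. by move=> t0; rewrite /flat ltNge t0. Qed.

Lemma flat1_nd s t : s <= t -> flat 1 s <= flat 1 t.
Proof.
move=> st; have [s0|s0] := leP s 0; first by rewrite (flat1_le0 s0) flat1_ge0.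
have t0 := lt_le_trans s0 st.
by rewrite /flat s0 t0 !hornerC !mul1r ler_expR lerN2 lef_pV2.
Qed.

Lemma bump_ge0 a b t : 0 <= bell a b t.
Proof. by rewrite mulr_ge0 ?flat1_ge0. Qed.

Lemma bump_lt1 a b t : bell a b t < 1.
Proof. by rewrite mulr_ilt1 ?flat1_ge0 ?flat1_lt1. Qed.

Lemma bump_gt0 a b t : a < t < b -> 0 < bell a b t.
Proof. by case/andP=> *; rewrite mulr_gt0// flat1_gt0// subr_gt0. Qed.

Lemma bump_eq0 a b t : ~~ (a < t < b) -> bell a b t = 0.
Proof.
rewrite negb_and -!leNgt => /orP[h|h]; rewrite /bell.
  by rewrite flat1_le0 ?mul0r// subr_le0.
by rewrite [X in _ * X]flat1_le0 ?mulr0// subr_le0.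
Qed.

(* Since [0 <= bell < 1] with [bell > 0] exactly on the open interval, these
   smooth functions converge pointwise to the indicator of ]a, b[. *)
Definition plateau (m : nat) (a b t : R) : R := 1 - (1 - bell a b t) ^+ m.

Lemma smooth1_plateau m a b : smooth1 (plateau m a b).
Proof.
have h1 : smooth1 (fun t => 1 + (-1) * bell a b t).
  by apply: smooth1D; [exact: smooth1_cst|apply: smooth1M;
    [exact: smooth1_cst|exact: smooth1_bump]].
have h2 : smooth1 (fun t => 1 + (-1) * (1 + (-1) * bell a b t) ^+ m).
  by apply: smooth1D; [exact: smooth1_cst|apply: smooth1M;
    [exact: smooth1_cst|exact: smooth1X]].
by apply: (@smooth1_eq _ _ _ h2) => t; rewrite !mulN1r.
Qed.

Lemma plateau_ge0 m a b t : 0 <= plateau m a b t.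
Proof.
rewrite subr_ge0 exprn_ile1 ?subr_ge0 ?gerBl ?bump_ge0//.
by rewrite ltW// bump_lt1.
Qed.

Lemma plateau_le1 m a b t : plateau m a b t <= 1.
Proof. by rewrite gerBl exprn_ge0// subr_ge0 ltW// bump_lt1. Qed.

Lemma plateau_eq0 m a b t : ~~ (a < t < b) -> plateau m a b t = 0.
Proof. by move=> /bump_eq0 h; rewrite /plateau h subr0 expr1n subrr. Qed.

Lemma plateau_cvg a b t : plateau m a b t @[m --> \oo] --> (\1_`]a, b[ t : R).
Proof.
rewrite indicE mem_setE in_itv/=; have [h|h] := boolP (a < t < b).
  rewrite -[X in _ --> X]subr0.
  apply: cvgB; first exact: cvg_cst.
  apply: cvg_expr; rewrite ger0_norm; first by rewrite gtrBl bump_gt0.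
  by rewrite subr_ge0 ltW// bump_lt1.
rewrite (_ : (fun m => plateau m a b t) = cst 0); first exact: cvg_cst.
by apply/funext => m; rewrite plateau_eq0.
Qed.

Lemma smooth1_MVT f (x y : R) : smooth1 f -> x <= y ->
  exists2 c, x <= c <= y & f y - f x = derive1 f c * (y - x).
Proof.
move=> sf xy.
have [||c] := @MVT_segment _ f (derive1 f) x y xy.
- by move=> z _; exact: smooth1_is_derive.
- exact/continuous_subspaceT/(@smooth1_continuous f 0%N).
by rewrite in_itv => cxy ->; exists c.
Qed.

Lemma plateau_integrable m a b u :
  lebesgue_measure.-integrable `]-oo, u] (EFin \o plateau m a b).
Proof.
have cp : continuous (plateau m a b).
  exact: (@smooth1_continuous _ 0%N (smooth1_plateau m a b)).
have mp : measurable_fun setT (plateau m a b) by exact: continuous_measurable_fun.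
apply: (integrableS measurableT) => //.
have hb : lebesgue_measure.-integrable setT (EFin \o \1_`]a, b[ : R -> \bar R).
  exact: integrable_indic_itv.
apply: (le_integrable _ _ _ hb) => //; first exact/measurable_EFinP.
move=> t _ /=; rewrite lee_fin ger0_norm ?plateau_ge0// indicE mem_setE in_itv/=.
have [h|h] := boolP (a < t < b); first by rewrite normr1 plateau_le1.
by rewrite plateau_eq0// normr0.
Qed.

(** The primitive is normalised to vanish at [a]. It is constant where the plateau is zero and, the
    plateau being at most 1, rises by at most [b - a]. *)
Lemma plateau_primitive m a b : a <= b -> exists F : R -> R,
  [/\ smooth1 F, derive1 F = plateau m a b,
      {homo F : s t / s <= t},
      (forall t, t <= a -> F t = 0) & forall t, b <= t -> F t = F b /\ F b <= b - a].
Proof.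
move=> ab; pose F t := (\int[lebesgue_measure]_(s in `]-oo, t]) plateau m a b s)%R.
have FP (t : R) : derivable F t 1 /\ derive1 F t = plateau m a b t.
  apply: (@continuous_FTC1 _ _ -oo%O t (t + 1)) => //.
  - by rewrite ltrDl.
  - exact: plateau_integrable.
  - exact: ltNyr.
  - exact: (@smooth1_continuous _ 0%N (smooth1_plateau m a b) t).
have dF : derive1 F = plateau m a b by apply/funext => t; case: (FP t).
have sF : smooth1 F.
  split=> -[|n] t; first by case: (FP t).
  by rewrite derive1Sn dF; apply: smooth1_der; exact: smooth1_plateau.
have Fnd : {homo F : s t / s <= t}.
  move=> s t st; have [c _ h] := smooth1_MVT sF st.
  by rewrite -subr_ge0 h dF mulr_ge0 ?plateau_ge0 ?subr_ge0.
exists (fun t => F t - F a).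
have dF' : derive1 (fun t => F t - F a) = plateau m a b.
  apply/funext => t; rewrite derive1E.
  have h : is_derive t 1 (fun t => F t - F a) (derive1 F t - 0).
    by apply: is_deriveB; exact: smooth1_is_derive.
  by rewrite derive_val subr0 dF.
split=> //.
- by apply: smooth1D => //; exact: (smooth1_cst (- F a)).
- by move=> s t st; rewrite lerD2r Fnd.
- move=> t ta; have [c /andP[_ ca] h] := smooth1_MVT sF ta.
  apply/eqP; rewrite subr_eq0 eq_sym -subr_eq0 h dF plateau_eq0 ?mul0r//.
  by rewrite negb_and -!leNgt ca.
- move=> t bt; split.
    have [c /andP[bc _] h] := smooth1_MVT sF bt.
    apply/eqP; rewrite (inj_eq (addIr _)) -subr_eq0 h dF plateau_eq0 ?mul0r//.
    by rewrite negb_and -!leNgt bc orbT.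
  have [c _ ->] := smooth1_MVT sF ab.
  by rewrite dF ler_piMl ?subr_ge0 ?plateau_le1.
Qed.

(** [T] is the primitive of a plateau minus its translate by [l]. As [m] grows, its derivative tends
    to the indicator of one interval minus that of the next one; its height [l] becomes the length
    factor in [box_difference]. *)
Lemma smooth_tent m (a l : R) : 0 <= l -> exists T : R -> R,
  [/\ smooth1 T,
      forall t, derive1 T t = plateau m a (a + l) t - plateau m a (a + l) (t - l),
      forall t, 0 <= T t <= l & forall t, ~~ (a < t < a + 2 * l) -> T t = 0].
Proof.
move=> l0; have al : a <= a + l by rewrite lerDl.
have [F [sF dF ndF Fa Fb]] := plateau_primitive m al.
have sG : smooth1 (fun t => F (1 * t + - l)) by exact: smooth1_affine.
have F0 t : 0 <= F t.
  have [ta|ta] := leP t a; first by rewrite Fa.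
  by rewrite -(Fa _ (lexx a)) ndF// ltW.
have Fl t : F t <= l.
  have [_ h0] := Fb _ (lexx _); have h : F (a + l) <= l by lra.
  have [tb|tb] := leP t (a + l); first by rewrite (le_trans (ndF _ _ tb)).
  by have [-> _] := Fb _ (ltW tb).
exists (fun t => F t - F (1 * t + - l)); split.
- have h : smooth1 (fun t => F t + (-1) * F (1 * t + - l)).
    by apply: smooth1D => //; apply: smooth1M => //; exact: smooth1_cst.
  by apply: (@smooth1_eq _ _ _ h) => t; rewrite mulN1r.
- move=> t; rewrite derive1E.
  have h : is_derive t 1 (fun t => F t - F (1 * t + - l))
     (derive1 F t - 1 * derive1 F (1 * t + - l)).
    by apply: is_deriveB; [exact: smooth1_is_derive|
      apply: is_derive_affine; exact: smooth1_is_derive].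
  by rewrite derive_val dF !mul1r.
- move=> t; rewrite mul1r subr_ge0 ndF ?gerBl//=.
  by rewrite (le_trans _ (Fl t))// gerBl.
- move=> t; rewrite negb_and -!leNgt mul1r => /orP[h|h].
    by rewrite !Fa ?subrr// (le_trans _ h)// gerBl.
  have [-> _] := Fb (t - l) ltac:(lra).
  by have [-> _] := Fb t ltac:(lra); rewrite subrr.
Qed.

End smooth_line.

(** * Product test functions *)

Section product_functions.
Context {R : realType} {d : nat}.
Local Notation rV := 'rV[R]_d.
Implicit Types (f : 'I_d -> R -> R) (s : seq 'I_d).
Local Notation dir i := (delta_mx ord0 i : rV).

Lemma is_derive_line (g : rV -> R) (x v : rV) (dg : R) :
  is_derive (0 : R) 1 (fun h => g (h *: v + x)) dg -> is_derive x v g dg.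
Proof.
move=> [d1 d2]; split; first exact: (derivable1P g x v).2.
rewrite -d2 /derive; set g1 := fun h => h^-1 *: _; set g2 := fun h => h^-1 *: _.
suff -> : g1 = g2 by [].
by apply/funext => h; rewrite /g1 /g2 /= addr0 scale0r add0r [_%:A]mulr1.
Qed.

Lemma line_coord (h : R) (x : rV) i j :
  (h *: dir i + x) ord0 j = h *+ (i == j) + x ord0 j.
Proof. by rewrite !mxE eqxx/= [j == i]eq_sym; case: (i == j); rewrite ?mulr1 ?mulr0. Qed.

Definition prodf f (x : rV) : R := \prod_(i < d) f i (x ord0 i).

Definition dern f s i := derive1n (count_mem i s) (f i).

Lemma is_derive_prodf f (x : rV) i : (forall j, smooth1 (f j)) ->
  is_derive x (dir i) (prodf f)
    (prodf (fun j => if j == i then derive1 (f j) else f j) x).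
Proof.
move=> sf; apply: is_derive_line.
pose c := \prod_(j < d | j != i) f j (x ord0 j).
have -> : (fun h => prodf f (h *: dir i + x)) =
          c *: (fun h : R => f i (1 * h + x ord0 i)).
  apply/funext => h; transitivity (c * f i (1 * h + x ord0 i)) => //.
  rewrite /prodf (bigD1 i)//= mulrC line_coord eqxx mul1r.
  congr (_ * _); apply: eq_bigr => j ji; rewrite line_coord eq_sym (negbTE ji).
  by rewrite add0r.
rewrite /prodf (bigD1 i)//= eqxx mulrC.
rewrite (eq_bigr (fun j => f j (x ord0 j))); last by move=> j /negbTE ->.
have h : is_derive (0 : R) 1 (fun h : R => f i (1 * h + x ord0 i)) (1 * derive1 (f i) (x ord0 i)).
  apply: is_derive_affine; rewrite mulr0 add0r; exact: smooth1_is_derive.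
by rewrite mul1r in h; apply: is_deriveZ.
Qed.

Lemma partial_prodf f s : (forall j, smooth1 (f j)) ->
  partial s (prodf f) = prodf (dern f s).
Proof.
move=> sf; elim: s => [//|i s IH].
rewrite /= -/(partial s _) IH; apply/funext => x.
have sf' j : smooth1 (dern f s j).
  by split=> n t; rewrite /dern /derive1n -iterD; exact: (@smooth1_der _ _ (n + _)%N).
have [_ ->] := is_derive_prodf x i sf'.
apply: eq_bigr => j _; rewrite /dern /= (eq_sym i j); case: (j == i).
  by rewrite add1n derive1nS.
by rewrite add0n.
Qed.

Lemma smooth1_dern f s j : smooth1 (f j) -> smooth1 (dern f s j).
Proof.
move=> sf; split=> n t.
rewrite /dern /derive1n -iterD; exact: (@smooth1_der _ _ (n + _)%N).
Qed.

Lemma continuous_prodf f : (forall j, continuous (f j)) -> continuous (prodf f).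
Proof.
move=> cf; apply: continuous_big => //; first exact: mul_continuous.
move=> i _ x; apply: continuous_comp; last exact: cf.
exact: coord_continuous.
Qed.

Lemma smooth_prodf f : (forall j, smooth1 (f j)) -> smooth (prodf f).
Proof.
move=> sf s; rewrite partial_prodf//; split.
  by apply: continuous_prodf => j; exact: smooth1_continuous.
move=> x i.
by have [] := is_derive_prodf x i (fun j => smooth1_dern s (sf j)).
Qed.

Lemma box_compact (a b : 'I_d -> R) :
  compact [set x : rV | forall i, `[a i, b i]%classic (x ord0 i)].
Proof.
by apply: (@rV_compact _ _ (fun i => `[a i, b i]%classic)) => i; exact: segment_compact.
Qed.

Lemma test_prodf f (a b : 'I_d -> R) : (forall j, smooth1 (f j)) ->
  (forall j t, ~~ (a j < t < b j) -> f j t = 0) -> test_function (prodf f).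
Proof.
move=> sf f0; split; first exact: smooth_prodf.
apply: (subclosed_compact _ (@box_compact a b)); first exact: closed_closure.
rewrite closureE; apply: smallest_sub.
  by apply: compact_closed; [exact: norm_hausdorff|exact: box_compact].
move=> x /= /eqP fx i; rewrite in_itv/=; apply/negPn/negP => h.
apply: fx; rewrite /prodf (bigD1 i)//= f0 ?mul0r//.
by apply: contra h => /andP[/ltW -> /ltW ->].
Qed.

End product_functions.

(** * Integer parts: doubling, distance, convexity *)

Section floor_facts.
Context {R : realType}.
Implicit Types s t : R.

Lemma floor_double s t : Num.floor (2 * s) = Num.floor (2 * t) ->
  Num.floor s = Num.floor t.
Proof.
move=> h; apply/le_anti; rewrite !floor_ge_int.
have aux (a b : R) : Num.floor (2 * a) = Num.floor (2 * b) -> (Num.floor a)%:~R <= b :> R.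
  move=> ab; have : (2 * (Num.floor a)%:~R : R) <= 2 * a by rewrite ler_pM2l// floor_le.
  rewrite (_ : 2 * _ = (2 * Num.floor a)%:~R); last by rewrite intrM.
  by rewrite -floor_ge_int ab floor_ge_int intrM ler_pM2l.
by rewrite !aux.
Qed.

Lemma floor_dist s t : Num.floor s = Num.floor t -> `|s - t| < 1.
Proof.
move=> st; have /andP[s1 s2] := floor_itv s; have /andP[t1 t2] := floor_itv t.
rewrite st intrD in s1 s2; rewrite intrD in t2.
by rewrite ltr_norml; apply/andP; split; lra.
Qed.

Lemma floor_between r s t : r <= s <= t -> Num.floor r = Num.floor t ->
  Num.floor s = Num.floor r.
Proof.
move=> /andP[rs st] rt; apply/le_anti; rewrite {1}rt !floor_ge_int.
rewrite (le_trans (floor_le _) st)/=.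
by rewrite (le_trans (floor_le _) rs).
Qed.

End floor_facts.

(** * Dyadic boxes *)

Section dyadic.
Context {R : realType} {d' : nat}.
Local Notation d := d'.+1.
Local Notation rV := 'rV[R]_d.
Local Notation mu := (@lebesgue_rV R d).
Implicit Types (n m : nat) (x y : rV) (i : 'I_d).

(* The dyadic boxes of level [n] are obtained by halving one coordinate at a
   time, the coordinate halved at step [n] being [spl n]. *)
Definition spl n : 'I_d := inord (n %% d).
Definition lev n i : nat := \sum_(l < n) (spl l == i).
Definition side n i : R := 2 ^- lev n i.
Definition cell n x i : int := Num.floor (2 ^+ lev n i * x ord0 i).
Definition box n x : set rV := [set y | cell n y =1 cell n x].
(** A box named by its integer position, which makes the boxes of a level countable; [box] names it
    by one of its points. *)
Definition dbox n (z : 'I_d -> int) : set rV := [set y | cell n y =1 z].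

Lemma levS n i : lev n.+1 i = (lev n i + (spl n == i))%N.
Proof. by rewrite /lev big_ord_recr. Qed.

Lemma lev0 i : lev 0 i = 0%N. Proof. by rewrite /lev big_ord0. Qed.

Lemma sum_lev n : (\sum_i lev n i = n)%N.
Proof.
elim: n => [|n IH]; first by rewrite big1// => i _; rewrite lev0.
under eq_bigr do rewrite levS; rewrite big_split/= IH.
rewrite (bigD1 (spl n))//= eqxx big1 ?addn0 ?addn1// => i ne.
by rewrite eq_sym (negbTE ne).
Qed.

Lemma spl_addd n : spl (n + d) = spl n.
Proof. by rewrite /spl modnDr. Qed.

Lemma lev_d i : lev d i = 1%N.
Proof.
rewrite /lev (bigD1 i)//= big1 ?addn0; last first.
  move=> j ji; rewrite /spl modn_small//.
  by rewrite (_ : inord j = j) ?(negbTE ji)//; apply/val_inj; rewrite /= inordK.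
rewrite /spl modn_small// (_ : inord i = i) ?eqxx//.
by apply/val_inj; rewrite /= inordK.
Qed.

Lemma lev_addd n i : lev (n + d) i = (lev n i).+1.
Proof.
elim: n => [|n IH]; first by rewrite add0n lev_d lev0.
by rewrite addSn !levS IH spl_addd.
Qed.

Lemma lev_mono m n i : (m <= n)%N -> (lev m i <= lev n i)%N.
Proof.
move=> /subnK <-; elim: (n - m)%N => [//|k IH].
by rewrite addSn levS (leq_trans IH)// leq_addr.
Qed.

(** Coordinates are halved cyclically, so after [n] steps each one has been halved [n %/ d] or
    [n %/ d + 1] times. This is what keeps the boxes of bounded shape, all sides being comparable to
    the [n]-th power of the rate. *)
Lemma lev_bounds n i : (d * lev n i <= n + d /\ n <= d * (lev n i).+1)%N.
Proof.
rewrite (divn_eq n d); set r := (n %% d)%N; set q := (n %/ d)%N.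
have rd : (r < d)%N by rewrite ltn_mod.
have er : (lev r i <= 1)%N by rewrite -(lev_d i) lev_mono// ltnW.
have -> : lev (q * d + r) i = (q + lev r i)%N.
  by elim: q => [//|q IH]; rewrite mulSn -addnA [X in lev X _]addnC lev_addd IH addSn.
split.
  rewrite mulnDr (mulnC d q) -addnA leq_add2l.
  by rewrite (leq_trans (leq_mul (leqnn d) er))// muln1 leq_addl.
apply: (@leq_trans (d * q.+1)%N); last by rewrite leq_mul2l ltnS leq_addr orbT.
by rewrite (mulnS d) addnC (mulnC q) leq_add2r ltnW.
Qed.

Lemma side_gt0 n i : 0 < side n i.
Proof. by rewrite invr_gt0 exprn_gt0. Qed.

Lemma box_eq n x y : box n x y -> box n y = box n x.
Proof. by move=> h; apply/seteqP; split=> z zx i; rewrite zx h. Qed.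

Lemma box_dbox n x : box n x = dbox n (cell n x). Proof. by []. Qed.

Lemma cellS n x y i : cell n.+1 x i = cell n.+1 y i -> cell n x i = cell n y i.
Proof.
rewrite /cell levS; case: (spl n == i); last by rewrite addn0.
by rewrite addn1 exprS -!mulrA => /floor_double.
Qed.

Lemma boxS n x : box n.+1 x `<=` box n x.
Proof. by move=> y h i; apply: cellS; exact: h. Qed.

Lemma box_sub m n x : (m <= n)%N -> box n x `<=` box m x.
Proof.
move=> /subnK <-; elim: (n - m)%N => [//|k IH].
by rewrite addSn; apply: subset_trans IH; exact: boxS.
Qed.

Lemma dbox_prod n z : dbox n z = [set x | forall i,
  `[(z i)%:~R * side n i, (z i + 1)%:~R * side n i[%classic (x ord0 i)].
Proof.
apply/seteqP; split=> x h i; have := h i; rewrite /= /cell in_itv/= /side.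
  move=> <-; rewrite ler_pdivrMr ?exprn_gt0// ltr_pdivlMr ?exprn_gt0// mulrC.
  exact: floor_itv.
rewrite ler_pdivrMr ?exprn_gt0// ltr_pdivlMr ?exprn_gt0// mulrC.
exact: floor_def.
Qed.

Lemma measurable_rV_prod (A : 'I_d -> set (measurableTypeR R)) : (forall i, measurable (A i)) ->
  measurable [set x : rV | forall i, A i (x ord0 i)].
Proof.
move=> mA; rewrite (_ : mkset _ = \bigcap_(i in [set: 'I_d])
      ((fun x : rV => x ord0 i) @^-1` A i)).
  apply: fin_bigcap_measurable => // i _.
  by rewrite -[X in measurable X]setTI; exact: measurable_coord.
by apply/seteqP; split => [x Ax i _|x Ax i]; exact: Ax.
Qed.

Lemma measurable_dbox n z : measurable (dbox n z).
Proof.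
rewrite dbox_prod.
apply: (@measurable_rV_prod (fun i => `[(z i)%:~R * side n i, (z i + 1)%:~R * side n i[%classic)).
by move=> i; exact: measurable_itv.
Qed.

Lemma measurable_box n x : measurable (box n x).
Proof. exact: measurable_dbox. Qed.

Lemma mu_itv_prod (a h : 'I_d -> R) : (forall i, 0 <= h i) ->
  mu [set x | forall i, `[a i, a i + h i[%classic (x ord0 i)] =
  (\prod_i h i)%:E.
Proof.
move=> h0; rewrite (@lebesgue_rV_box R d (fun i => `[a i, a i + h i[%classic))//.
rewrite -prodEFin; apply: eq_bigr => i _.
rewrite lebesgue_measure_itv/= lte_fin ltrDl.
have [hi|hi] := ltP 0 (h i); first by rewrite -EFinB addrC addKr.
by congr EFin; apply/le_anti; rewrite hi h0.
Qed.

Lemma prod_side n : \prod_i side n i = 2 ^- n.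
Proof.
rewrite /side prodfV; congr GRing.inv.
by rewrite -[in RHS](sum_lev n) expr_sum.
Qed.

Lemma mu_dbox n z : mu (dbox n z) = (2 ^- n)%:E.
Proof.
rewrite dbox_prod -prod_side -(mu_itv_prod (fun i => (z i)%:~R * side n i)); last first.
  by move=> i; rewrite ltW// side_gt0.
by congr (mu _); apply/seteqP; split => x h i; have := h i; rewrite intrD mulrDl mul1r.
Qed.

Lemma mu_box n x : mu (box n x) = (2 ^- n)%:E.
Proof. exact: mu_dbox. Qed.

Lemma box_dist n x y i : box n x y -> `|x ord0 i - y ord0 i| < side n i.
Proof.
move=> /(_ i) /esym/floor_dist; rewrite -mulrBr normrM ger0_norm ?exprn_ge0// => h.
by rewrite /side -[X in _ < X]mul1r ltr_pdivlMr ?exprn_gt0// mulrC.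
Qed.

Lemma box_small x (e : R) : 0 < e -> exists n, box n x `<=` ball x e.
Proof.
move=> e0; have [k ke] : exists k, 2 ^- k < e :> R.
  have h : (2^-1 : R) ^+ k @[k --> \oo] --> (0 : R).
    by apply: cvg_expr; rewrite ger0_norm ?invr_ge0// invf_lt1// ltr1n.
  have /cvgr0Pnorm_lt/(_ _ e0)[k _ /(_ _ (leqnn k))] := h.
  by rewrite ger0_norm ?exprn_ge0 ?invr_ge0// exprVn; exists k.
exists (d * k.+1)%N => y xy; rewrite -ball_normE /=.
have e1 i : side (d * k.+1) i < e.
  apply: le_lt_trans ke; rewrite /side lef_pV2 ?posrE ?exprn_gt0// ler_weXn2l ?ler1n//.
  by have [_] := lev_bounds (d * k.+1) i; rewrite leq_mul2l.
rewrite [ltLHS]/Num.Def.normr/= mx_normrE; apply: bigmax_lt => //= -[i j] _.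
by rewrite (ord1 i) /= !mxE (lt_trans (box_dist j xy)).
Qed.

(** Boxes shrink to points, so an open set is the union of the boxes that it contains, and there are
    only countably many boxes. *)
Lemma open_dbox (U : set rV) : open U ->
  U = \bigcup_(p : nat * {ffun 'I_d -> int})
        (if asbool (dbox p.1 p.2 `<=` U) then dbox p.1 p.2 else set0).
Proof.
move=> oU; apply/seteqP; split=> x; last first.
  by move=> [[n z] _]; case: asboolP => // h; exact: h.
move=> Ux; have [e /= e0 eU] : nbhs_ball x U.
  by apply/nbhs_ballP; move: oU; rewrite openE; exact.
have [n nxe] := box_small x e0.
have zE : dbox n [ffun i => cell n x i] = box n x.
  by apply/seteqP; split => y h i; have := h i; rewrite ffunE.
exists (n, [ffun i => cell n x i]) => //=; rewrite zE asboolT//.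
exact: subset_trans eU.
Qed.

Definition dboxes : set (set rV) :=
  [set A | A = set0 \/ exists n z, A = dbox n z].

Let T := g_sigma_algebraType dboxes.

Let open_measurable_dboxes (U : set rV) : open U -> (measurable : set (set T)) U.
Proof.
move=> /open_dbox ->; apply: countable_bigcupT_measurable; first exact: countableP.
move=> [n z]; case: ifP => _; last exact: measurable0.
by apply: sub_sigma_algebra; right; exists n, z.
Qed.

(** Coordinates are continuous, so they pull open intervals back to open sets, which are countable
    unions of boxes. *)
Lemma measurable_dboxes : (measurable : set (set rV)) = <<s dboxes >>.
Proof.
apply/seteqP; split; last first.
  apply: smallest_sub; first exact: sigma_algebra_measurable.
  by move=> _ [->|[n [z ->]]]; [exact: measurable0|exact: measurable_dbox].
apply: smallest_sub; first exact: smallest_sigma_algebra.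
move=> A; rewrite -bigcup_seq/= => -[i _] [B mB <-].
have mc : measurable_fun (setT : set T) (fun x : T => (x : rV) ord0 i : measurableTypeR R).
  apply: (measurability _ (RGenOpens.measurableE R)).
  move=> _ [_ [a [b ->] <-]]; rewrite setTI.
  apply: open_measurable_dboxes; apply: open_comp; last exact: interval_open.
  by move=> x _; exact: coord_continuous.
exact: (mc measurableT _ mB).
Qed.

Lemma open_measurable_rV (U : set rV) : open U -> measurable U.
Proof. by rewrite measurable_dboxes; exact: open_measurable_dboxes. Qed.

Lemma continuous_measurable_rV (f : rV -> R) : continuous f -> measurable_fun setT f.
Proof.
move=> /continuousP cf; apply: (measurability _ (RGenOpens.measurableE R)).
move=> _ [_ [a [b ->] <-]]; rewrite setTI.
apply: open_measurable_rV; exact/cf/interval_open.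
Qed.

(** Two dyadic boxes are nested or disjoint. *)
Lemma setI_dboxes : setI_closed dboxes.
Proof.
move=> A B [->|[n [z ->]]]; first by rewrite set0I; left.
move=> [->|[m [w ->]]]; first by rewrite setI0; left.
wlog nm : n m z w / (n <= m)%N.
  move=> h; have [|/ltnW] := leqP n m; first exact: h.
  by rewrite setIC; exact: h.
have [->|/set0P[x [xz xw]]] := eqVneq (dbox n z `&` dbox m w) set0; first by left.
right; exists m, w; rewrite setIidr// => y yw.
have /(box_sub nm) h : box m x y by move=> i; rewrite yw xw.
by move=> i; rewrite h xz.
Qed.

Let unit_box (k : nat) : set rV :=
  if unpickle k is Some z then dbox 0 (z : {ffun 'I_d -> int}) else set0.

(** Serves twice: for the translation invariance of the measure, and, applied to the densities of
    the two parts of a function, to show that a function with zero integral on every box vanishes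
    almost everywhere. *)
Lemma dbox_measure_unique (m1 m2 : {measure set rV -> \bar R}) :
  (forall n z, m1 (dbox n z) = m2 (dbox n z)) ->
  (forall n z, m1 (dbox n z) < +oo)%E ->
  forall A, measurable A -> m1 A = m2 A.
Proof.
move=> m12 m1oo; apply: (measure_unique dboxes unit_box).
- exact: measurable_dboxes.
- exact: setI_dboxes.
- by move=> k; rewrite /unit_box; case: unpickle => [z|]; [right; exists 0%N, z|left].
- apply/seteqP; split => // x _; exists (pickle [ffun i => cell 0 x i]) => //.
  by rewrite /unit_box pickleK => i; rewrite ffunE.
- by move=> _ [->|[n [z ->]]]; rewrite ?measure0//.
- move=> k; rewrite /unit_box; case: unpickle => [z|]; last by rewrite measure0 ltry.
  exact: m1oo.
Qed.

End dyadic.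

(** * Translations *)

Section translation.
Context {R : realType} {d' : nat}.
Local Notation d := d'.+1.
Local Notation rV := 'rV[R]_d.
Local Notation mu := (@lebesgue_rV R d).
Local Notation dir i := (delta_mx ord0 i : rV).
Implicit Types (v x y : rV).

Lemma measurable_addv v : measurable_fun setT (fun x => v + x).
Proof.
apply/measurable_fun_rVP => i.
rewrite (_ : (fun _ => _) = (fun x => v ord0 i + x ord0 i)).
  by apply: measurable_funD => //; exact: measurable_coord.
by apply/funext => x; rewrite mxE.
Qed.

Lemma mu_addv v (A : set rV) : measurable A -> mu ((fun x => v + x) @^-1` A) = mu A.
Proof.
have mv := measurable_addv v.
have E n z : pushforward mu (fun x => v + x) (dbox n z) = mu (dbox n z).
  rewrite mu_dbox -(@prod_side R d' n) /pushforward.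
  rewrite -(mu_itv_prod (fun i => (z i)%:~R * side n i - v ord0 i)); last first.
    by move=> i; rewrite ltW// side_gt0.
  rewrite dbox_prod; congr (mu _); apply/seteqP; split => x h i; have := h i;
    rewrite /= mxE !in_itv/= intrD mulrDl mul1r => /andP[h1 h2]; apply/andP; split; lra.
pose m1 : {measure set rV -> \bar R} := pushforward mu (fun x => v + x).
move=> mA; rewrite -[LHS]/(m1 mv A); apply: dbox_measure_unique => // n z.
by rewrite [m1 _ _]E mu_dbox ltry.
Qed.

Lemma ge0_integral_addv v (f : rV -> \bar R) : measurable_fun setT f ->
  (forall x, 0 <= f x)%E -> (\int[mu]_x f (v + x)%R = \int[mu]_x f x)%E.
Proof.
move=> mf f0; have mv := measurable_addv v.
transitivity (\int[pushforward mu (fun x => (v + x)%R)]_x f x)%E.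
  by rewrite (ge0_integral_pushforward mv).
by apply: eq_measure_integral => A mA _; exact: mu_addv.
Qed.

Lemma integrable_addv v (f : rV -> R) : mu.-integrable setT (EFin \o f) ->
  mu.-integrable setT (EFin \o (fun x => f (v + x))).
Proof.
move=> /integrableP[mf fi]; apply/integrableP; split.
  apply/measurable_EFinP; apply: measurableT_comp (measurable_addv v).
  exact/measurable_EFinP.
rewrite (_ : (\int[mu]_x _)%E = (\int[mu]_x `|(EFin \o f) (v + x)%R|)%E)//.
rewrite (@ge0_integral_addv v (fun x => `|(EFin \o f) x|%E))//.
exact: measurableT_comp.
Qed.

Lemma Rintegral_addv v (f : rV -> R) : mu.-integrable setT (EFin \o f) ->
  \int[mu]_x f (v + x) = \int[mu]_x f x.
Proof.
move=> fi; have mv := measurable_addv v.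
congr fine; transitivity (\int[pushforward mu (fun x => (v + x)%R)]_x (f x)%:E)%E.
  rewrite (@integral_pushforward _ _ _ _ _ _ mv _ setT (EFin \o f))//.
    by have /integrableP[] := fi.
  by rewrite preimage_setT; exact: integrable_addv.
by apply: eq_measure_integral => A mA _; exact: mu_addv.
Qed.

Lemma is_derive_along (F : rV -> R) x v (t dF : R) :
  is_derive (t *: v + x) v F dF -> is_derive t 1 (fun s : R => F (s *: v + x)) dF.
Proof.
have E : (fun h : R => h^-1 *: (((fun s : R => F (s *: v + x)) \o shift t) (h *: 1) - F (t *: v + x)))
     = (fun h : R => h^-1 *: ((F \o shift (t *: v + x)) (h *: v) - F (t *: v + x))).
  apply/funext => h; congr (_ *: (F _ - _)) => /=.
  by rewrite [_%:A]mulr1 scalerDl addrA.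
by move=> [d1 d2]; split; rewrite /derivable /derive E.
Qed.

Lemma MVT_along (F : rV -> R) x i (h : R) : 0 <= h ->
  (forall y, derivable F y (dir i)) ->
  exists2 c, 0 <= c <= h & F (h *: dir i + x) - F x = 'D_(dir i) F (c *: dir i + x) * h.
Proof.
move=> h0 dF.
have Fd (t : R) : is_derive t 1 (fun s : R => F (s *: dir i + x)) ('D_(dir i) F (t *: dir i + x)).
  by apply: is_derive_along; apply: DeriveDef => //; exact: dF.
have [|c] := @MVT_segment _ (fun s : R => F (s *: dir i + x)) (fun s => 'D_(dir i) F (s *: dir i + x)) 0 h h0.
  apply: derivable_within_continuous => t _; by have [] := Fd t.
by rewrite in_itv/= scale0r add0r subr0 => ch E; exists c.
Qed.

Definition cube (M : R) : set rV := [set x | forall i, `[- M, M]%classic (x ord0 i)].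

Lemma cube_compact M : compact (cube M).
Proof. exact: box_compact. Qed.

Lemma compact_cube (K : set rV) : compact K -> exists2 M, 0 <= M & K `<=` cube M.
Proof.
move=> /compact_bounded[M0 [_ KM]]; exists (`|M0| + 1); first by rewrite addr_ge0.
move=> x /(KM (`|M0| + 1)) h i; rewrite /= in_itv/= -ler_norml.
apply: le_trans (h _); last by rewrite (le_lt_trans (ler_norm M0))// ltrDl.
rewrite [leRHS]/Num.Def.normr/= mx_normrE; apply/bigmax_geP; right => /=.
by exists (ord0, i).
Qed.

Lemma measurable_cube M : measurable (cube M).
Proof. exact: (@measurable_rV_prod R d' (fun=> `[- M, M]%classic) (fun=> measurable_itv _)). Qed.

Lemma mu_cube M : (mu (cube M) < +oo)%E.
Proof.
rewrite (@lebesgue_rV_box R d (fun=> `[- M, M]%classic))//.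
rewrite (eq_bigr (fun=> (fine (lebesgue_measure `[- M, M]))%:E)); last first.
  move=> i _; rewrite fineK// lebesgue_measure_itv/=; case: ifP => // _.
by rewrite prodEFin ltry.
Qed.

Lemma continuous_bounded_compact (f : rV -> R) K : continuous f -> compact K ->
  exists2 C, 0 <= C & forall x, K x -> `|f x| <= C.
Proof.
move=> cf cK; have /compact_bounded[M [_ KM]] : compact (f @` K).
  by apply: continuous_compact => //; exact: continuous_subspaceT.
exists (`|M| + 1); first by rewrite addr_ge0.
move=> x Kx; apply: (KM (`|M| + 1)); last by exists x.
by rewrite (le_lt_trans (ler_norm M))// ltrDl.
Qed.

Lemma integrable_cube (C M : R) :
  mu.-integrable setT (EFin \o (fun x => C * \1_(cube M) x)).
Proof.
have h : mu.-integrable setT (EFin \o (\1_(cube M) : rV -> R)).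
  apply/integrableP; split.
    by apply/measurable_EFinP; apply: measurable_indic; exact: measurable_cube.
  under eq_integral do rewrite /= ger0_norm//.
  by rewrite integral_indic ?setIT ?mu_cube//; exact: measurable_cube.
rewrite (_ : _ \o _ = (fun x => C%:E * (\1_(cube M) x)%:E)%E).
  exact: integrableZl.
by apply/funext => x /=; rewrite EFinM.
Qed.

Lemma compact_support_integrable (f : rV -> R) K : continuous f -> compact K ->
  (forall x, ~ K x -> f x = 0) ->
  mu.-integrable setT (EFin \o f) /\ exists C, forall x, `|f x| <= C.
Proof.
move=> cf cK f0; have [C C0 fC] := continuous_bounded_compact cf cK.
have [M M0 KM] := compact_cube cK.
have fb x : `|f x| <= C * \1_(cube M) x.
  have [Kx|nKx] := pselect (K x); last by rewrite f0// normr0 mulr_ge0.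
  by rewrite indicE mem_set ?mulr1; [exact: fC|exact: KM].
split; last first.
  by exists C => x; rewrite (le_trans (fb x))// ler_piMr// indicE lern1 leq_b1.
apply: le_integrable (integrable_cube C M) => //.
  by apply/measurable_EFinP; exact: continuous_measurable_rV.
by move=> x _ /=; rewrite lee_fin (le_trans (fb x))// ler_norm.
Qed.

(** By translation invariance the difference quotients of [F] along [dir i] have integral 0. They
    converge to the derivative, and the mean value theorem dominates them. *)
Lemma integral_derive0 (F : rV -> R) i K : compact K ->
  (forall x, ~ K x -> F x = 0) -> continuous F ->
  (forall x, derivable F x (dir i)) -> continuous ('D_(dir i) F) ->
  \int[mu]_x 'D_(dir i) F x = 0.
Proof.
move=> cK F0 cF dF cdF.
have [M M0 KM] := compact_cube cK.
(* Two units of margin around the support: a translation by at most 1 may reach the support from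
   outside, and the intermediate point of the mean value theorem may move by 1 again. *)
have [C C0 fC] := continuous_bounded_compact cdF (@cube_compact (M + 2)).
have [iF _] := compact_support_integrable cF cK F0.
pose h n : R := n.+1%:R^-1.
have h0 n : 0 < h n by rewrite invr_gt0.
have h1 n : h n <= 1 by rewrite invf_le1// ler1n.
pose g n x := (h n)^-1 * (F (h n *: dir i + x) - F x).
have iFn n : mu.-integrable setT (EFin \o (fun x => F (h n *: dir i + x))) by exact: integrable_addv.
have iD n : mu.-integrable setT (EFin \o (fun x => F (h n *: dir i + x) - F x)).
  pose Fn x := F (h n *: dir i + x).
  rewrite (_ : _ \o _ = (fun x => (EFin \o Fn) x - (EFin \o F) x)%E)//.
  by apply: integrableB => //; exact: iFn.
have iG n : mu.-integrable setT (EFin \o g n).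
  rewrite (_ : _ \o _ = (fun x => ((h n)^-1)%:E * (F (h n *: dir i + x) - F x)%:E)%E).
    by apply: (integrableZl measurableT); exact: iD.
  by apply/funext => x /=; rewrite -EFinM.
have ig n : \int[mu]_x g n x = 0.
  rewrite /g RintegralZl// RintegralB; [|by []|exact: iFn|by []].
  by rewrite Rintegral_addv// subrr mulr0.
have cg x : g n x @[n --> \oo] --> 'D_(dir i) F x.
  have hc : h n @[n --> \oo] --> (0 : R)^'.
    move=> A nA.
    have hA : \forall n \near \oo, h n != 0 -> A (h n) := @cvg_harmonic R _ nA.
    apply: (@filterS _ \oo _ (fun n => h n != 0 -> A (h n))) hA => n; apply.
    exact: lt0r_neq0.
  have dc : (fun t : R => t^-1 *: ((F \o shift x) (t *: dir i) - F x)) @ 0^'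
      --> 'D_(dir i) F x by exact: (dF x).
  exact: cvg_comp hc dc.
have gb n x : `|g n x| <= C * \1_(cube (M + 1)) x.
  have [c /andP[c0 ch] E] := MVT_along x (ltW (h0 n)) dF.
  have [xM|xM] := pselect (cube (M + 1) x).
    rewrite indicE mem_set// mulr1 /g E mulrC mulfK ?gt_eqF//.
    apply: fC => j; have := xM j; rewrite /= !in_itv/= line_coord => /andP[x1 x2].
    have c1 := le_trans ch (h1 n).
    by case: (i == j); rewrite ?mulr1n ?mulr0n; apply/andP; split; lra.
  rewrite /g !F0 ?subrr ?mulr0 ?normr0 ?mulr_ge0//.
    by move=> /KM h'; apply: xM => j; have := h' j; rewrite /= !in_itv/= => /andP[x1 x2];
      apply/andP; split; lra.
  move=> /KM h'; apply: xM => j; have := h' j; have := h1 n; have := h0 n.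
  rewrite /= !in_itv/= line_coord => hn1 hn0 /andP[x1 x2].
  by move: x1 x2; case: (i == j); rewrite ?mulr1n ?mulr0n => x1 x2; apply/andP; split; lra.
have mg n : measurable_fun setT (EFin \o g n).
  apply/measurable_EFinP; apply: measurable_funM => //; apply: measurable_funB.
    by have /integrableP[/measurable_EFinP] := iFn n.
  exact: continuous_measurable_rV.
have [_ _] := @dominated_convergence _ _ _ mu setT measurableT (fun n => EFin \o g n)
  (EFin \o 'D_(dir i) F) (EFin \o (fun x => C * \1_(cube (M + 1)) x)) mg
  ltac:(by apply/measurable_EFinP; exact: continuous_measurable_rV)
  ltac:(by apply: aeW => x _; apply: cvg_EFin; [exact: nearW|exact: cg])
  (integrable_cube _ _)
  ltac:(by apply: aeW => x n _; rewrite /= lee_fin; exact: gb).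
rewrite (_ : (fun n => _) = cst 0%E); last first.
  apply/funext => n /=; rewrite -(@fineK _ (\int[mu]_x _)%E).
    by have := ig n; rewrite /Rintegral => ->.
  exact: integrable_fin_num (iG n).
by move=> /cvg_lim; rewrite /Rintegral lim_cst// => <-.
Qed.

End translation.

(** * Test functions and weak derivatives *)

Section test_functions.
Context {R : realType} {d' : nat}.
Local Notation d := d'.+1.
Local Notation rV := 'rV[R]_d.
Local Notation mu := (@lebesgue_rV R d).
Local Notation dir i := (delta_mx ord0 i : rV).
Implicit Types (u v phi psi : rV -> R) (s : seq 'I_d).

Lemma partial_rcons s i phi : partial (rcons s i) phi = partial s ('D_(dir i) phi).
Proof. by rewrite /partial foldr_rcons. Qed.

Lemma test_derive phi i : test_function phi -> test_function ('D_(dir i) phi).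
Proof.
move=> [sphi cphi]; split; first by move=> s; rewrite -partial_rcons; exact: sphi.
apply: (subclosed_compact _ cphi); first exact: closed_closure.
rewrite {1}closureE; apply: smallest_sub; first exact: closed_closure.
move=> x /= /eqP Dx; apply: contrapT => nx; apply: Dx.
have nphi : \forall y \near x, cst 0 y = phi y.
  have : nbhs x (~` closure [set x | phi x != 0]).
    by apply: open_nbhs_nbhs; split => //; exact/closed_openC/closed_closure.
  apply: filterS => y ny; apply/esym/eqP/negPn/negP => phiy; apply: ny.
  exact: subset_closure.
by rewrite -(near_eq_derive (dir i) nphi) derive_cst.
Qed.

Lemma test_partial phi s : test_function phi -> test_function (partial s phi).
Proof. by move=> tphi; elim: s => [//|i s IH] /=; exact: test_derive. Qed.

Lemma test_continuous phi : test_function phi -> continuous phi.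
Proof. by move=> [/(_ [::])[]]. Qed.

Lemma test_derivable phi x i : test_function phi -> derivable phi x (dir i).
Proof. by move=> [/(_ [::])[_]]. Qed.

Lemma test_eq0 phi x : ~ closure [set x | phi x != 0] x -> phi x = 0.
Proof.
move=> nx; apply/eqP/negPn/negP => phix; apply: nx; exact: subset_closure.
Qed.

Lemma test_integrable phi : test_function phi ->
  mu.-integrable setT (EFin \o phi) /\ exists C, forall x, `|phi x| <= C.
Proof.
move=> tphi; have [_ cphi] := tphi.
apply: (compact_support_integrable (test_continuous tphi) cphi) => x; exact: test_eq0.
Qed.

Lemma test_measurable phi : test_function phi -> measurable_fun setT phi.
Proof. by move=> /test_continuous; exact: continuous_measurable_rV. Qed.

Lemma integrableM_bounded u phi C : mu.-integrable setT (EFin \o u) ->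
  measurable_fun setT phi -> (forall x, `|phi x| <= C) ->
  mu.-integrable setT (EFin \o (fun x => u x * phi x)).
Proof.
move=> iu mphi phiC; have /integrableP[/measurable_EFinP mu_ _] := iu.
have iCu : mu.-integrable setT (fun x => C%:E * (EFin \o u) x)%E by exact: integrableZl.
apply: (le_integrable _ _ _ iCu) => //.
  by apply/measurable_EFinP; exact: measurable_funM.
move=> x _ /=; rewrite lee_fin mulrC !normrM ler_wpM2r//.
by rewrite (le_trans (phiC x))// ler_norm.
Qed.

Lemma integrableM_test u phi : mu.-integrable setT (EFin \o u) ->
  test_function phi -> mu.-integrable setT (EFin \o (fun x => u x * phi x)).
Proof.
move=> iu tphi; have [_ [C phiC]] := test_integrable tphi.
exact: (integrableM_bounded iu (test_measurable tphi) phiC).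
Qed.

Lemma test_ibp psi phi i : test_function psi -> test_function phi ->
  \int[mu]_x (psi x * 'D_(dir i) phi x) = - \int[mu]_x ('D_(dir i) psi x * phi x).
Proof.
move=> tpsi tphi.
have tDpsi := @test_derive _ i tpsi; have tDphi := @test_derive _ i tphi.
have hD (x : rV) : is_derive x (dir i) (fun x => psi x * phi x)
    ('D_(dir i) psi x * phi x + psi x * 'D_(dir i) phi x).
  have h := is_deriveM (derivableP (@test_derivable _ x i tpsi))
                       (derivableP (@test_derivable _ x i tphi)).
  by refine (@is_derive_eq _ _ _ _ _ _ _ _ h _); rewrite /GRing.scale/= addrC [in RHS]mulrC.
have DE : 'D_(dir i) (fun x => psi x * phi x) =
    (fun x => 'D_(dir i) psi x * phi x + psi x * 'D_(dir i) phi x).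
  by apply/funext => x; have [_ ->] := hD x.
have := @integral_derive0 R d' (fun x => psi x * phi x) i _ tphi.2.
rewrite DE => h; apply/eqP; rewrite -addr_eq0 addrC -RintegralD//; last first.
- apply: integrableM_test => //; exact: (test_integrable tpsi).1.
- apply: integrableM_test => //; exact: (test_integrable tDpsi).1.
apply/eqP; apply: h.
- by move=> x nx; rewrite (test_eq0 nx) mulr0.
- move=> x; exact: (continuousM (@test_continuous _ tpsi x) (@test_continuous _ tphi x)).
- by move=> x; have [] := hD x.
- move=> x; apply: (@continuousD _ _ _ _ _ x).
    exact: (continuousM (@test_continuous _ tDpsi x) (@test_continuous _ tphi x)).
  exact: (continuousM (@test_continuous _ tpsi x) (@test_continuous _ tDphi x)).
Qed.

Lemma integrable_locally_rV u : mu.-integrable setT (EFin \o u) -> locally_integrable_rV u.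
Proof.
move=> /integrableP[mu_ iu]; split; first exact/measurable_EFinP.
move=> K cK; apply: le_lt_trans iu.
apply: ge0_subset_integral => //.
- have oK : open (~` K) by apply: closed_openC; apply: compact_closed => //; exact: norm_hausdorff.
  by rewrite -(setCK K); apply: measurableC; exact: open_measurable_rV.
- by apply: (measurableT_comp (f:=abse) _ mu_).
Qed.

(** Integration by parts removes the outermost derivative of [phi] first and puts it innermost on
    [psi], so the directions come out in reverse order. *)
Lemma test_weak_partial psi s : test_function psi ->
  is_weak_partial psi s (partial (rev s) psi).
Proof.
move=> tpsi; split.
- exact/integrable_locally_rV/(test_integrable tpsi).1.
- exact/integrable_locally_rV/(test_integrable (test_partial _ tpsi)).1.
move=> phi tphi; elim: s psi tpsi => [|i s IH] psi tpsi.
  by rewrite expr0 mul1r.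
rewrite /= test_ibp//; last exact: test_partial.
by rewrite IH ?rev_cons ?partial_rcons; [rewrite exprS mulN1r mulNr|exact: test_derive].
Qed.

End test_functions.

(** * Dominated convergence, null sets and densities *)

Section integral_facts.
Context d (T : measurableType d) {R : realType}.
Variable mu : {measure set T -> \bar R}.

Lemma Rdominated_cvg (f_ : nat -> T -> R) (f g : T -> R) :
  (forall n, measurable_fun setT (f_ n)) -> measurable_fun setT f ->
  {ae mu, forall x, f_ n x @[n --> \oo] --> f x} ->
  mu.-integrable setT (EFin \o g) -> (forall n x, `|f_ n x| <= g x) ->
  \int[mu]_x f_ n x @[n --> \oo] --> \int[mu]_x f x.
Proof.
move=> mf_ mf cf ig fg.
have [||||ifi _ h] := @dominated_convergence _ _ _ mu setT measurableT (fun n => EFin \o f_ n)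
  (EFin \o f) (EFin \o g) _ _ _ ig.
- by move=> n; exact/measurable_EFinP.
- exact/measurable_EFinP.
- by apply: filterS cf => x h _; apply: cvg_EFin; [exact: nearW|exact: h].
- by apply: aeW => x n _; rewrite /= lee_fin.
rewrite /Rintegral.
have fin : (\int[mu]_x (EFin \o f) x)%E \is a fin_num by exact: integrable_fin_num.
by move: h; rewrite -(fineK fin) => /fine_cvg.
Qed.

Lemma eq_Rintegral_ae (f g : T -> R) : measurable_fun setT f -> measurable_fun setT g ->
  {ae mu, forall x, f x = g x} -> \int[mu]_x f x = \int[mu]_x g x.
Proof.
move=> mf mg fg; congr fine; apply: ae_eq_integral => //.
- exact/measurable_EFinP.
- exact/measurable_EFinP.
- by apply: filterS fg => x -> _.
Qed.

Lemma integrable_eq_ae (f g : T -> R) : measurable_fun setT g ->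
  {ae mu, forall x, f x = g x} -> mu.-integrable setT (EFin \o f) ->
  mu.-integrable setT (EFin \o g).
Proof.
move=> mg fg /integrableP[mf fi]; apply/integrableP; split; first exact/measurable_EFinP.
rewrite (_ : (\int[mu]_x _ = \int[mu]_x `|(EFin \o f) x|)%E)//.
apply: ae_eq_integral => //.
- by apply: measurableT_comp => //; exact/measurable_EFinP.
- exact: measurableT_comp.
- by apply: filterS fg => x /= -> _.
Qed.

Section density.
Variables (p : T -> \bar R) (mp : measurable_fun setT p) (p0 : forall x, (0 <= p x)%E).

Definition density (A : set T) : \bar R := (\int[mu]_(x in A) p x)%E.

Let density0 : density set0 = 0%E. Proof. exact: integral_set0. Qed.

Let density_ge0 A : (0 <= density A)%E. Proof. exact: integral_ge0. Qed.

Let density_sigma_additive : semi_sigma_additive density.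
Proof. exact: semi_sigma_additive_nng_induced. Qed.

HB.instance Definition _ := isMeasure.Build _ _ _ density
  density0 density_ge0 density_sigma_additive.

Definition density_measure : {measure set T -> \bar R} := density.

End density.
End integral_facts.

(** * Uniqueness of weak derivatives *)

Section box_uniqueness.
Context {R : realType} {d' : nat}.
Local Notation d := d'.+1.
Local Notation rV := 'rV[R]_d.
Local Notation mu := (@lebesgue_rV R d).

(** The densities of the positive and negative parts agree on boxes, hence on every measurable set.
    Where [f >= 0] the negative part vanishes, elsewhere the positive part does; exchanging the two
    densities on each of these sets gives the integral of [|f|] the value 0. *)
Lemma dbox_ae_eq0 (f : rV -> R) : measurable_fun setT f ->
  (forall n z, mu.-integrable (dbox n z) (EFin \o f)) ->
  (forall n z, \int[mu]_(x in dbox n z) f x = 0) ->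
  {ae mu, forall x, f x = 0}.
Proof.
move=> mf fi f0; pose F := EFin \o f.
have mF : measurable_fun setT F by exact/measurable_EFinP.
have mp : measurable_fun setT (funepos F) by exact: measurable_funepos.
have mq : measurable_fun setT (funeneg F) by exact: measurable_funeneg.
have fp n z : (\int[mu]_(x in dbox n z) (funepos F) x < +oo)%E.
  by apply: integral_funepos_lt_pinfty => //; exact: measurable_dbox.
have fq n z : (\int[mu]_(x in dbox n z) (funeneg F) x < +oo)%E.
  by apply: integral_funeneg_lt_pinfty => //; exact: measurable_dbox.
have pq A : measurable A -> (\int[mu]_(x in A) (funepos F) x = \int[mu]_(x in A) (funeneg F) x)%E.
  move=> mA.
  apply: (@dbox_measure_unique R d' (density_measure mu mp (fun x => funepos_ge0 F x))
     (density_measure mu mq (fun x => funeneg_ge0 F x)) _ _ A mA) => n z; last exact: fp.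
  have := integrable_fin_num (measurable_dbox n z) (fi n z).
  have := f0 n z; rewrite /Rintegral => h /fineK; rewrite h => /esym.
  rewrite integralE -/F; have := fp n z; have := fq n z.
  have h1 : (0 <= \int[mu]_(x in dbox n z) (funepos F) x)%E by exact: integral_ge0.
  have h2 : (0 <= \int[mu]_(x in dbox n z) (funeneg F) x)%E by exact: integral_ge0.
  rewrite -!ge0_fin_numE// => q1 p1 E0.
  suff : (\int[mu]_(x in dbox n z) (funepos F) x = \int[mu]_(x in dbox n z) (funeneg F) x)%E by [].
  move: E0; rewrite -(fineK p1) -(fineK q1) -EFinB.
  by move=> /(congr1 fine) /= /subr0_eq ->.
have : (\int[mu]_x `|F x| = 0)%E.
  pose A := [set x | 0 <= f x].
  have mA : measurable A.
    rewrite (_ : A = f @^-1` `[0, +oo[); last first.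
      by apply/seteqP; split => x; rewrite /A /= in_itv/= andbT.
    by rewrite -[X in measurable X]setTI; exact: mf.
  rewrite -(setUv A) ge0_integral_setU//; [|exact: measurableC|exact/measurable_funTS/measurableT_comp|]; last first.
    by rewrite disj_set2E setICr.
  rewrite (@eq_integral _ _ _ _ A (funepos F)); last first.
    move=> x /set_mem /= fx; rewrite /F funeposE /= ger0_norm//.
    by rewrite (max_idPl _)// lee_fin.
  rewrite (@eq_integral _ _ _ _ (~` A) (funeneg F)); last first.
    move=> x /set_mem /= /negP; rewrite -ltNge => fx; rewrite /F funenegE /= ltr0_norm//.
    by rewrite (max_idPl _)// lee_fin oppr_ge0 ltW.
  rewrite pq// -(pq (~` A)); last exact: measurableC.
  rewrite integral0_eq ?integral0_eq ?adde0//.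
  - move=> x /= /negP; rewrite -ltNge => fx; rewrite /F funeposE /=.
    by rewrite (max_idPr _)// lee_fin ltW.
  - move=> x /= fx; rewrite /F funenegE /=.
    by rewrite (max_idPr _)// lee_fin oppr_le0.
move/(ae_eq_integral_abs mu measurableT mF).
by apply: filterS => x /(_ I)[].
Qed.

Definition rbox (a b : 'I_d -> R) : set rV :=
  [set x | forall j, `[a j, b j[%classic (x ord0 j)].

Lemma measurable_rbox a b : measurable (rbox a b).
Proof.
exact: (@measurable_rV_prod R d' (fun j => `[a j, b j[%classic) (fun=> measurable_itv _)).
Qed.

Lemma hyperplane_negligible (i : 'I_d) (c : R) : mu.-negligible [set x : rV | x ord0 i = c].
Proof.
have E : [set x : rV | x ord0 i = c] =
   [set x | forall j, (if j == i then [set c] else setT) (x ord0 j)].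
  apply/seteqP; split => x /= h; last by have := h i; rewrite eqxx.
  by move=> j; case: eqP => // ->.
have mc (j : 'I_d) : measurable ((if j == i then [set c] else setT) : set (measurableTypeR R)).
  by case: ifP.
exists [set x : rV | x ord0 i = c]; split => //.
- by rewrite E; exact: (@measurable_rV_prod R d' (fun j => if j == i then [set c] else setT)).
- rewrite E (@lebesgue_rV_box R d (fun j => if j == i then [set c] else setT))//.
  by rewrite (bigD1 i)//= eqxx lebesgue_measure_set1 mul0e.
Qed.

Definition sbox m (a b : 'I_d -> R) : rV -> R := prodf (fun j => plateau m (a j) (b j)).

Lemma sbox_test m a b : test_function (sbox m a b).
Proof.
apply: (@test_prodf _ _ _ a b) => j; first exact: smooth1_plateau.
by move=> t; exact: plateau_eq0.
Qed.

Lemma sbox_ge0 m a b x : 0 <= sbox m a b x.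
Proof. by apply: prodr_ge0 => j _; exact: plateau_ge0. Qed.

Lemma sbox_le1 m a b x : sbox m a b x <= 1.
Proof. by apply: prodr_ile1 => j _; rewrite plateau_ge0 plateau_le1. Qed.

(** The plateaus converge to indicators of open intervals while the boxes are half open; the
    difference lies in the hyperplanes of the lower faces, which are negligible. *)
Lemma sbox_cvg a b : {ae mu, forall x, sbox m a b x @[m --> \oo] --> (\1_(rbox a b) x : R)}.
Proof.
have : {ae mu, forall x : rV, forall j, x ord0 j <> a j}.
  apply: filter_forall => j; apply: negligibleS (hyperplane_negligible j (a j)).
  by move=> x /= /contrapT.
apply: filterS => x xa.
rewrite (_ : \1_(rbox a b) x = \prod_(j < d) \1_`]a j, b j[ (x ord0 j)); last first.
  have [/= xb|xb] := pselect (rbox a b x).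
    rewrite indicE mem_set// big1// => j _; rewrite indicE mem_set//=.
    have := xb j; rewrite /= !in_itv/= => /andP[+ ->]; rewrite le_eqVlt => /orP[/eqP e|->//].
    by case: (xa j).
  rewrite indicE memNset//; apply/esym/eqP/prodf_eq0.
  have [j nj] : exists j, ~ (`[a j, b j[%classic (x ord0 j)) by exact/existsNP.
  exists j => //; rewrite indicE memNset//= => h'; apply: nj; move: h'.
  by rewrite /= !in_itv/= => /andP[/ltW -> ->].
apply: cvg_big => //; first exact: mul_continuous.
by move=> j _; exact: plateau_cvg.
Qed.

Lemma Rintegral_restrict (w : rV -> R) (A : set rV) :
  \int[mu]_(x in A) w x = \int[mu]_x (w x * \1_A x).
Proof.
rewrite Rintegral_mkcond; apply: eq_Rintegral => x _.
by rewrite patchE indicE; case: (x \in A); rewrite ?mulr1 ?mulr0.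
Qed.

Lemma sbox_limit (w : rV -> R) a b : mu.-integrable setT (EFin \o w) ->
  \int[mu]_x (w x * sbox m a b x) @[m --> \oo] --> \int[mu]_(x in rbox a b) w x.
Proof.
move=> iw; have /integrableP[/measurable_EFinP mw _] := iw.
rewrite Rintegral_restrict.
apply: (@Rdominated_cvg _ _ _ mu _ _ (fun x => `|w x|)).
- move=> m; apply: measurable_funM => //; exact: test_measurable (sbox_test m a b).
- by apply: measurable_funM => //; apply: measurable_indic; exact: measurable_rbox.
- apply: filterS (sbox_cvg a b) => x h; apply: cvgM => //; exact: cvg_cst.
- exact: integrable_norm.
- move=> m x; rewrite normrM (ger0_norm (sbox_ge0 _ _ _ _)).
  by rewrite ler_piMr// sbox_le1.
Qed.

Lemma dbox_rbox n (z : 'I_d -> int) :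
  dbox n z = rbox (fun i => (z i)%:~R * side n i) (fun i => (z i + 1)%:~R * side n i).
Proof. exact: dbox_prod. Qed.

(** The test functions [sbox] converge boundedly to the indicator of a dyadic box, so the integral
    of [v] over every box is 0. *)
Lemma weak_eq0 (v : rV -> R) : locally_integrable_rV v ->
  (forall phi, test_function phi -> \int[mu]_x (v x * phi x) = 0) ->
  {ae mu, forall x, v x = 0}.
Proof.
move=> [mv lv] v0.
have iK (M : R) : mu.-integrable (cube M) (EFin \o v).
  apply/integrableP; split; first exact/measurable_EFinP/measurable_funTS.
  by apply: lv; exact: cube_compact.
have dK n (z : 'I_d -> int) : exists M : R, (dbox n z : set rV) `<=` cube M.
  have [M _ h] := compact_cube (@box_compact R d (fun i => (z i)%:~R * side n i)
     (fun i => (z i + 1)%:~R * side n i)).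
  exists M => x; rewrite dbox_rbox => xz; apply: h => i; have := xz i.
  by rewrite /= !in_itv/= => /andP[-> /ltW].
apply: dbox_ae_eq0 => // n z; have [M zM] := dK n z.
  apply: integrableS (iK M) => //; [exact: measurable_cube|exact: measurable_dbox].
(* [v] is only locally integrable. Cutting it to a cube that contains the box makes it integrable,
   and the test functions, zero outside the box, do not see the cut. *)
pose w x := v x * \1_(cube M) x.
have wE x : w x = (v \_ (cube M)) x.
  by rewrite /w patchE indicE; case: (x \in cube M); rewrite ?mulr1 ?mulr0.
have iw : mu.-integrable setT (EFin \o w).
  have := (integrable_mkcond (EFin \o v) (measurable_cube M)).1 (iK M).
  by rewrite restrict_EFin (_ : v \_ (cube M) = w)//; apply/funext => x.
have h := @sbox_limit w (fun i => (z i)%:~R * side n i) (fun i => (z i + 1)%:~R * side n i) iw.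
rewrite -dbox_rbox in h.
have -> : \int[mu]_(x in dbox n z) v x = \int[mu]_(x in dbox n z) w x.
  by apply: eq_Rintegral => x /set_mem /zM xM; rewrite wE patchE mem_set.
apply: (cvg_unique _ h); first exact: Rhausdorff.
rewrite (_ : (fun m => _) = cst 0); first exact: cvg_cst.
apply/funext => m.
transitivity (\int[mu]_x (v x * sbox m (fun i => (z i)%:~R * side n i)
    (fun i => (z i + 1)%:~R * side n i) x)); last exact/v0/sbox_test.
apply: eq_Rintegral => x _.
rewrite wE patchE; case: ifPn => // /negP nxM.
rewrite [in RHS](_ : sbox _ _ _ x = 0) ?mulr0 ?mul0r//; apply/eqP/negPn/negP => s0.
apply: nxM; apply/mem_set; apply: zM; rewrite dbox_rbox => i.
rewrite /= in_itv/=; apply/negPn/negP => h'; move/eqP: s0; apply.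
rewrite /sbox /prodf (bigD1 i)//= plateau_eq0 ?mul0r//.
by apply: contra h' => /andP[/ltW -> ->].
Qed.

Lemma integrableM_test_loc (v phi : rV -> R) : locally_integrable_rV v ->
  test_function phi -> mu.-integrable setT (EFin \o (fun x => v x * phi x)).
Proof.
move=> [mv lv] tphi; have [_ [C phiC]] := test_integrable tphi.
have [_ cphi] := tphi; have [M _ KM] := compact_cube cphi.
have iv : mu.-integrable setT (EFin \o (v \_ (cube M))).
  rewrite -restrict_EFin; apply/(integrable_mkcond (EFin \o v) (measurable_cube M)).1.
  apply/integrableP; split; first exact/measurable_EFinP/measurable_funTS.
  by apply: lv; exact: cube_compact.
rewrite (_ : (fun x => v x * phi x) = (fun x => (v \_ (cube M)) x * phi x)).
  exact: integrableM_test.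
apply/funext => x; rewrite patchE; case: ifPn => // /negP nxM.
by rewrite (@test_eq0 _ _ phi x) ?mulr0// => xK; apply/nxM/mem_set/KM.
Qed.

Lemma compact_measurable_rV (K : set rV) : compact K -> measurable K.
Proof.
move=> cK; have oK : open (~` K).
  by apply: closed_openC; apply: compact_closed => //; exact: norm_hausdorff.
by rewrite -(setCK K); apply: measurableC; exact: open_measurable_rV.
Qed.

Lemma weak_partial_unique u s (v1 v2 : rV -> R) : is_weak_partial u s v1 ->
  is_weak_partial u s v2 -> {ae mu, forall x, v1 x = v2 x}.
Proof.
move=> [_ lv1 h1] [_ lv2 h2]; have [m1 l1] := lv1; have [m2 l2] := lv2.
have l12 : locally_integrable_rV (fun x => v1 x - v2 x).
  split; first exact: measurable_funB.
  move=> K cK; have mK := compact_measurable_rV cK.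
  apply: (@le_lt_trans _ _ (\int[mu]_(x in K) (`|v1 x|%:E + `|v2 x|%:E)))%E; last first.
    rewrite ge0_integralD//; first exact: lte_add_pinfty (l1 _ cK) (l2 _ cK).
    - by apply/measurable_EFinP/measurableT_comp => //; exact: measurable_funTS.
    - by apply/measurable_EFinP/measurableT_comp => //; exact: measurable_funTS.
  apply: ge0_le_integral => //.
  - apply/measurable_EFinP/measurableT_comp => //; apply: measurable_funTS.
    exact: measurable_funB.
  - apply/measurable_EFinP/measurable_funD; apply: measurableT_comp => //;
      exact: measurable_funTS.
  - by move=> x _; rewrite -EFinD lee_fin ler_normB.
have := weak_eq0 l12 => h.
apply: filterS (h _) => [x /subr0_eq//|phi tphi].
under eq_Rintegral do rewrite mulrBl.
rewrite RintegralB//; [|exact: integrableM_test_loc..].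
have := h1 _ tphi; rewrite (h2 _ tphi) => e.
have sg : (-1) ^+ size s != 0 :> R by rewrite signr_eq0.
by rewrite -(mulfI sg e) subrr.
Qed.

(** The weak derivative is tested on a tent along [i] times plateaus in the other directions. The
    [i]-th derivative of this product tends to the indicator of [L] minus that of [U]; the product
    itself is at most [h i] and vanishes outside [L] and [U]. All later gradient estimates come from
    this one. *)
Lemma box_difference (u v : rV -> R) (i : 'I_d) (a h : 'I_d -> R) (L U : set rV) :
  mu.-integrable setT (EFin \o u) -> mu.-integrable setT (EFin \o v) ->
  is_weak_partial u [:: i] v -> (forall j, 0 <= h j) ->
  L = rbox a (fun j => a j + h j) ->
  U = rbox (fun j => a j + h i *+ (j == i)) (fun j => a j + h i *+ (j == i) + h j) ->
  `|\int[mu]_(x in L) u x - \int[mu]_(x in U) u x| <= h i * \int[mu]_(x in L `|` U) `|v x|.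
Proof.
move=> iu iv [_ _ uv] h0 LE UE.
have [T TP] := choice (fun m => @smooth_tent R m (a i) (h i) (h0 i)).
pose f m j := if j == i then T m else plateau m (a j) (a j + h j).
have sf m j : smooth1 (f m j).
  by rewrite /f; case: eqP => _; [have [] := TP m|exact: smooth1_plateau].
pose phi m := prodf (f m).
have tphi m : test_function (phi m).
  apply: (@test_prodf _ _ _ a (fun j => a j + h j + h i *+ (j == i))) => // j t.
  rewrite /f; case: eqP => [->|_]; last by rewrite mulr0n addr0; exact: plateau_eq0.
  have [_ _ _ T0] := TP m; rewrite mulr1n (_ : _ + _ + _ = a i + 2 * h i); [exact: T0|ring].
have Dphi m x : 'D_(delta_mx ord0 i) (phi m) x = sbox m a (fun j => a j + h j) x -
   sbox m (fun j => a j + h i *+ (j == i)) (fun j => a j + h i *+ (j == i) + h j) x.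
  have [_ ->] := is_derive_prodf x i (sf m).
  rewrite /prodf /sbox /prodf (bigD1 i)//= [X in _ = X - _](bigD1 i)//= [X in _ = _ - X](bigD1 i)//=.
  rewrite !eqxx mulr1n /f eqxx.
  have [_ TD _ _] := TP m; rewrite TD mulrBl; congr (_ * _ - _ * _).
  - by apply: eq_bigr => j /negbTE ->.
  - by rewrite /plateau /bell; congr (1 - (1 - flat 1 _ * flat 1 _) ^+ m); ring.
  - by apply: eq_bigr => j /negbTE ->; rewrite mulr0n addr0.
have lim := cvgB (sbox_limit (a := a) (b := fun j => a j + h j) iu)
   (sbox_limit (a := fun j => a j + h i *+ (j == i)) (b := fun j => a j + h i *+ (j == i) + h j) iu).
have mLU : measurable (L `|` U) by rewrite LE UE; apply: measurableU; exact: measurable_rbox.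
have ivLU : mu.-integrable setT (EFin \o (fun x => `|v x| * \1_(L `|` U) x)).
  refine (@integrableM_bounded _ _ (fun x => `|v x|) \1_(L `|` U) 1 _ _ _).
  - exact: integrable_norm.
  - exact: measurable_indic.
  - by move=> x; rewrite indicE ger0_norm// lern1 leq_b1.
have bound m : `|\int[mu]_x (u x * sbox m a (fun j => a j + h j) x) -
   \int[mu]_x (u x * sbox m (fun j => a j + h i *+ (j == i)) (fun j => a j + h i *+ (j == i) + h j) x)|
   <= h i * \int[mu]_(x in L `|` U) `|v x|.
  rewrite -RintegralB//; [|by apply: integrableM_test => //; exact: sbox_test..].
  under eq_Rintegral do rewrite -mulrBr -Dphi.
  have -> := uv _ (tphi m); rewrite /= expr1 mulN1r normrN.
  have ivp : mu.-integrable setT (EFin \o (fun x => v x * phi m x)) by exact: integrableM_test.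
  apply: le_trans (le_normr_Rintegral _ _) _ => //.
  rewrite [X in _ <= _ * X]Rintegral_restrict -RintegralZl//.
  apply: le_Rintegral => //.
  - exact: integrable_norm.
  - rewrite (_ : _ \o _ = (fun x => (h i)%:E * (EFin \o (fun x => `|v x| * \1_(L `|` U) x)%R) x)%E).
      exact: integrableZl.
    by apply/funext => x /=; rewrite EFinM.
  move=> x _; rewrite normrM [leRHS]mulrCA ler_wpM2l//.
  have [_ _ Tb T0] := TP m.
  have [xLU|xLU] := pselect ((L `|` U) x).
    rewrite indicE mem_set// mulr1 /phi /prodf (bigD1 i)//= normrM {1}/f eqxx.
    have /andP[T1 T2] := Tb (x ord0 i).
    rewrite ger0_norm// -[leRHS]mulr1 ler_pM// normr_prod.
    apply: prodr_ile1 => j /negbTE ji; rewrite /f ji normr_ge0/=.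
    by rewrite ger0_norm ?plateau_ge0// plateau_le1.
  rewrite indicE memNset// mulr0 normr_le0; apply/negPn/negP => /prodf_neq0 fx.
  have fj j : j != i -> a j < x ord0 j < a j + h j.
    move=> ji; apply/negPn/negP => nx; have := fx j isT.
    by rewrite /f (negbTE ji) plateau_eq0// eqxx.
  have fi : a i < x ord0 i < a i + 2 * h i.
    by apply/negPn/negP => nx; have := fx i isT; rewrite /f eqxx T0// eqxx.
  apply: xLU; have [xi|xi] := ltP (x ord0 i) (a i + h i).
    left; rewrite LE => j; rewrite /= in_itv/=; case: (eqVneq j i) => [->|/fj].
      by rewrite xi andbT; case/andP: fi => /ltW.
    by case/andP => /ltW -> ->.
  right; rewrite UE => j; rewrite /= in_itv/=; case: (eqVneq j i) => [->|/fj].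
    by rewrite mulr1n xi/=; case/andP: fi => _; lra.
  by rewrite mulr0n addr0; case/andP => /ltW -> ->.
rewrite LE UE; apply: (cvgr_to_le (cvg_norm (lim _))); apply: nearW => m; rewrite -LE -UE.
exact: bound.
Qed.

End box_uniqueness.

(** * Averages over dyadic boxes *)

Section averages.
Context {R : realType} {d' : nat}.
Local Notation d := d'.+1.
Local Notation rV := 'rV[R]_d.
Local Notation mu := (@lebesgue_rV R d).
Implicit Types (n m k : nat) (x y : rV) (z : 'I_d -> int) (u v w : rV -> R) (f g : rV -> \bar R).

(** An enumeration by [nat], so that integrals split into series over the boxes of a level. An index
    that encodes no position yields the empty set. *)
Definition pbox n k : set rV :=
  if @pickle_inv {ffun 'I_d -> int} k is Some z then dbox n z else set0.

Lemma measurable_pbox n k : measurable (pbox n k).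
Proof. by rewrite /pbox; case: pickle_inv => [z|]; [exact: measurable_dbox|exact: measurable0]. Qed.

Lemma pbox_cover n : \bigcup_k pbox n k = [set: rV].
Proof.
apply/seteqP; split => // x _; exists (pickle [ffun i => cell n x i]) => //.
by rewrite /pbox pickleK_inv => i; rewrite ffunE.
Qed.

Lemma pbox_box n k x : pbox n k x -> pbox n k = box n x.
Proof.
rewrite /pbox; case: pickle_inv => // z xz.
by apply/seteqP; split => y yz i; rewrite yz xz.
Qed.

Lemma pbox_trivIset n : trivIset setT (pbox n).
Proof.
move=> k l _ _ [x []]; rewrite /pbox.
case Ek : (pickle_inv k) => [z|//]; case El : (pickle_inv l) => [z'|//] xz xz'.
have zz : z = z' by apply/ffunP => i; rewrite -xz -xz'.
rewrite -zz in El; have := @pickle_invK {ffun 'I_d -> int} k; have := @pickle_invK {ffun 'I_d -> int} l.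
by rewrite /oapp Ek El => <- <-.
Qed.

Lemma pbox0P n k : pbox n k = set0 \/ exists x, pbox n k = box n x.
Proof.
have [->|/set0P[x xk]] := eqVneq (pbox n k) set0; [by left|right].
by exists x; exact: pbox_box.
Qed.

Definition leveled (U : Type) n (f : rV -> U) := forall x y, box n x y -> f y = f x.

Lemma leveledW (U : Type) m n (f : rV -> U) : (m <= n)%N -> leveled m f -> leveled n f.
Proof. by move=> mn lf x y /(box_sub mn)/lf. Qed.

Lemma leveled_comp (U V : Type) n (f : rV -> U) (F : U -> V) :
  leveled n f -> leveled n (F \o f).
Proof. by move=> lf x y xy /=; rewrite (lf _ _ xy). Qed.

(** Every preimage is a union of boxes of level [n], of which there are countably many. *)
Lemma leveled_measurable d0 (U : measurableType d0) n (f : rV -> U) : leveled n f ->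
  measurable_fun setT f.
Proof.
move=> lf _ A mA; rewrite setTI.
rewrite (_ : f @^-1` A = \bigcup_k (if asbool (pbox n k `<=` f @^-1` A) then pbox n k else set0)).
  by apply: bigcupT_measurable => k; case: ifP => _; [exact: measurable_pbox|exact: measurable0].
apply/seteqP; split => x; last by move=> [k _]; case: asboolP => // h; exact: h.
move=> fx; have : [set: rV] x by [].
rewrite -(pbox_cover n) => -[k _ xk]; exists k => //; rewrite asboolT//.
by rewrite (pbox_box xk) => y /lf; rewrite /= => ->.
Qed.

Lemma integral_pbox n f : measurable_fun setT f -> (forall x, 0 <= f x)%E ->
  (\int[mu]_x f x = \sum_(k <oo) \int[mu]_(x in pbox n k) f x)%E.
Proof.
move=> mf f0; rewrite -ge0_integral_bigcup ?pbox_cover//.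
- by move=> k; exact: measurable_pbox.
- exact: pbox_trivIset.
Qed.

(** The conditional expectation on the boxes of level [n], used for non-negative extended functions;
    [2 ^+ n] is the inverse of the volume of a box. [An] is its counterpart for integrable real
    functions. *)
Definition En n f x : \bar R := ((2 ^+ n)%:E * \int[mu]_(y in box n x) f y)%E.

Lemma En_ge0 n f x : (forall x, 0 <= f x)%E -> (0 <= En n f x)%E.
Proof. by move=> f0; rewrite mule_ge0 ?lee_fin ?exprn_ge0//; exact: integral_ge0. Qed.

Lemma En_leveled n f : leveled n (En n f).
Proof. by move=> x y /box_eq; rewrite /En => ->. Qed.

Lemma integral_box_leveled n f x : leveled n f ->
  (\int[mu]_(y in box n x) f y = (2 ^- n)%:E * f x)%E.
Proof.
move=> lf; rewrite (eq_integral (cst (f x))); last by move=> y /set_mem /lf.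
rewrite (integral_cst mu (@measurable_box R d' n x)) /= mu_box; exact: muleC.
Qed.

Lemma exp2_fact n : ((2 ^+ n)%:E * (2 ^- n)%:E = 1%:E :> \bar R)%E.
Proof. by rewrite -EFinM divff// expf_neq0. Qed.

Lemma En_id n f x : leveled n f -> En n f x = f x.
Proof. by move=> lf; rewrite /En integral_box_leveled// muleA exp2_fact mul1e. Qed.

Lemma integral_En n f : measurable_fun setT f -> (forall x, 0 <= f x)%E ->
  (\int[mu]_x En n f x = \int[mu]_x f x)%E.
Proof.
move=> mf f0; rewrite (integral_pbox n mf f0) (@integral_pbox n (En n f)); last 2 first.
- exact: leveled_measurable (@En_leveled n f).
- by move=> x; exact: En_ge0.
apply: eq_eseriesr => k _; have [->|[x ->]] := pbox0P n k; first by rewrite !integral_set0.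
by rewrite (integral_box_leveled x (@En_leveled n f)) /En muleA [X in (X * _)%E]muleC exp2_fact mul1e.
Qed.

Lemma En_le n f g x : measurable_fun setT f -> measurable_fun setT g ->
  (forall x, 0 <= f x)%E -> (forall x, 0 <= g x)%E ->
  {ae mu, forall x, (f x <= g x)%E} -> (En n f x <= En n g x)%E.
Proof.
move=> mf mg f0 g0 fg; rewrite lee_wpmul2l ?lee_fin ?exprn_ge0//.
apply: ae_ge0_le_integral => //; first exact: measurable_box.
- exact: measurable_funTS.
- exact: measurable_funTS.
- by apply: filterS fg => y h _.
Qed.

Lemma En_nneseries n (F : nat -> rV -> \bar R) x : (forall k, measurable_fun setT (F k)) ->
  (forall k x, 0 <= F k x)%E ->
  (En n (fun x => \sum_(k <oo) F k x) x = \sum_(k <oo) En n (F k) x)%E.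
Proof.
move=> mF F0; rewrite /En integral_nneseries//; last 2 first.
- exact: measurable_box.
- by move=> k; exact: measurable_funTS.
rewrite nneseriesZl//; move=> k _; exact: integral_ge0.
Qed.

Definition An n u x : R := 2 ^+ n * \int[mu]_(y in box n x) u y.

Lemma An_leveled n u : leveled n (An n u).
Proof. by move=> x y /box_eq; rewrite /An => ->. Qed.

Lemma An_measurable n u : measurable_fun setT (An n u).
Proof. exact: leveled_measurable (@An_leveled n u). Qed.

Lemma integrable_box n u x : mu.-integrable setT (EFin \o u) ->
  mu.-integrable (box n x) (EFin \o u).
Proof. by move=> iu; apply: integrableS iu => //; exact: measurable_box. Qed.

Lemma EFin_An n u x : mu.-integrable setT (EFin \o u) ->
  (An n u x)%:E = En n (EFin \o u) x.
Proof.
move=> iu; rewrite /An /En EFinM; congr (_ * _)%E.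
by rewrite fineK//; apply: integrable_fin_num; [exact: measurable_box|exact: integrable_box].
Qed.

Lemma An_id n u x : leveled n u -> An n u x = u x.
Proof.
move=> lu; rewrite /An /Rintegral.
have := @integral_box_leveled n (EFin \o u) x (leveled_comp EFin lu); rewrite /= => ->.
by rewrite -EFinM /= mulrA divff ?mul1r// expf_neq0.
Qed.

Lemma AnB n u w x : mu.-integrable setT (EFin \o u) -> mu.-integrable setT (EFin \o w) ->
  An n (fun x => u x - w x) x = An n u x - An n w x.
Proof.
move=> iu iw; rewrite /An RintegralB ?mulrBr//; [exact: measurable_box|exact: integrable_box..].
Qed.

Lemma An_norm n u x : mu.-integrable setT (EFin \o u) ->
  `|An n u x| <= An n (fun x => `|u x|) x.
Proof.
move=> iu; rewrite /An normrM ger0_norm ?exprn_ge0// ler_wpM2l ?exprn_ge0//.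
apply: le_normr_Rintegral; [exact: measurable_box|exact: integrable_box].
Qed.

Lemma An_ge0 n u x : (forall x, 0 <= u x) -> 0 <= An n u x.
Proof. by move=> u0; rewrite mulr_ge0 ?exprn_ge0//; exact: Rintegral_ge0. Qed.

Lemma ge0_An_integrable n u : mu.-integrable setT (EFin \o u) -> (forall x, 0 <= u x) ->
  mu.-integrable setT (EFin \o An n u) /\ \int[mu]_x An n u x = \int[mu]_x u x.
Proof.
move=> iu u0; have /integrableP[mu_ fu] := iu.
have E : (\int[mu]_x (An n u x)%:E = \int[mu]_x (u x)%:E)%E.
  rewrite -(integral_En n mu_); last by move=> x; rewrite /= lee_fin.
  by apply: eq_integral => x _; rewrite EFin_An.
split; last by rewrite /Rintegral E.
apply/integrableP; split; first by apply/measurable_EFinP; exact: An_measurable.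
apply: le_lt_trans fu; under eq_integral do rewrite /= ger0_norm ?An_ge0//.
by rewrite E; under [X in (_ <= X)%E]eq_integral do rewrite /= ger0_norm//.
Qed.

Lemma An_integrable n u : mu.-integrable setT (EFin \o u) ->
  mu.-integrable setT (EFin \o An n u) /\
  \int[mu]_x `|An n u x| <= \int[mu]_x `|u x|.
Proof.
move=> iu; have inu := integrable_norm iu.
have [iA EA] := ge0_An_integrable n inu (fun x => normr_ge0 (u x)).
have iAu : mu.-integrable setT (EFin \o An n u).
  apply: (le_integrable _ _ _ iA) => //; first by apply/measurable_EFinP; exact: An_measurable.
  by move=> x _ /=; rewrite lee_fin (le_trans (An_norm n x iu))// ler_norm.
split => //; rewrite -EA; apply: le_Rintegral => //; first exact: integrable_norm.
by move=> x _; exact: An_norm.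
Qed.

Lemma An_integral n u : mu.-integrable setT (EFin \o u) ->
  \int[mu]_x An n u x = \int[mu]_x u x.
Proof.
move=> iu; have [iA _] := An_integrable n iu.
congr fine; rewrite -(pbox_cover n) !integral_bigcup ?pbox_cover//;
  try (by move=> k; exact: measurable_pbox); try exact: pbox_trivIset.
apply: eq_eseriesr => k _; have [->|[x ->]] := pbox0P n k; first by rewrite !integral_set0.
rewrite (@integral_box_leveled n (EFin \o An n u) x (leveled_comp EFin (@An_leveled n u))) /=.
by rewrite EFin_An// /En muleA [X in (X * _)%E]muleC exp2_fact mul1e.
Qed.

End averages.

Section floor2.
Context {R : realType}.

Lemma floor_double_or (t : R) :
  Num.floor (2 * t) = 2 * Num.floor t \/ Num.floor (2 * t) = 2 * Num.floor t + 1.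
Proof.
have /andP[h1 h2] := floor_itv t; rewrite intrD in h2.
have [h|h] := ltP (2 * t) (2 * (Num.floor t)%:~R + 1).
  by left; apply: floor_def; rewrite intrD intrM; apply/andP; split; lra.
by right; apply: floor_def; rewrite !intrD intrM; apply/andP; split; lra.
Qed.

End floor2.

(** * The rate 2^(-1/d) and the sides of the boxes *)

Section rate.
Context {R : realType} {d' : nat}.
Local Notation d := d'.+1.

Definition qr : R := (2^-1) `^ (d%:R^-1).

Lemma qr_gt0 : 0 < qr. Proof. by rewrite powR_gt0. Qed.

Lemma qrXd : qr ^+ d = 2^-1.
Proof. by rewrite -powR_mulrn ?powR_ge0// -powRrM mulVf ?powRr1// pnatr_eq0. Qed.

Lemma qr_lt1 : qr < 1.
Proof.
rewrite ltNge; apply/negP => h; have : 1 <= qr ^+ d by rewrite exprn_ege1.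
by rewrite qrXd leNgt invf_lt1// ltr1n.
Qed.

Lemma qr_ge0 : 0 <= qr. Proof. exact: ltW qr_gt0. Qed.

Lemma side_qr n (i : 'I_d) : side n i = qr ^+ (d * lev n i).
Proof. by rewrite exprM qrXd exprVn. Qed.

Lemma qrX_le m n : (m <= n)%N -> qr ^+ n <= qr ^+ m.
Proof. by move=> mn; apply: ler_wiXn2l => //; [exact: qr_ge0|exact/ltW/qr_lt1]. Qed.

Lemma side_le n (i : 'I_d) : side n i <= 2 * qr ^+ n.
Proof.
have [_ h] := lev_bounds n i; have := qrX_le h.
by rewrite mulnS exprD qrXd -side_qr; lra.
Qed.

Lemma side_ge n (i : 'I_d) : qr ^+ n <= 2 * side n i.
Proof.
have [h _] := lev_bounds n i; have := qrX_le h.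
by rewrite -side_qr exprD qrXd; lra.
Qed.

Definition qS : R := (1 - qr)^-1.

Lemma qS_ge0 : 0 <= qS. Proof. by rewrite invr_ge0 subr_ge0 ltW// qr_lt1. Qed.

Lemma sum_qr_le m n : \sum_(m <= j < n) qr ^+ j <= qS * qr ^+ m.
Proof.
have q1 : 0 < 1 - qr by rewrite subr_gt0 qr_lt1.
have [nm|mn] := leqP n m.
  by rewrite big_geq// mulr_ge0 ?qS_ge0 ?exprn_ge0 ?qr_ge0.
suff : \sum_(m <= j < n) qr ^+ j = qS * (qr ^+ m - qr ^+ n).
  by move=> ->; rewrite ler_wpM2l ?qS_ge0// gerBl exprn_ge0// qr_ge0.
have <- : (1 - qr) * (\sum_(m <= j < n) qr ^+ j) = qr ^+ m - qr ^+ n.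
  rewrite mulr_sumr (eq_bigr (fun j => - (qr ^+ j.+1 - qr ^+ j))).
    by rewrite sumrN (telescope_sumr (fun j => qr ^+ j) (ltnW mn)) opprB.
  by move=> j _; rewrite exprS; ring.
by rewrite /qS mulrA mulVf ?mul1r// lt0r_neq0.
Qed.

Lemma nneseries_qr_le m : (\sum_(m <= j <oo) (qr ^+ j)%:E <= (qS * qr ^+ m)%:E)%E.
Proof.
apply: lime_le; first by apply: is_cvg_nneseries => n _ _; rewrite lee_fin exprn_ge0// qr_ge0.
by apply: nearW => n; rewrite sumEFin lee_fin sum_qr_le.
Qed.

End rate.

(** * The two halves of a box *)

Section splitting.
Context {R : realType} {d' : nat}.
Local Notation d := d'.+1.
Local Notation rV := 'rV[R]_d.
Local Notation mu := (@lebesgue_rV R d).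
Local Notation spl := (@spl d').
Local Notation side := (@side R d').
Implicit Types (n m k : nat) (x y : rV) (z : 'I_d -> int) (u v w : rV -> R).

Definition child n z (b : int) : 'I_d -> int :=
  fun j => if j == spl n then 2 * z j + b else z j.

Lemma cell_child n x : exists2 b : int, b = 0 \/ b = 1 & cell n.+1 x =1 child n (cell n x) b.
Proof.
have E (j : 'I_d) : cell n.+1 x j = if j == spl n then Num.floor (2 * (2 ^+ lev n j * x ord0 j)) else cell n x j.
  rewrite /cell levS eq_sym; case: eqP => _; last by rewrite addn0.
  by rewrite addn1 exprS mulrA.
have [h|h] := @floor_double_or R (2 ^+ lev n (spl n : 'I_d) * x ord0 (spl n)).
  exists 0; first by left.
  by move=> j; rewrite E /child; case: eqP => // ->; rewrite h addr0.
exists 1; first by right.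
by move=> j; rewrite E /child; case: eqP => // ->; rewrite h.
Qed.

Lemma dbox_child n z b : b = 0 \/ b = 1 -> (dbox n.+1 (child n z b) : set rV) `<=` dbox n z.
Proof.
move=> b01 x xb; have [c c01 xc] := cell_child n x; move=> j.
have := xb j; rewrite xc /child; case: eqP => [->|//].
by case: b01 => ->; case: c01 => ->; lia.
Qed.

Definition lower n x : set rV := dbox n.+1 (child n (cell n x) 0).
Definition upper n x : set rV := dbox n.+1 (child n (cell n x) 1).

Lemma box_split n x : box n x = lower n x `|` upper n x.
Proof.
apply/seteqP; split => y; last first.
  by move=> [/dbox_child h|/dbox_child h]; apply: h; [left|right].
move=> xy; have [b b01 yb] := cell_child n y.
have h : cell n.+1 y =1 child n (cell n x) b by move=> j; rewrite yb /child xy.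
by case: b01 h => ->; [left|right].
Qed.

Lemma box_next n x : box n.+1 x = lower n x \/ box n.+1 x = upper n x.
Proof.
have [b b01 yb] := cell_child n x.
by case: b01 yb => -> yb; [left|right]; apply/seteqP; split => y h j; rewrite h// yb.
Qed.

Lemma lower_upper_disjoint n x : lower n x `&` upper n x = set0.
Proof.
apply/seteqP; split => // y [/(_ (spl n)) h /(_ (spl n))]; rewrite h /child eqxx; lia.
Qed.

Definition corner n x (i : 'I_d) : R := (child n (cell n x) 0 i)%:~R * side n.+1 i.

Lemma lower_rbox n x :
  lower n x = rbox (corner n x) (fun j => corner n x j + side n.+1 j).
Proof.
rewrite /lower dbox_rbox; apply/seteqP; split => y h j; have := h j;
  by rewrite /= /corner intrD mulrDl mul1r.
Qed.

Lemma upper_rbox n x : upper n x =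
  rbox (fun j => corner n x j + side n.+1 (spl n) *+ (j == spl n))
       (fun j => corner n x j + side n.+1 (spl n) *+ (j == spl n) + side n.+1 j).
Proof.
have E (j : 'I_d) : (child n (cell n x) 1 j)%:~R * side n.+1 j =
    corner n x j + side n.+1 (spl n) *+ (j == spl n) :> R.
  rewrite /corner /child; case: eqP => [->|_]; last by rewrite mulr0n addr0.
  by rewrite mulr1n addr0 intrD mulrDl mul1r.
rewrite /upper dbox_rbox; apply/seteqP; split => y h j; have := h j;
  by rewrite /= intrD mulrDl mul1r E.
Qed.

(** With [a] and [b] the integrals over the two halves, the finer average is [2 ^+ n] times [2 * a]
    or [2 * b], the coarser one [2 ^+ n] times [a + b]. *)
Lemma An_next n u x : mu.-integrable setT (EFin \o u) ->
  `|An n.+1 u x - An n u x| =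
  2 ^+ n * `|\int[mu]_(y in lower n x) u y - \int[mu]_(y in upper n x) u y|.
Proof.
move=> iu; rewrite /An (@box_split n x) Rintegral_setU; last 4 first.
- exact: measurable_dbox.
- exact: measurable_dbox.
- by rewrite -box_split; exact: integrable_box.
- by rewrite disj_set2E lower_upper_disjoint.
set a := \int[mu]_(y in lower n x) u y; set b := \int[mu]_(y in upper n x) u y.
rewrite -[X in X * `|a - b|]ger0_norm ?exprn_ge0// -normrM.
have [->|->] := box_next n x; rewrite -/a -/b exprS.
  by congr `|_|; ring.
by rewrite -normrN; congr `|_|; ring.
Qed.

End splitting.

(** * Gradient estimates for averages *)

Section gradient.
Context {R : realType} {d' : nat}.
Local Notation d := d'.+1.
Local Notation rV := 'rV[R]_d.
Local Notation mu := (@lebesgue_rV R d).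
Local Notation spl := (@spl d').
Local Notation side := (@side R d').
Local Notation qr := (@qr R d').
Local Notation dir i := (delta_mx ord0 i : rV).
Variables (u : rV -> R) (v : 'I_d -> rV -> R).
Hypothesis iu : mu.-integrable setT (EFin \o u).
Hypothesis iv : forall i, mu.-integrable setT (EFin \o v i).
Hypothesis uv : forall i, is_weak_partial u [:: i] (v i).

Definition grad x : R := \sum_i `|v i x|.

Lemma grad_ge0 x : 0 <= grad x.
Proof. by apply: sumr_ge0. Qed.

Lemma grad_integrable : mu.-integrable setT (EFin \o grad).
Proof.
rewrite (_ : _ \o _ = (fun x => \sum_(i < d) (`|v i x|%R)%:E)%E).
  by apply: integrable_sum => // i _; exact: (integrable_norm (iv i)).
by apply/funext => x /=; rewrite sumEFin.
Qed.

Lemma grad_ge i x : `|v i x| <= grad x.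
Proof. by rewrite /grad (bigD1 i)//= lerDl sumr_ge0. Qed.

(** [box_difference] for the two halves of the box, whose distance is the side of level [n.+1] in
    the direction that was cut. *)
Lemma An_grad n x : `|An n.+1 u x - An n u x| <= 2 * qr ^+ n * An n grad x.
Proof.
rewrite An_next//.
have h := box_difference iu (iv (spl n)) (uv (spl n)) (fun j => ltW (side_gt0 n.+1 j))
  (lower_rbox n x) (upper_rbox n x).
rewrite -box_split in h.
have vg : \int[mu]_(y in box n x) `|v (spl n) y| <= \int[mu]_(y in box n x) grad y.
  apply: le_Rintegral; first exact: measurable_box.
  - by apply: integrable_box; exact: integrable_norm.
  - by apply: integrable_box; exact: grad_integrable.
  - by move=> y _; exact: grad_ge.
have sn : side n.+1 (spl n) <= 2 * qr ^+ n.
  by rewrite (le_trans (side_le _ _))// ler_wpM2l// qrX_le.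
rewrite /An mulrCA ler_wpM2l ?exprn_ge0//.
apply: (le_trans h); apply: ler_pM => //.
  by rewrite ltW// side_gt0.
by apply: Rintegral_ge0.
Qed.

Lemma box_addv n i x : box n (side n i *: dir i + x) =
  rbox (fun j => (cell n x j)%:~R * side n j + side n i *+ (j == i))
       (fun j => (cell n x j)%:~R * side n j + side n i *+ (j == i) + side n j).
Proof.
have E j : cell n (side n i *: dir i + x) j = cell n x j + (j == i)%:Z.
  rewrite /cell line_coord eq_sym; case: eqP => [->|_]; last by rewrite add0r addr0.
  rewrite mulr1n mulrDr mulfV ?gt_eqF ?exprn_gt0// [LHS](_ : _ = Num.floor (1%:~R + 2 ^+ lev n i * x ord0 i))//.
  by rewrite floorDzr ?intr_int// intrKfloor addrC.
rewrite box_dbox dbox_rbox; apply/seteqP; split => y h j; have := h j;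
  by rewrite /= E; case: eqVneq => [->|_]; rewrite /= ?addr0 !intrD !mulrDl ?mul1r ?mul0r ?addr0.
Qed.

Lemma box_rbox n x : box n x =
  rbox (fun j => (cell n x j)%:~R * side n j) (fun j => (cell n x j)%:~R * side n j + side n j).
Proof.
rewrite box_dbox dbox_rbox; apply/seteqP; split => y h j; have := h j;
  by rewrite /= !intrD !mulrDl !mul1r.
Qed.

Lemma An_hop n i x : `|An n u (side n i *: dir i + x) - An n u x| <=
  side n i * (An n (fun y => `|v i y|) x + An n (fun y => `|v i y|) (side n i *: dir i + x)).
Proof.
have h := box_difference iu (iv i) (uv i) (fun j => ltW (side_gt0 n j))
  (box_rbox n x) (box_addv n i x).
rewrite Rintegral_setU in h; last 4 first.
- exact: measurable_box.
- exact: measurable_box.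
- apply: integrableS (integrable_norm (iv i)) => //; apply: measurableU; exact: measurable_box.
- rewrite disj_set2E; apply/eqP/seteqP; split => // y [].
  rewrite box_rbox box_addv => /(_ i) h1 /(_ i); move: h1.
  by rewrite /= !in_itv/= eqxx mulr1n => /andP[_ h1] /andP[h2 _]; lra.
rewrite /An -mulrBr -mulrDr normrM ger0_norm ?exprn_ge0// mulrCA ler_wpM2l ?exprn_ge0//.
by rewrite distrC.
Qed.

(** A bound on the jumps of the step function [An n u] along its own grid. The factor 2 comes from
    the two neighbouring boxes in [An_hop], each contributing an average of [|v i|], and averaging
    and translation preserve its integral. *)
Lemma An_hop_L1 n i :
  \int[mu]_x `|An n u (side n i *: dir i + x) - An n u x| <=
  2 * side n i * \int[mu]_x `|v i x|.
Proof.
have [iA _] := An_integrable n iu.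
have inv := integrable_norm (iv i).
have [iV EV] := ge0_An_integrable n inv (fun x => normr_ge0 (v i x)).
have iV' := integrable_addv (side n i *: dir i) iV.
have iVV : mu.-integrable setT (EFin \o (fun x => An n (fun y => `|v i y|) x +
    An n (fun y => `|v i y|) (side n i *: dir i + x))).
  rewrite (_ : _ \o _ = (fun x => (An n (fun y => `|v i y|) x)%R%:E +
     (An n (fun y => `|v i y|) (side n i *: dir i + x))%R%:E)%E)//.
  exact: integrableD.
apply: (@le_trans _ _ (\int[mu]_x (side n i * (An n (fun y => `|v i y|) x +
    An n (fun y => `|v i y|) (side n i *: dir i + x))))).
  apply: le_Rintegral => //.
  - apply: integrable_norm.
    rewrite (_ : _ \o _ = (fun x => (An n u (side n i *: dir i + x))%R%:E - (An n u x)%:E)%E)//.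
    by apply: integrableB => //; exact: integrable_addv.
  - rewrite (_ : _ \o _ = (fun x => (side n i)%:E * (An n (fun y => `|v i y|) x +
    An n (fun y => `|v i y|) (side n i *: dir i + x))%R%:E)%E).
      exact: integrableZl.
    by apply/funext => x /=; rewrite EFinM.
  - by move=> x _; exact: An_hop.
rewrite RintegralZl// RintegralD//.
have -> := Rintegral_addv (side n i *: dir i) iV.
by rewrite EV -mulr2n -[X in _ * X]mulr_natl mulrCA mulrA.
Qed.

End gradient.

Lemma emeasurable_nneseries d (T : measurableType d) (R : realType)
    (h : nat -> T -> \bar R) : (forall k, measurable_fun setT (h k)) ->
  (forall k x, 0 <= h k x)%E ->
  measurable_fun setT (fun x => \sum_(i <oo) h i x)%E.
Proof.
move=> mh h0; rewrite (_ : (fun x => _) = (fun x => \sum_(0 <= i <oo | i \in predT) h i x)%E).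
  exact: ge0_emeasurable_sum.
by apply/funext => x; apply: eq_eseriesl.
Qed.

(** * Almost everywhere and mean convergence of the averages *)

Section convergence.
Context {R : realType} {d' : nat}.
Local Notation d := d'.+1.
Local Notation rV := 'rV[R]_d.
Local Notation mu := (@lebesgue_rV R d).
Local Notation qr := (@qr R d').
Local Notation qS := (@qS R d').

Lemma integral_box_An n (w : rV -> R) m (z : 'I_d -> int) : (m <= n)%N ->
  mu.-integrable setT (EFin \o w) ->
  \int[mu]_(x in dbox m z) An n w x = \int[mu]_(x in dbox m z) w x.
Proof.
move=> mn iw; set B := dbox m z.
have mB : measurable B by exact: measurable_dbox.
pose w' x := w x * \1_B x.
have iw' : mu.-integrable setT (EFin \o w').
  apply: (@integrableM_bounded _ _ w \1_B 1) => //.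
  by move=> x; rewrite indicE ger0_norm// lern1 leq_b1.
have lB : leveled n (\1_B : rV -> R).
  move=> x y xy; rewrite !indicE; congr (nat_of_bool _)%:R.
  have := box_sub mn xy => xy'.
  by apply/idP/idP => /set_mem h; apply/mem_set => i; rewrite -h// xy'.
rewrite (Rintegral_restrict (An n w) B) (Rintegral_restrict w B) -(An_integral n iw'); apply: eq_Rintegral => x _.
rewrite /An -mulrA; congr (_ * _).
rewrite -RintegralZr//; [|exact: measurable_box|exact: integrable_box].
by apply: eq_Rintegral => y /set_mem /lB; rewrite /w' => ->.
Qed.

Variables (u : rV -> R) (v : 'I_d -> rV -> R).
Hypothesis iu : mu.-integrable setT (EFin \o u).
Hypothesis iv : forall i, mu.-integrable setT (EFin \o v i).
Hypothesis uv : forall i, is_weak_partial u [:: i] (v i).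

Let inc n x : R := `|An n.+1 u x - An n u x|.

(** The total variation of the averages at [x] from level [n] on. By [An_grad] its integral is at
    most the tail of a geometric series. *)
Let T n x : \bar R := (\sum_(n <= j <oo) (inc j x)%:E)%E.

Let Gint : R := \int[mu]_x grad v x.

Let inc_ge0 n x : (0 <= (inc n x)%:E)%E.
Proof. by rewrite lee_fin; exact: normr_ge0. Qed.

Let minc n : measurable_fun setT (EFin \o inc n).
Proof.
apply/measurable_EFinP; apply: measurableT_comp => //.
by apply: measurable_funB; exact: An_measurable.
Qed.

Let inc_int n : (\int[mu]_x (inc n x)%:E <= (2 * qr ^+ n * Gint)%:E)%E.
Proof.
have ig := grad_integrable iv.
have [iA EA] := ge0_An_integrable n ig (grad_ge0 v).
rewrite /Gint -EA -RintegralZl// fineK.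
  apply: ge0_le_integral => //.
  - exact: minc.
  - by apply/measurable_EFinP; apply: measurable_funM => //; exact: An_measurable.
  - by move=> x _; rewrite lee_fin; exact: An_grad.
apply: integrable_fin_num => //.
rewrite (_ : (fun x => _) = (fun x => (2 * qr ^+ n)%:E * (EFin \o An n (grad v)) x)%E).
  exact: integrableZl.
by apply/funext => x; rewrite EFinM.
Qed.

Let Gint_ge0 : 0 <= Gint.
Proof. by apply: Rintegral_ge0 => x _; exact: grad_ge0. Qed.

Let T_ge0 n x : (0 <= T n x)%E.
Proof. by apply: nneseries_ge0 => j _ _; exact: inc_ge0. Qed.

Let TE n x : T n x = (\sum_(i <oo) (inc (i + n) x)%:E)%E.
Proof. by rewrite (@nneseries_addn _ (fun i => (inc i x)%:E)). Qed.

Let mT n : measurable_fun setT (T n).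
Proof.
rewrite (_ : T n = (fun x => \sum_(i <oo) (inc (i + n) x)%:E)%E).
  by apply: emeasurable_nneseries => k //; exact: minc.
by apply/funext => x; exact: TE.
Qed.

Let T_int n : (\int[mu]_x T n x <= (2 * qS * qr ^+ n * Gint)%:E)%E.
Proof.
under eq_integral do rewrite TE.
rewrite integral_nneseries; [|exact: measurableT|by move=> i; exact: minc|by move=> i x _; exact: inc_ge0].
apply: (@le_trans _ _ (\sum_(i <oo) (2 * Gint)%:E * (qr ^+ (i + n))%:E)%E).
  apply: lee_nneseries => [i _ _|i _].
    by apply: integral_ge0 => x _; exact: inc_ge0.
  by rewrite (le_trans (inc_int _))// -EFinM lee_fin mulrAC.
rewrite nneseriesZl; last by move=> i _; rewrite lee_fin exprn_ge0// qr_ge0.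
rewrite (@nneseries_addn _ (fun i => (qr ^+ i)%:E)); last first.
  by move=> i; rewrite lee_fin exprn_ge0// qr_ge0.
apply: (@le_trans _ _ ((2 * Gint)%:E * (qS * qr ^+ n)%:E)%E).
  by apply: lee_wpmul2l; [rewrite lee_fin mulr_ge0|exact: nneseries_qr_le].
by rewrite -EFinM lee_fin le_eqVlt; apply/orP; left; apply/eqP; ring.
Qed.

Let T_bound x l n : An j u x @[j --> \oo] --> l -> (`|l - An n u x|%:E <= T n x)%E.
Proof.
move=> ul.
have : `|An j u x - An n u x|%:E @[j --> \oo] --> `|l - An n u x|%:E.
  apply: cvg_EFin; first exact: nearW.
  by apply: cvg_norm; apply: cvgB => //; exact: cvg_cst.
move/cvge_to_le; apply; near=> N.
have nN : (n <= N)%N by near: N; exact: nbhs_infty_ge.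
rewrite (le_trans _ (nneseries_lim_ge N _))//.
rewrite sumEFin lee_fin -(telescope_sumr (fun j => An j u x) nN).
exact: ler_norm_sum.
Unshelve. all: by end_near. Qed.

Let T_cvg x : (T 0 x < +oo)%E -> cvgn (fun n => An n u x).
Proof.
move=> Tx.
have h : cvgn [series An j.+1 u x - An j u x]_j.
  apply: normed_cvg; apply: nondecreasing_is_cvgn.
    apply: nondecreasing_series => k _ _; exact: normr_ge0.
  exists (fine (T 0 x)) => _ [n _ <-].
  rewrite -lee_fin fineK ?ge0_fin_numE//.
  rewrite /series/= -sumEFin.
  by apply: (nneseries_lim_ge n).
rewrite (_ : (fun n => _) = (fun n => An 0 u x + [series An j.+1 u x - An j u x]_j n)).
  by apply: is_cvgD => //; exact: is_cvg_cst.
apply/funext => n; rewrite /series/= telescope_sumr// addrC subrK//.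
Qed.

(** The increments are summable in mean, so the averages converge almost everywhere, dominated by
    [|An 0 u|] plus their total variation. The limit has the same integral as [u] on every box and
    is therefore [u]. *)
Lemma An_cvg : {ae mu, forall x, An n u x @[n --> \oo] --> u x}.
Proof.
have iT : mu.-integrable setT (T 0).
  apply/integrableP; split; first exact: mT.
  under eq_integral do rewrite gee0_abs//.
  by apply: le_lt_trans (T_int 0) _; rewrite ltry.
have aeT : {ae mu, forall x, cvgn (fun n => An n u x)}.
  apply: filterS (integrable_ae measurableT iT) => x /(_ I) Tx.
  by apply: T_cvg; rewrite -ge0_fin_numE.
(* An upper limit exists everywhere and is measurable; it is the limit wherever the averages
   converge. *)
pose ut x : R := fine (limn_esup (fun n => (An n u x)%:E)).
have mut : measurable_fun setT ut.
  apply: (measurableT_comp (f := fine)) => //.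
  by apply: measurable_fun_limn_esup => n; apply/measurable_EFinP; exact: An_measurable.
have aeut : {ae mu, forall x, An n u x @[n --> \oo] --> ut x}.
  apply: filterS aeT => x cx.
  have : (An n u x)%:E @[n --> \oo] --> (limn (fun n => An n u x))%:E.
    by apply: cvg_EFin; [exact: nearW|exact: cx].
  by move=> /cvg_limn_einf_sup[_ E]; rewrite /ut E.
have iu0 := (An_integrable 0 iu).1.
have ig : mu.-integrable setT (fun x => `|An 0 u x|%:E + T 0 x)%E.
  by apply: integrableD => //; exact: (integrable_norm iu0).
have dom : {ae mu, forall x, forall n, `|(An n u x)%:E| <= `|An 0 u x|%:E + T 0 x}%E.
  apply: aeW => x n /=.
  have : (`|An n u x - An 0 u x|%:E <= T 0 x)%E.
    rewrite (le_trans _ (nneseries_lim_ge n _))//.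
    by rewrite sumEFin lee_fin -(telescope_sumr (fun j => An j u x) (leq0n n)) ler_norm_sum.
  move=> /(leeD2l `|An 0 u x|%:E); apply: le_trans.
  by rewrite -EFinD lee_fin -[X in `|X| <= _](subrK (An 0 u x)) [leRHS]addrC ler_normD.
have DC B : measurable B -> mu.-integrable B (EFin \o ut) /\
    (\int[mu]_(x in B) (An n u x)%:E)%E @[n --> \oo] --> (\int[mu]_(x in B) (ut x)%:E)%E.
  move=> mB.
  have [|||||i1 _ h] := @dominated_convergence _ _ _ mu B mB (fun n => EFin \o An n u) (EFin \o ut)
    (fun x => `|An 0 u x|%:E + T 0 x)%E.
  - by move=> n; apply/measurable_EFinP/measurable_funTS; exact: An_measurable.
  - by apply/measurable_EFinP/measurable_funTS.
  - by apply: filterS aeut => x h _; apply: cvg_EFin; [exact: nearW|exact: h].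
  - exact: integrableS ig.
  - by apply: filterS dom => x h n _; exact: h.
  by split.
have ae0 : {ae mu, forall x, ut x - u x = 0}.
  have mu_ : measurable_fun setT u by have /integrableP[/measurable_EFinP] := iu.
  have iB m (z : 'I_d -> int) : mu.-integrable (dbox m z) (EFin \o u).
    by apply: integrableS iu => //; exact: measurable_dbox.
  apply: dbox_ae_eq0; first exact: measurable_funB.
    move=> m z; have [iut _] := DC _ (measurable_dbox m z).
    rewrite (_ : _ \o _ = (fun x => (ut x)%:E - (u x)%:E)%E)//.
    by apply: integrableB => //; exact: measurable_dbox.
  move=> m z; have [iut h] := DC _ (measurable_dbox m z).
  rewrite RintegralB//; [|exact: measurable_dbox]; apply/eqP; rewrite subr_eq0; apply/eqP.
  rewrite /Rintegral; congr fine.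
  apply: (cvg_unique _ h); first exact: ereal_hausdorff.
  (* From level [m] on, averaging leaves the integral over a box of level [m] unchanged, so the
     sequence is eventually constant. *)
  apply: cvg_near_cst; near=> n.
  have mn : (m <= n)%N by near: n; exact: nbhs_infty_ge.
  have E := congr1 EFin (integral_box_An z mn iu); move: E.
  have f1 := integrable_fin_num (measurable_dbox m z) (iB m z).
  have iAB : mu.-integrable (dbox m z) (EFin \o An n u).
    by apply: integrableS (An_integrable n iu).1 => //; exact: measurable_dbox.
  have f2 := integrable_fin_num (measurable_dbox m z) iAB.
  by rewrite /Rintegral (fineK f1) (fineK f2).
apply: filterS2 aeut ae0 => x h /subr0_eq <-; exact: h.
Unshelve. all: by end_near. Qed.

Lemma An_L1 n : mu.-integrable setT (EFin \o (fun x => u x - An n u x)) /\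
  \int[mu]_x `|u x - An n u x| <= 2 * qS * qr ^+ n * \int[mu]_x grad v x.
Proof.
have iA := (An_integrable n iu).1.
have iD : mu.-integrable setT (EFin \o (fun x => u x - An n u x)).
  rewrite (_ : _ \o _ = (fun x => (u x)%:E - (An n u x)%:E)%E)//.
  exact: integrableB.
split => //; rewrite -lee_fin -/Gint.
apply: le_trans (T_int n).
rewrite fineK; last exact: integrable_fin_num (integrable_norm iD).
apply: ae_ge0_le_integral => //.
- by have /integrableP[] := integrable_norm iD.
- by apply: filterS An_cvg => x h _; exact: T_bound.
Qed.

End convergence.

(** * The first order case *)

Section quantiles.
Context {R : realType} {d' : nat}.
Local Notation d := d'.+1.
Local Notation rV := 'rV[R]_d.
Local Notation mu := (@lebesgue_rV R d).
Variable u : rV -> R.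
Hypothesis iu : mu.-integrable setT (EFin \o u).

Let W x : R := `|u x|.

Let iW : mu.-integrable setT (EFin \o W). Proof. exact: integrable_norm. Qed.

Let mW : measurable_fun setT W. Proof. by have /integrableP[/measurable_EFinP] := iW. Qed.

(** Chebyshev's inequality on a box, [r] being a lower bound for the fraction of the box that [A]
    fills. *)
Lemma An_chebyshev n x (phi : rV -> R) (A : set rV) (c r : R) :
  mu.-integrable setT (EFin \o phi) -> (forall y, 0 <= phi y) ->
  measurable A -> A `<=` box n x -> 0 <= c -> (forall y, A y -> c <= phi y) ->
  ((r * 2 ^- n)%:E <= mu A)%E -> c * r <= An n phi x.
Proof.
move=> iphi phi0 mA Ax c0 cphi rA.
have h : ((c * (r * 2 ^- n))%:E <= \int[mu]_(y in box n x) (phi y)%:E)%E.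
  apply: (@le_trans _ _ (\int[mu]_(y in A) (phi y)%:E)%E); last first.
    apply: ge0_subset_integral => //; first exact: measurable_box.
    - by apply/measurable_EFinP/measurable_funTS; have /integrableP[/measurable_EFinP] := iphi.
    - by move=> y _; rewrite lee_fin.
  apply: (@le_trans _ _ (\int[mu]_(y in A) cst c%:E y)%E); last first.
    apply: ge0_le_integral => //.
    by apply/measurable_EFinP/measurable_funTS; have /integrableP[/measurable_EFinP] := iphi.
  by rewrite (integral_cst mu mA) EFinM lee_wpmul2l// lee_fin.
have fin := integrable_fin_num (measurable_box n x) (integrable_box n x iphi).
move: h; rewrite -(fineK fin) lee_fin => h.
have -> : c * r = 2 ^+ n * (c * (r * 2 ^- n)) by field; rewrite expf_neq0.
by rewrite /An ler_wpM2l// exprn_ge0.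
Qed.

Definition high n x (t : R) : set rV := box n x `&` [set y | t <= `|u y|].

Lemma measurable_high n x t : measurable (high n x t).
Proof.
apply: measurableI; first exact: measurable_box.
rewrite (_ : mkset _ = W @^-1` `[t, +oo[); last first.
  by apply/seteqP; split => y; rewrite /= in_itv/= andbT.
by rewrite -[X in measurable X]setTI; exact: mW.
Qed.

Lemma mu_high_fin n x t : mu (high n x t) \is a fin_num.
Proof.
rewrite ge0_fin_numE//; apply: (@le_lt_trans _ _ (mu (box n x))).
  by apply: le_measure; rewrite ?inE; [exact: measurable_high|exact: measurable_box|exact: subIsetl].
by rewrite mu_box ltry.
Qed.

(** Why a quarter: a set that fills less than a quarter of a box fills less than half of either of
    its halves. [qinc_gap] uses this to pass from level [n] to [n.+1]. *)
Let levels n x : set R := [set t | 0 <= t /\ ((4^-1 * 2 ^- n)%:E <= mu (high n x t))%E].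

Definition quantile n x : R := sup (levels n x).

Let levels0 n x : levels n x 0.
Proof.
split => //; rewrite (_ : high n x 0 = box n x); last first.
  by apply/seteqP; split => y; [case|split=> //=].
by rewrite mu_box lee_fin ler_piMl// ?invr_ge0 ?exprn_ge0// invf_le1// ler1n.
Qed.

Let levels_ub n x t : levels n x t -> t <= 4 * An n W x.
Proof.
move=> [t0 ht].
have h : t * 4^-1 <= An n W x.
  exact: (@An_chebyshev n x W (high n x t) t 4^-1 iW (fun y => normr_ge0 (u y))
    (measurable_high n x t) (@subIsetl _ _ _) t0 (fun y h => h.2) ht).
by rewrite mulrC -ler_pdivrMr.
Qed.

Let levels_sup n x : has_sup (levels n x).
Proof.
by split; [exists 0; exact: levels0|exists (4 * An n W x) => t; exact: levels_ub].
Qed.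

Lemma quantile_ge0 n x : 0 <= quantile n x.
Proof. by apply: (ub_le_sup (levels_sup n x).2); exact: levels0. Qed.

Lemma quantile_le n x : quantile n x <= 4 * An n (fun y => `|u y|) x.
Proof. by apply: ge_sup; [exists 0; exact: levels0|move=> t; exact: levels_ub]. Qed.

Lemma mu_high_le n x (s t : R) : s <= t -> (mu (high n x t) <= mu (high n x s))%E.
Proof.
move=> st; apply: le_measure; rewrite ?inE; [exact: measurable_high..|].
by move=> y [yx /= yt]; split => //=; exact: le_trans yt.
Qed.

Lemma lt_quantile n x t : t < quantile n x -> ((4^-1 * 2 ^- n)%:E <= mu (high n x t))%E.
Proof.
rewrite -subr_gt0 => h; have [s [_ hs]] := sup_adherent h (levels_sup n x).
rewrite -/(quantile n x) opprB addrC subrK => ts.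
by rewrite (le_trans hs)// mu_high_le// ltW.
Qed.

Lemma gt_quantile n x t : quantile n x < t -> (mu (high n x t) < (4^-1 * 2 ^- n)%:E)%E.
Proof.
move=> h; rewrite ltNge; apply/negP => ht.
have /(ub_le_sup (levels_sup n x).2) : levels n x t.
  by split => //; rewrite (le_trans (quantile_ge0 n x))// ltW.
by rewrite leNgt h.
Qed.

Lemma quantile_leveled n : leveled n (quantile n).
Proof. by move=> x y /box_eq xy; rewrite /quantile /levels /high xy. Qed.

(** If [|u|] stayed below [|a|] minus twice the mean deviation on three quarters of the box, then
    [u] would be too far from its mean [a] there for the mean deviation to be what it is. Together
    with [tail_vanish], this makes the running maxima reach [|u|] in the limit. *)
Lemma quantile_ge n x :
  `|An n u x| - 2 * An n (fun y => `|u y - An n u y|) x <= quantile n x.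
Proof.
set a := An n u x; set e := An n _ x.
have e0 : 0 <= e by exact: An_ge0.
apply/ler_addgt0Pr => eta eta0; rewrite lerBlDr.
(* The slack makes [e'] positive and the contradiction strict: small quantiles would give
   [3 / 2 * e' <= e < e']. *)
set e' := e + eta / 4.
have e'0 : 0 < e' by rewrite ltr_wpDl// divr_gt0.
have [t0|t0] := ltP (`|a| - 2 * e') 0.
  have := quantile_ge0 n x; rewrite /e' in t0; lra.
suff /(ub_le_sup (levels_sup n x).2) : levels n x (`|a| - 2 * e').
  by rewrite -/(quantile n x) /e'; lra.
split => //; rewrite leNgt; apply/negP => small.
pose A := box n x `\` high n x (`|a| - 2 * e').
have mA : measurable A by apply: measurableD; [exact: measurable_box|exact: measurable_high].
have iD : mu.-integrable setT (EFin \o (fun y => `|u y - An n u y|)).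
  apply: integrable_norm; rewrite (_ : _ \o _ = (fun y => (u y)%:E - (An n u y)%:E)%E)//.
  by apply: integrableB => //; exact: (An_integrable n iu).1.
have muA : ((4^-1 * 3 * 2 ^- n)%:E <= mu A)%E.
  have bfin : (mu (box n x) < +oo)%E by rewrite mu_box ltry.
  rewrite /A measureD//; [|exact: measurable_box|exact: measurable_high].
  rewrite setIidr; last exact: subIsetl.
  have fh := mu_high_fin n x (`|a| - 2 * e').
  rewrite [X in (_ <= X - _)%E](mu_box n x).
  rewrite [X in (_ <= _ - X)%E](_ : _ = mu (high n x (`|a| - 2 * e')))//.
  move: small; rewrite -(fineK fh) -EFinB lte_fin lee_fin; lra.
have : (2 * e') * (4^-1 * 3) <= e.
  apply: (@An_chebyshev n x _ A) => //.
  - exact: subDsetl.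
  - by rewrite mulr_ge0// ltW.
  move=> y [yx nh]; rewrite (@An_leveled _ _ n u _ _ yx) -/a.
  have yt : `|u y| < `|a| - 2 * e'.
    by rewrite ltNge; apply/negP => h; apply: nh.
  rewrite distrC; apply: le_trans (lerB_dist _ _); lra.
rewrite /e'; lra.
Qed.

End quantiles.

Lemma Rintegral_sum d (T : measurableType d) (R : realType) (mu : {measure set T -> \bar R})
    (I : Type) (r : seq I) (F : I -> T -> R) :
  (forall i, mu.-integrable setT (EFin \o F i)) ->
  \int[mu]_x (\sum_(i <- r) F i x) = \sum_(i <- r) \int[mu]_x F i x.
Proof.
move=> iF; elim: r => [|i r IH].
  by rewrite big_nil; under eq_Rintegral do rewrite big_nil; rewrite Rintegral_cst ?mul0r.
rewrite big_cons -IH -RintegralD//; first by apply: eq_Rintegral => x _; rewrite big_cons.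
rewrite (_ : _ \o _ = (fun x => \sum_(i <- r) (F i x)%:E)%E).
  by apply: integrable_sum => // j _; exact: iF.
by apply/funext => x /=; rewrite sumEFin.
Qed.

(** * Oscillation under translations that stay inside a box *)

Section variation.
Context {R : realType} {d' : nat}.
Local Notation d := d'.+1.
Local Notation rV := 'rV[R]_d.
Local Notation mu := (@lebesgue_rV R d).
Local Notation spl := (@spl d').
Local Notation side := (@side R d').
Local Notation qr := (@qr R d').
Local Notation qS := (@qS R d').
Local Notation dir i := (delta_mx ord0 i : rV).
Implicit Types (n m k j N : nat) (h x y : rV) (f : rV -> R).

(** Oscillation is measured only between points of one box: thresholds that are constant on boxes
    then agree at both points, so slices can be compared. *)
Definition same_box n h : set rV := [set x | box n x (h + x)].

Lemma measurable_same_box n h : measurable (same_box n h).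
Proof.
rewrite (_ : same_box n h = \bigcup_k (pbox n k `&` (fun x => h + x) @^-1` pbox n k)).
  apply: bigcupT_measurable => k; apply: measurableI; first exact: measurable_pbox.
  rewrite -[X in measurable X]setTI; apply: (@measurable_addv R d' h) => //.
  exact: measurable_pbox.
apply/seteqP; split => x.
  move=> hx; have : [set: rV] x by [].
  rewrite -(pbox_cover n) => -[k _ xk]; exists k => //; split => //=.
  by rewrite (pbox_box xk).
by move=> [k _ [xk /=]]; rewrite (pbox_box xk).
Qed.

Definition osc n h f x : R := `|f (h + x) - f x| * \1_(same_box n h) x.

Definition var n h f : R := \int[mu]_x osc n h f x.

Lemma osc_ge0 n h f x : 0 <= osc n h f x.
Proof. by rewrite mulr_ge0. Qed.

Lemma osc_in n h f x : same_box n h x -> osc n h f x = `|f (h + x) - f x|.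
Proof. by move=> hx; rewrite /osc indicE mem_set// mulr1. Qed.

Lemma osc_out n h f x : ~ same_box n h x -> osc n h f x = 0.
Proof. by move=> hx; rewrite /osc indicE memNset// mulr0. Qed.

Lemma diff_integrable h f : mu.-integrable setT (EFin \o f) ->
  mu.-integrable setT (EFin \o (fun x => `|f (h + x) - f x|)).
Proof.
move=> fi; apply: integrable_norm.
rewrite (_ : _ \o _ = (fun x => (f (h + x))%R%:E - (f x)%:E)%E)//.
by apply: integrableB => //; exact: integrable_addv.
Qed.

Lemma osc_integrable n h f : mu.-integrable setT (EFin \o f) ->
  mu.-integrable setT (EFin \o osc n h f).
Proof.
move=> fi; apply: (@integrableM_bounded _ _ (fun x => `|f (h + x) - f x|) _ 1).
- exact: diff_integrable.
- by apply: measurable_indic; exact: measurable_same_box.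
- by move=> x; rewrite indicE ger0_norm// lern1 leq_b1.
Qed.

Lemma same_box_mono n m h : (n <= m)%N -> same_box m h `<=` same_box n h.
Proof. by move=> nm x /(box_sub nm). Qed.

Lemma same_box_double n i (t : R) x : 0 <= t -> same_box n ((2 * t) *: dir i) x ->
  same_box n (t *: dir i) x /\ same_box n (t *: dir i) (t *: dir i + x).
Proof.
move=> t0 h.
have b1 : same_box n (t *: dir i) x.
  move=> j; apply: (@floor_between R) (esym (h j)).
  rewrite !ler_wpM2l ?exprn_ge0// !line_coord.
    by case: (i == j); rewrite ?mulr1n ?mulr0n; lra.
  by case: (i == j); rewrite ?mulr1n ?mulr0n; lra.
split => // j; rewrite b1 -h addrA -scalerDl.
by congr (cell n (_ *: _ + _) j); ring.
Qed.

Lemma osc_double n i (t : R) f x : 0 <= t ->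
  osc n ((2 * t) *: dir i) f x <= osc n (t *: dir i) f (t *: dir i + x) + osc n (t *: dir i) f x.
Proof.
move=> t0; have [hx|hx] := pselect (same_box n ((2 * t) *: dir i) x); last first.
  by rewrite (osc_out f hx) addr_ge0// osc_ge0.
have [h1 h2] := same_box_double t0 hx.
rewrite !osc_in// addrA -scalerDl (_ : t + t = 2 * t); last by ring.
by rewrite (le_trans _ (ler_normD _ _))// subrKA.
Qed.

Lemma var_double n i (t : R) f : mu.-integrable setT (EFin \o f) -> 0 <= t ->
  var n ((2 * t) *: dir i) f <= 2 * var n (t *: dir i) f.
Proof.
move=> fi t0; have io := osc_integrable n (t *: dir i) fi.
have io' := integrable_addv (t *: dir i) io.
apply: (@le_trans _ _ (\int[mu]_x (osc n (t *: dir i) f (t *: dir i + x) + osc n (t *: dir i) f x))).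
  apply: le_Rintegral => //; first exact: osc_integrable.
    rewrite (_ : _ \o _ = (fun x => (osc n (t *: dir i) f (t *: dir i + x))%R%:E + (osc n (t *: dir i) f x)%:E)%E)//.
    exact: integrableD.
  by move=> x _; exact: osc_double.
by rewrite RintegralD// (Rintegral_addv _ io) -mulr2n mulr_natl.
Qed.

Lemma var_pow k n i (t : R) f : mu.-integrable setT (EFin \o f) -> 0 <= t ->
  var n ((2 ^+ k * t) *: dir i) f <= 2 ^+ k * var n (t *: dir i) f.
Proof.
move=> fi t0; elim: k => [|k IH]; first by rewrite expr0 !mul1r.
rewrite exprS -!mulrA; apply: (le_trans (var_double n i fi _)).
  by rewrite mulr_ge0 ?exprn_ge0.
by rewrite ler_wpM2l.
Qed.

Lemma var_mono n m h f : mu.-integrable setT (EFin \o f) -> (n <= m)%N -> var m h f <= var n h f.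
Proof.
move=> fi nm; apply: le_Rintegral => //; [exact: osc_integrable..|].
move=> x _; have [hx|hx] := pselect (same_box m h x).
  by rewrite !osc_in//; exact: same_box_mono hx.
by rewrite osc_out// osc_ge0.
Qed.

Lemma var_ge0 n h f : 0 <= var n h f.
Proof. by apply: Rintegral_ge0 => x _; exact: osc_ge0. Qed.

Lemma upper_lower j x y : upper j x (side j.+1 (spl j) *: dir (spl j) + y) <-> lower j x y.
Proof.
rewrite upper_rbox lower_rbox; split => h i; have := h i; rewrite /= !in_itv/= line_coord eq_sym;
  case: eqVneq => [->|_]; rewrite ?mulr1n ?mulr0n => /andP[h1 h2]; apply/andP; split; lra.
Qed.

(** The translation by [side j.+1 (spl j)] carries the lower half of the box onto the upper half, so
    the difference of the two integrals is the integral of a difference of values taken inside one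
    box of level [j]. *)
Lemma An_step_osc j f x : mu.-integrable setT (EFin \o f) ->
  `|An j.+1 f x - An j f x| <= An j (osc j (side j.+1 (spl j) *: dir (spl j)) f) x.
Proof.
move=> fi; rewrite An_next// /An ler_wpM2l ?exprn_ge0//.
set h := side j.+1 (spl j) *: dir (spl j).
have mL : measurable (lower j x) by exact: measurable_dbox.
have mU : measurable (upper j x) by exact: measurable_dbox.
have iL : mu.-integrable (lower j x) (EFin \o f) by exact: integrableS fi.
have if1 A : measurable A -> mu.-integrable setT (EFin \o (fun x => f x * \1_A x)).
  move=> mA; apply: (@integrableM_bounded _ _ f \1_A 1) => //.
  by move=> y; rewrite indicE ger0_norm// lern1 leq_b1.
have EU : \int[mu]_(y in upper j x) f y = \int[mu]_(y in lower j x) f (h + y).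
  rewrite (Rintegral_restrict f (upper j x)) (Rintegral_restrict (fun y => f (h + y)) (lower j x)).
  rewrite -(Rintegral_addv h (if1 _ mU)); apply: eq_Rintegral => y _.
  congr (_ * _); rewrite !indicE; congr (nat_of_bool _)%:R.
  by apply/idP/idP => /set_mem/upper_lower h'; apply/mem_set.
have ifh : mu.-integrable (lower j x) (EFin \o (fun y => f (h + y))).
  by apply: (integrableS measurableT) => //; exact: integrable_addv.
rewrite EU distrC -RintegralB//.
apply: le_trans (le_normr_Rintegral _ _) _ => //.
  rewrite (_ : _ \o _ = (fun y => (f (h + y))%R%:E - (f y)%:E)%E)//.
  exact: integrableB.
have io := osc_integrable j h fi.
apply: (@le_trans _ _ (\int[mu]_(y in lower j x) osc j h f y)).
  rewrite le_eqVlt; apply/orP; left; apply/eqP; apply: eq_Rintegral => y /set_mem yL.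
  rewrite osc_in// => i.
  have yb : box j x y by rewrite box_split; left.
  have hb : box j x (h + y) by rewrite box_split; right; apply/upper_lower.
  by rewrite yb hb.
have ioL : mu.-integrable (lower j x) (EFin \o osc j h f) by exact: integrableS io.
rewrite box_split Rintegral_setU//.
- by rewrite lerDl; apply: Rintegral_ge0 => y _; exact: osc_ge0.
- by apply: integrableS io => //; exact: measurableU.
- by rewrite disj_set2E lower_upper_disjoint.
Qed.

Lemma An_step_var j f : mu.-integrable setT (EFin \o f) ->
  \int[mu]_x `|An j.+1 f x - An j f x| <= var j (side j.+1 (spl j) *: dir (spl j)) f.
Proof.
move=> fi; have io := osc_integrable j (side j.+1 (spl j) *: dir (spl j)) fi.
have [iA EA] := ge0_An_integrable j io (fun x => osc_ge0 _ _ _ _).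
rewrite /var -EA; apply: le_Rintegral => //.
  apply: integrable_norm.
  rewrite (_ : _ \o _ = (fun x => (An j.+1 f x)%:E - (An j f x)%:E)%E)//.
  by apply: integrableB => //; exact: (An_integrable _ fi).1.
by move=> x _; exact: An_step_osc.
Qed.

(** A Poincare inequality for step functions. Since [f] is its own average at level [N], it
    telescopes down to level [n]. The step at level [j] costs the variation along
    [side j.+1 (spl j)], which is a power of two times [side N (spl j)]; doubling a translation at
    most doubles the variation, so only the ratio of the sides appears, and the sides sum
    geometrically. *)
Lemma leveled_var_bound n N f : (n <= N)%N -> leveled N f -> mu.-integrable setT (EFin \o f) ->
  \int[mu]_x `|f x - An n f x| <=
  2 * qS * qr ^+ n * \sum_i (side N i)^-1 * var n (side N i *: dir i) f.
Proof.
move=> nN lf fi; set S := \sum_i _.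
have iA k := (An_integrable k fi).1.
have iD k : mu.-integrable setT (EFin \o (fun x => `|An k.+1 f x - An k f x|)).
  apply: integrable_norm.
  by rewrite (_ : _ \o _ = (fun x => (An k.+1 f x)%:E - (An k f x)%:E)%E)//;
    apply: integrableB => //; exact: iA.
have step j : (n <= j < N)%N -> \int[mu]_x `|An j.+1 f x - An j f x| <= 2 * qr ^+ j * S.
  move=> /andP[nj jN]; apply: (le_trans (An_step_var j fi)).
  set i := spl j.
  have lv : (lev j.+1 i <= lev N i)%N by exact: lev_mono.
  have E : side j.+1 i = 2 ^+ (lev N i - lev j.+1 i) * side N i.
    have KE : lev N i = (lev N i - lev j.+1 i + lev j.+1 i)%N by rewrite subnK.
    rewrite /side [in X in _ = _ * X]KE exprD invfM.
    by rewrite mulVKf// expf_neq0.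
  apply: (le_trans (var_mono _ fi nj)).
  rewrite E; apply: (le_trans (var_pow _ _ _ fi (ltW (side_gt0 _ _)))).
  have -> : 2 ^+ (lev N i - lev j.+1 i) = side j.+1 i / side N i.
    by rewrite E mulfK// gt_eqF// side_gt0.
  rewrite -mulrA; apply: ler_pM.
  - by rewrite ltW// side_gt0.
  - by rewrite mulr_ge0 ?var_ge0// invr_ge0 ltW// side_gt0.
  - by rewrite (le_trans (side_le _ _))// ler_wpM2l// qrX_le.
  - rewrite /S (bigD1 i)//= lerDl sumr_ge0// => k _.
    by rewrite mulr_ge0 ?var_ge0// invr_ge0 ltW// side_gt0.
have S0 : 0 <= S.
  by apply: sumr_ge0 => k _; rewrite mulr_ge0 ?var_ge0// invr_ge0 ltW// side_gt0.
apply: (@le_trans _ _ (\int[mu]_x (\sum_(n <= j < N) `|An j.+1 f x - An j f x|))).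
  apply: le_Rintegral => //.
  - apply: integrable_norm.
    by rewrite (_ : _ \o _ = (fun x => (f x)%:E - (An n f x)%:E)%E)//;
      apply: integrableB => //; exact: iA.
  - rewrite (_ : _ \o _ = (fun x => \sum_(n <= j < N) (`|An j.+1 f x - An j f x|%R)%:E)%E).
      by apply: integrable_sum => // j _; exact: iD.
    by apply/funext => x /=; rewrite sumEFin.
  move=> x _; rewrite -{1}(An_id x lf) -(telescope_sumr (fun j => An j f x) nN).
  exact: ler_norm_sum.
apply: (@le_trans _ _ (\sum_(n <= j < N) 2 * qr ^+ j * S)).
  have -> : \int[mu]_x (\sum_(n <= j < N) `|An j.+1 f x - An j f x|) =
     \sum_(n <= j < N) \int[mu]_x `|An j.+1 f x - An j f x|.
    by rewrite Rintegral_sum.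
  rewrite big_nat_cond [leRHS]big_nat_cond; apply: ler_sum => j /andP[+ _].
  exact: step.
rewrite -mulr_suml -mulr_sumr ler_wpM2r// -mulrA ler_wpM2l//.
exact: sum_qr_le.
Qed.

End variation.

(** * Slices of a number between two heights *)

Section clip.
Context {R : realType}.
Implicit Types a b s t : R.

Definition clip a b s : R := Num.min (Num.max (s - a) 0) (b - a).

Local Ltac cases := rewrite /clip;
  repeat match goal with |- context [Num.max ?x ?y] => case: (leP x y) => ? end;
  repeat match goal with |- context [Num.min ?x ?y] => case: (leP x y) => ? end; lra.

Lemma clip_ge0 a b s : a <= b -> 0 <= clip a b s.
Proof. by move=> ab; rewrite /clip le_min subr_ge0 ab le_max lexx orbT. Qed.

Lemma clip_le a b s : 0 <= a -> 0 <= s -> clip a b s <= s.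
Proof. by move=> a0 s0; rewrite /clip ge_min ge_max s0 gerBl a0. Qed.

Lemma clip_lip a b s t : a <= b -> `|clip a b s - clip a b t| <= `|s - t|.
Proof.
move=> ab; wlog st : s t / t <= s.
  move=> h; have [/h//|/ltW/h] := leP t s.
  by move=> h'; rewrite distrC (distrC s).
rewrite (ger0_norm (_ : 0 <= s - t)) ?subr_ge0// ler_norml; apply/andP; split; cases.
Qed.

(** The function [min _ b] is the sum of [min _ a] and of the slice, up to a constant; all three are
    nondecreasing, so the increments have one sign and their absolute values add. *)
Lemma clip_telescope a b s t : a <= b ->
  `|Num.min s a - Num.min t a| + `|clip a b s - clip a b t| <= `|Num.min s b - Num.min t b|.
Proof.
move=> ab; wlog st : s t / t <= s.
  move=> h; have [/h//|/ltW/h] := leP t s.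
  by move=> h'; rewrite (distrC (Num.min s a)) (distrC (clip a b s)) (distrC (Num.min s b)).
have e1 : 0 <= Num.min s a - Num.min t a by cases.
have e2 : 0 <= clip a b s - clip a b t by cases.
rewrite (ger0_norm e1) (ger0_norm e2) (le_trans _ (ler_norm _))//; cases.
Qed.

Lemma min_lip a s t : `|Num.min s a - Num.min t a| <= `|s - t|.
Proof.
wlog st : s t / t <= s.
  move=> h; have [/h//|/ltW/h] := leP t s.
  by move=> h'; rewrite distrC (distrC s).
rewrite (ger0_norm (_ : 0 <= s - t)) ?subr_ge0// ler_norml; apply/andP; split; cases.
Qed.

Lemma clip_low a b s : a < b -> s < a + (b - a) / 3 -> clip a b s <= (b - a) / 3.
Proof. move=> ab h; cases. Qed.

Lemma clip_high a b s : a < b -> a + 2 * (b - a) / 3 <= s -> 2 * (b - a) / 3 <= clip a b s.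
Proof. move=> ab h; cases. Qed.

End clip.

(** * Running maxima of quantiles and the slices between them *)

Section quantile_layers.
Context {R : realType} {d' : nat}.
Local Notation d := d'.+1.
Local Notation rV := 'rV[R]_d.
Local Notation mu := (@lebesgue_rV R d).
Variable u : rV -> R.
Hypothesis iu : mu.-integrable setT (EFin \o u).

Fixpoint qmax n (x : rV) : R :=
  if n is m.+1 then Num.max (qmax m x) (quantile u n x) else quantile u 0 x.

Lemma qmax_leveled n : leveled n (qmax n).
Proof.
elim: n => [|n IH] x y xy; first exact: quantile_leveled xy.
rewrite /= (IH x y); first by rewrite (@quantile_leveled _ _ u n.+1 x y xy).
exact: boxS xy.
Qed.

Lemma qmax_ge0 n x : 0 <= qmax n x.
Proof.
by elim: n => [|n IH] /=; rewrite ?le_max ?IH//; exact: quantile_ge0.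
Qed.

Lemma qmax_nd n x : qmax n x <= qmax n.+1 x.
Proof. by rewrite /= le_max lexx. Qed.

Lemma quantile_qmax n x : quantile u n x <= qmax n x.
Proof. by case: n => [|n] //=; rewrite le_max lexx orbT. Qed.

Definition qinc n x : R := if n is m.+1 then qmax n x - qmax m x else qmax 0 x.

Lemma qinc_ge0 n x : 0 <= qinc n x.
Proof. by case: n => [|n]; rewrite ?qmax_ge0// subr_ge0 qmax_nd. Qed.

Lemma qinc_leveled n : leveled n (qinc n).
Proof.
case: n => [|n] x y xy; first exact: qmax_leveled xy.
rewrite /qinc (qmax_leveled xy) (@qmax_leveled n x y)//; exact: boxS xy.
Qed.

Lemma sum_qinc n x : \sum_(i < n.+1) qinc i x = qmax n x.
Proof.
elim: n => [|n IH]; first by rewrite big_ord_recl big_ord0 addr0.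
by rewrite big_ord_recr IH /= addrC subrK.
Qed.

(** The thresholds always come from [u]; the sliced function [w] is a parameter because the slices
    of [|u|] are later compared with those of its approximations by step functions. *)
Definition layer n (w : rV -> R) x : R := clip (qmax n x) (qmax n.+1 x) (w x).

Lemma layer_measurable n (w : rV -> R) : measurable_fun setT w ->
  measurable_fun setT (layer n w).
Proof.
move=> mw; have mq k : measurable_fun setT (qmax k) := leveled_measurable (@qmax_leveled k).
apply: measurable_minr; last by apply: measurable_funB.
by apply: measurable_maxr => //; exact: measurable_funB.
Qed.

Lemma layer_integrable n (w : rV -> R) : mu.-integrable setT (EFin \o w) ->
  (forall x, 0 <= w x) -> mu.-integrable setT (EFin \o layer n w).
Proof.
move=> iw w0; apply: (le_integrable _ _ _ iw) => //.
  apply/measurable_EFinP; apply: layer_measurable; by have /integrableP[/measurable_EFinP] := iw.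
move=> x _ /=; rewrite lee_fin !ger0_norm//; last exact/clip_ge0/qmax_nd.
by apply: clip_le => //; exact: qmax_ge0.
Qed.

Lemma layer_leveled n N (w : rV -> R) : (n < N)%N -> leveled N w -> leveled N (layer n w).
Proof.
move=> nN lw x y xy; rewrite /layer (lw _ _ xy).
rewrite (@qmax_leveled n x y); last exact: box_sub (ltnW nN) _ xy.
by rewrite (@qmax_leveled n.+1 x y)//; exact: box_sub nN _ xy.
Qed.

(** By induction on [L] with a sharper bound as long as [x] and [h + x] share a box of level [L]:
    the thresholds are then equal at both points and the sum is at most the increment of
    [min w (qmax L)], by [clip_telescope]. Once the two points are separated, no further term
    contributes. *)
Lemma sum_osc_layer L h (w : rV -> R) x :
  \sum_(n < L) osc n.+1 h (layer n w) x <= `|w (h + x) - w x|.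
Proof.
suff H : (same_box L h x \/ L = 0%N ->
   \sum_(n < L) osc n.+1 h (layer n w) x <= `|Num.min (w (h + x)) (qmax L x) - Num.min (w x) (qmax L x)|)
   /\ \sum_(n < L) osc n.+1 h (layer n w) x <= `|w (h + x) - w x| by case: H.
elim: L => [|L [IH1 IH2]]; first by rewrite big_ord0.
have main : same_box L.+1 h x -> \sum_(n < L.+1) osc n.+1 h (layer n w) x <=
     `|Num.min (w (h + x)) (qmax L.+1 x) - Num.min (w x) (qmax L.+1 x)|.
  move=> hx; have hx' : same_box L h x by exact: same_box_mono hx.
  rewrite big_ord_recr /= osc_in// /layer.
  rewrite (qmax_leveled hx) (qmax_leveled hx').
  apply: le_trans (clip_telescope _ _ (qmax_nd L x)).
  by rewrite lerD2r; apply: IH1; left.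
have [hx|hx] := pselect (same_box L.+1 h x).
  by split=> [_|]; [exact: main|exact: le_trans (main hx) (min_lip _ _ _)].
split; first by move=> [|//].
by rewrite big_ord_recr /= osc_out ?addr0.
Qed.

(* With [a < b] the successive maxima, [|u|] is below [a + (b - a) / 3] on half
   of the box and above [a + 2 (b - a) / 3] on a quarter of it, so that the
   layer is far from every constant. *)
Lemma qinc_gap n x : qinc n.+1 x <=
  24 * An n.+1 (fun y => `|layer n (fun y => `|u y|) y - An n.+1 (layer n (fun y => `|u y|)) y|) x.
Proof.
set f := layer n _; set phi := fun y => `|f y - An n.+1 f y|.
have iW : mu.-integrable setT (EFin \o (fun y => `|u y|)) by exact: integrable_norm.
have if_ : mu.-integrable setT (EFin \o f) by exact: layer_integrable.
have iphi : mu.-integrable setT (EFin \o phi).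
  apply: integrable_norm; rewrite (_ : _ \o _ = (fun y => (f y)%:E - (An n.+1 f y)%:E)%E)//.
  by apply: integrableB => //; exact: (An_integrable _ if_).1.
have phi0 y : 0 <= phi y by exact: normr_ge0.
rewrite /qinc; set a := qmax n x; set b := qmax n.+1 x.
have [ba|ab] := leP b a.
  by rewrite (@le_trans _ _ 0)// ?subr_le0// mulr_ge0// An_ge0.
have bq : b = quantile u n.+1 x.
  by move: ab; rewrite /b /=; case: (leP (qmax n x) (quantile u n.+1 x)) => // _; rewrite /a ltxx.
have fE y : box n.+1 x y -> f y = clip a b `|u y|.
  move=> xy; rewrite /f /layer (qmax_leveled xy) (@qmax_leveled n x y)//; exact: boxS xy.
set c := An n.+1 f x.
have cE y : box n.+1 x y -> An n.+1 f y = c by move=> xy; exact: (@An_leveled _ _ n.+1 f x y xy).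
(* The slice is at most a third of [b - a] on half of the box and at least two thirds on a quarter
   of it. Whichever side of the middle its mean [c] is on, one of these sets is at distance
   [(b - a) / 6] from [c]; the worse case is a sixth on a quarter, whence 24. *)
have [hc|hc] := leP ((b - a) / 2) c.
  pose A := box n.+1 x `\` high u n.+1 x (a + (b - a) / 3).
  have mA : measurable A by apply: measurableD; [exact: measurable_box|exact: measurable_high].
  have muA : ((2^-1 * 2 ^- n.+1)%:E <= mu A)%E.
    (* The bound comes from the parent box, whose quantile is at most [a]: less than a quarter of
       the parent is less than half of the present box. *)
    have h1 : (mu (high u n.+1 x (a + (b - a) / 3)) < (4^-1 * 2 ^- n)%:E)%E.
      apply: (@le_lt_trans _ _ (mu (high u n x (a + (b - a) / 3)))).
        apply: le_measure; rewrite ?inE; [exact: measurable_high..|].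
        by move=> y [/boxS xy h]; split.
      apply: gt_quantile => //; apply: (le_lt_trans (quantile_qmax n x)).
      by rewrite -/a ltrDl divr_gt0// subr_gt0.
    have bfin : (mu (box n.+1 x) < +oo)%E by rewrite mu_box ltry.
    rewrite /A measureD//; [|exact: measurable_box|exact: measurable_high].
    rewrite setIidr; last exact: subIsetl.
    have fh := mu_high_fin iu n.+1 x (a + (b - a) / 3).
    rewrite [X in (_ <= X - _)%E](mu_box n.+1 x).
    rewrite [X in (_ <= _ - X)%E](_ : _ = mu (high u n.+1 x (a + (b - a) / 3)))//.
    move: h1; rewrite -(fineK fh) -EFinB lte_fin lee_fin exprS invfM; lra.
  have : (b - a) / 6 * 2^-1 <= An n.+1 phi x.
    apply: (@An_chebyshev R d' n.+1 x phi A) => //.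
    - exact: subDsetl.
    - by rewrite divr_ge0// subr_ge0 ltW.
    move=> y [yx nh]; rewrite /phi (cE _ yx) (fE _ yx).
    have yt : `|u y| < a + (b - a) / 3 by rewrite ltNge; apply/negP => h; apply: nh.
    have := clip_low ab yt; rewrite distrC => h; apply: le_trans (ler_norm _); lra.
  lra.
have : (b - a) / 6 * 4^-1 <= An n.+1 phi x.
  apply: (@An_chebyshev R d' n.+1 x phi (high u n.+1 x (a + 2 * (b - a) / 3))) => //.
  - exact: measurable_high.
  - exact: subIsetl.
  - by rewrite divr_ge0// subr_ge0 ltW.
  - move=> y [yx /= yt]; rewrite /phi (cE _ yx) (fE _ yx).
    have := clip_high ab yt => h; apply: le_trans (ler_norm _); lra.
  - by apply: lt_quantile => //; rewrite -bq; lra.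
lra.
Qed.

End quantile_layers.

(** * Induction on the order *)

Section layers.
Context {R : realType} {d' : nat}.
Local Notation d := d'.+1.
Local Notation rV := 'rV[R]_d.
Local Notation mu := (@lebesgue_rV R d).
Local Notation qr := (@qr R d').
Local Notation qS := (@qS R d').
Implicit Types (g h : nat -> rV -> \bar R).

Lemma nneseries_mulr_le (b : nat -> R) (I : \bar R) (c : R) : (forall n, 0 <= b n) ->
  (0 <= I)%E -> (forall N, \sum_(n < N) b n <= c) ->
  (\sum_(n <oo) (b n)%:E * I <= c%:E * I)%E.
Proof.
move=> b0 I0 bc; apply: lime_le.
  by apply: is_cvg_nneseries => n _ _; rewrite mule_ge0// lee_fin.
apply: nearW => N; rewrite big_mkord -ge0_sume_distrl; last by move=> n _; rewrite lee_fin.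
by rewrite sumEFin lee_wpmul2r// lee_fin.
Qed.

Lemma sum_qr_tail k N : \sum_(n < N) (if (k <= n)%N then qr ^+ n else 0) <= qS * qr ^+ k.
Proof.
apply: le_trans (sum_qr_le k N); rewrite big_geq_mkord.
by rewrite [leRHS]big_mkcond/=.
Qed.

(** With [0 < m] the terms increase geometrically and the sum is controlled by the value at [k].
    This is the place where the induction needs the order to be at least 1. *)
Lemma sum_qrV_head m k N : (0 < m)%N ->
  \sum_(n < N) (if (k <= n)%N then 0 else qr ^- (n * m)) <= qS * qr ^- (k * m).
Proof.
move=> m0; have q0 : 0 < qr by exact: qr_gt0.
have q1 : qr < 1 by exact: qr_lt1.
have mono j l : (j <= l)%N -> qr ^- (j * m) <= qr ^- (l * m).
  by move=> jl; rewrite lef_pV2 ?posrE ?exprn_gt0// qrX_le// leq_mul2r jl orbT.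
suff h j : \sum_(n < j) qr ^- (n * m) <= qS * qr ^- (j * m).
  have [Nk|kN] := leqP N k.
    rewrite (eq_bigr (fun n : 'I_N => qr ^- (n * m))); last first.
      by move=> n _; rewrite leqNgt (leq_trans (ltn_ord n) Nk).
    by rewrite (le_trans (h N))// ler_wpM2l ?qS_ge0// mono.
  apply: le_trans (h k); rewrite -(big_mkord xpredT (fun n => if (k <= n)%N then 0 else qr ^- (n * m))).
  rewrite (@big_cat_nat _ _ _ k)//= 1?ltnW// big_mkord [X in _ + X]big1_seq ?addr0.
    by apply: ler_sum => n _; rewrite leqNgt ltn_ord.
  by move=> n; rewrite mem_index_iota => /andP[_ /andP[-> _]].
elim: j => [|j IH].
  by rewrite big_ord0 mulr_ge0 ?qS_ge0// invr_ge0 exprn_ge0// ltW.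
rewrite big_ord_recr/=; apply: le_trans (lerD IH (lexx _)) _.
set y := qr ^- (j * m); have y0 : 0 <= y by rewrite invr_ge0 exprn_ge0// ltW.
have E : y * qr^-1 <= qr ^- (j.+1 * m).
  rewrite mulSn addnC exprD invfM ler_wpM2l// lef_pV2 ?posrE ?exprn_gt0//.
  by rewrite -{2}[qr]expr1 qrX_le.
apply: (@le_trans _ _ (qS * (y * qr^-1))); last by rewrite ler_wpM2l ?qS_ge0.
rewrite (_ : qS * y + y = y * (qS + 1)); last by ring.
rewrite mulrCA ler_wpM2l//.
have p : 0 < 1 - qr by rewrite subr_gt0.
rewrite /qS -subr_ge0.
rewrite (_ : _ - _ = (1 - qr)^-1 * qr^-1 * (1 - qr) ^+ 2); last first.
  by field; rewrite (gt_eqF q0) (gt_eqF p).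
by rewrite mulr_ge0 ?sqr_ge0// mulr_ge0 ?invr_ge0 ?ltW.
Qed.

Definition weight k g : \bar R := (\sum_(n <oo) (qr ^- (n * k))%:E * \int[mu]_x g n x)%E.

(** Extended values are allowed because [coarsen] builds its layers as infinite sums. *)
Definition layers g := (forall n, leveled n (g n)) /\ forall n x, (0 <= g n x)%E.

Lemma layers_measurable g n : layers g -> measurable_fun setT (g n).
Proof. by move=> [lg _]; exact: leveled_measurable (lg n). Qed.

Lemma qrV_ge0 n : (0 <= (qr ^- n)%:E)%E.
Proof. by rewrite lee_fin invr_ge0 exprn_ge0// qr_ge0. Qed.

Lemma layersD g h : layers g -> layers h -> layers (fun n x => g n x + h n x)%E.
Proof.
move=> [lg g0] [lh h0]; split; last by move=> n x; rewrite adde_ge0.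
by move=> n x y xy; rewrite (lg _ _ _ xy) (lh _ _ _ xy).
Qed.

Lemma weightD k g h : layers g -> layers h ->
  (weight k (fun n x => g n x + h n x) = weight k g + weight k h)%E.
Proof.
move=> lg lh; have [_ g0] := lg; have [_ h0] := lh.
rewrite /weight -nneseriesD; last 2 first.
- by move=> n _ _; rewrite mule_ge0 ?qrV_ge0// integral_ge0.
- by move=> n _ _; rewrite mule_ge0 ?qrV_ge0// integral_ge0.
apply: eq_eseriesr => n _; rewrite ge0_integralD//; [|exact: layers_measurable..].
by rewrite ge0_muleDr// integral_ge0.
Qed.

Lemma layersZ c g : 0 <= c -> layers g -> layers (fun n x => c%:E * g n x)%E.
Proof.
move=> c0 [lg g0]; split; last by move=> n x; rewrite mule_ge0// lee_fin.
by move=> n x y xy; rewrite (lg _ _ _ xy).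
Qed.

Lemma weightZ k c g : 0 <= c -> layers g ->
  (weight k (fun n x => c%:E * g n x) = c%:E * weight k g)%E.
Proof.
move=> c0 lg; have [_ g0] := lg.
rewrite /weight -nneseriesZl; last first.
  by move=> n _; rewrite mule_ge0 ?qrV_ge0// integral_ge0.
apply: eq_eseriesr => n _; rewrite ge0_integralZl_EFin//; last exact: layers_measurable.
by rewrite muleCA.
Qed.

Lemma layers_rate g : layers g -> layers (fun n x => (qr ^+ n)%:E * g n x)%E.
Proof.
move=> [lg g0]; split; last by move=> n x; rewrite mule_ge0// lee_fin exprn_ge0// qr_ge0.
by move=> n x y xy; rewrite (lg _ _ _ xy).
Qed.

Lemma weight_rate k g : layers g ->
  weight k.+1 (fun n x => (qr ^+ n)%:E * g n x)%E = weight k g.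
Proof.
move=> lg; have [_ g0] := lg; apply: eq_eseriesr => n _.
rewrite ge0_integralZl_EFin//; [|exact: layers_measurable|by rewrite exprn_ge0// qr_ge0].
rewrite muleA -EFinM mulnS exprD invfM mulrAC mulVf ?mul1r//.
by rewrite expf_neq0// gt_eqF// qr_gt0.
Qed.

Definition first_layer (f : rV -> \bar R) n x := if n is 0 then f x else 0%E.

Lemma layers_first f : leveled 0 f -> (forall x, 0 <= f x)%E -> layers (first_layer f).
Proof. by move=> lf f0; split => [[|n]|[|n]]. Qed.

Lemma weight_first k f : (forall x, 0 <= f x)%E -> weight k (first_layer f) = (\int[mu]_x f x)%E.
Proof.
move=> f0; rewrite /weight nneseries_recl//; last first.
  move=> n _; rewrite mule_ge0 ?qrV_ge0// integral_ge0// => x _.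
  by rewrite /first_layer; case: n.
rewrite mul0n expr0 invr1 mul1e; set s := (X in (_ + X)%E); suff -> : s = 0%E by rewrite adde0.
apply: eseries0 => -[//|n] _ _.
by rewrite /first_layer integral0 mule0.
Qed.

Definition coarsen g n x : \bar R := (\sum_(k <oo) if (k <= n)%N then 0 else En n (g k) x)%E.

Lemma layers_coarsen g : layers g -> layers (coarsen g).
Proof.
move=> [lg g0]; split => [n x y xy|n x].
  by apply: eq_eseriesr => k _; rewrite (En_leveled (g k) xy).
by apply: nneseries_ge0 => k _ _; case: ifP => // _; exact: En_ge0.
Qed.

(** After exchanging the sums, the layer [g k] is counted once at each level [n < k], with its
    integral preserved by averaging; [sum_qrV_head] adds up the weights. *)
Lemma weight_coarsen m g : (0 < m)%N -> layers g ->
  (weight m (coarsen g) <= qS%:E * weight m g)%E.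
Proof.
move=> m0 lg; have [_ g0] := lg.
have I0 k : (0 <= \int[mu]_x g k x)%E by exact: integral_ge0.
rewrite {1}/weight.
have E n : ((qr ^- (n * m))%:E * \int[mu]_x coarsen g n x =
    \sum_(k <oo) ((if (k <= n)%N then 0 else qr ^- (n * m))%:E * \int[mu]_x g k x))%E.
  rewrite /coarsen integral_nneseries//; last 2 first.
  - move=> k; case: (k <= n)%N => //; exact: leveled_measurable (@En_leveled _ _ n _).
  - by move=> k x _; case: ifP => // _; exact: En_ge0.
  rewrite -nneseriesZl; last first.
    by move=> k _; apply: integral_ge0 => x _; case: ifP => // _; exact: En_ge0.
  apply: eq_eseriesr => k _; case: (k <= n)%N; first by rewrite integral0 mule0 mul0e.
  by rewrite integral_En//; exact: layers_measurable.
rewrite (eq_eseriesr (fun n _ => E n)) nneseries_interchange; last first.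
  by move=> n k; rewrite mule_ge0//; case: ifP => //; rewrite qrV_ge0.
rewrite /weight -nneseriesZl; last first.
  by move=> n _; rewrite mule_ge0// qrV_ge0.
apply: lee_nneseries => [k _ _|k _].
  by apply: nneseries_ge0 => n _ _; rewrite mule_ge0//; case: ifP => //; rewrite qrV_ge0.
rewrite muleA -EFinM; apply: nneseries_mulr_le => //; last by move=> N; exact: sum_qrV_head.
by move=> n; case: ifP => // _; have := qrV_ge0 (n * m); rewrite lee_fin.
Qed.

Lemma sum_rate_En g x : layers g ->
  (\sum_(n <oo) (qr ^+ n)%:E * (\sum_(k <oo) En n (g k) x) <=
   \sum_(n <oo) (qS%:E * ((qr ^+ n)%:E * g n x) + (qr ^+ n)%:E * coarsen g n x))%E.
Proof.
move=> lg; have [lev0 g0] := lg; have [_ c0] := layers_coarsen lg.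
have q0 n : (0 <= (qr ^+ n)%:E)%E by rewrite lee_fin exprn_ge0// qr_ge0.
rewrite nneseriesD; last 2 first.
- by move=> n _ _; rewrite mule_ge0 ?lee_fin ?qS_ge0// mule_ge0.
- by move=> n _ _; rewrite mule_ge0.
have E n : ((qr ^+ n)%:E * (\sum_(k <oo) En n (g k) x) =
   (\sum_(k <oo) ((if (k <= n)%N then qr ^+ n else 0)%:E * g k x)) + (qr ^+ n)%:E * coarsen g n x)%E.
  rewrite -(nneseriesZl (f := fun k => if (k <= n)%N then 0%E else En n (g k) x)); last first.
    by move=> k _; case: ifP => // _; exact: En_ge0.
  rewrite -nneseriesD; last 2 first.
  - by move=> k _ _; rewrite mule_ge0//; case: ifP => // _; exact: q0.
  - by move=> k _ _; rewrite mule_ge0//; case: ifP => // _; exact: En_ge0.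
  rewrite -nneseriesZl; last by move=> k _; exact: En_ge0.
  apply: eq_eseriesr => k _; case: ifP => kn; last by rewrite mul0e add0e.
  by rewrite mule0 adde0 En_id//; exact: leveledW (lev0 k).
rewrite (eq_eseriesr (fun n _ => E n)) nneseriesD; last 2 first.
- by move=> n _ _; apply: nneseries_ge0 => k _ _; rewrite mule_ge0//; case: ifP => // _; exact: q0.
- by move=> n _ _; rewrite mule_ge0.
apply: leeD => //.
rewrite nneseries_interchange; last first.
  by move=> n k; rewrite mule_ge0//; case: ifP => // _; exact: q0.
apply: lee_nneseries => [k _ _|k _].
  by apply: nneseries_ge0 => n _ _; rewrite mule_ge0//; case: ifP => //.
rewrite muleA -EFinM; apply: nneseries_mulr_le => // [n|N]; last exact: sum_qr_tail.
by case: ifP => // _; rewrite exprn_ge0// qr_ge0.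
Qed.

End layers.

(** * Domination at order 1 *)

Section boxing.
Context {R : realType} {d' : nat}.
Local Notation d := d'.+1.
Local Notation rV := 'rV[R]_d.
Local Notation mu := (@lebesgue_rV R d).
Local Notation side := (@side R d').
Local Notation qr := (@qr R d').
Local Notation qS := (@qS R d').
Local Notation dir i := (delta_mx ord0 i : rV).

Definition dominated (k : nat) (u : rV -> R) (A : R) := exists g : nat -> rV -> \bar R,
  [/\ layers g, {ae mu, forall x, (`|u x|%:E <= \sum_(n <oo) g n x)%E} &
      (weight k g <= A%:E)%E].

Lemma Rintegral_addB_le (f g : rV -> R) : mu.-integrable setT (EFin \o f) ->
  mu.-integrable setT (EFin \o g) ->
  \int[mu]_x `|f x| <= \int[mu]_x `|g x| + \int[mu]_x `|f x - g x|.
Proof.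
move=> if_ ig; have iD : mu.-integrable setT (EFin \o (fun x => f x - g x)).
  rewrite (_ : _ \o _ = (fun y => (f y)%:E - (g y)%:E)%E)//.
  by apply: integrableB => //.
have iN := integrable_norm ig; have iDN := integrable_norm iD.
rewrite -RintegralD//; apply: le_Rintegral => //; first exact: integrable_norm.
  rewrite (_ : _ \o _ = (fun y => (`|g y|%R)%:E + (`|f y - g y|%R)%:E)%E)//.
  exact: integrableD.
by move=> x _; rewrite -[X in `|X| <= _](subrK (g x)) [leRHS]addrC ler_normD.
Qed.

Lemma ler_geometric_limit (X a c : R) L :
  (forall N, (L <= N)%N -> X <= a + c * qr ^+ N) -> X <= a.
Proof.
move=> h; have : a + c * qr ^+ N @[N --> \oo] --> a + c * 0.
  apply: cvgD; first exact: cvg_cst.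
  apply: cvgM; first exact: cvg_cst.
  by apply: cvg_expr; rewrite ger0_norm ?qr_ge0// qr_lt1.
rewrite mulr0 addr0 => /cvgr_to_ge; apply; near=> N; apply: h.
by near: N; exact: nbhs_infty_ge.
Unshelve. all: by end_near. Qed.

Variables (u : rV -> R) (v : 'I_d -> rV -> R).
Hypothesis iu : mu.-integrable setT (EFin \o u).
Hypothesis iv : forall i, mu.-integrable setT (EFin \o v i).
Hypothesis uv : forall i, is_weak_partial u [:: i] (v i).

Let G : R := \int[mu]_x grad v x.

Let G_sum : G = \sum_i \int[mu]_x `|v i x|.
Proof. by rewrite /G /grad Rintegral_sum// => i; exact: integrable_norm. Qed.

Let W x := `|u x|.
Let iW : mu.-integrable setT (EFin \o W). Proof. exact: integrable_norm. Qed.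
Let W0 x : 0 <= W x. Proof. exact: normr_ge0. Qed.

(* Replacing [u] by its averages at a fine level [N] turns every layer into a
   step function, whose oscillation on a box is controlled by its jumps along
   the translations by [side N i]. *)
Let WN N x := `|An N u x|.
Let iWN N : mu.-integrable setT (EFin \o WN N).
Proof. by apply: integrable_norm; exact: (An_integrable N iu).1. Qed.
Let WN0 N x : 0 <= WN N x. Proof. exact: normr_ge0. Qed.

Let dev n (w : rV -> R) : R := \int[mu]_x `|layer u n w x - An n.+1 (layer u n w) x|.

Let il n w : mu.-integrable setT (EFin \o w) -> (forall x, 0 <= w x) ->
  mu.-integrable setT (EFin \o layer u n w).
Proof. exact: layer_integrable. Qed.

Let idev n w : mu.-integrable setT (EFin \o w) -> (forall x, 0 <= w x) ->
  mu.-integrable setT (EFin \o (fun x => layer u n w x - An n.+1 (layer u n w) x)).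
Proof.
move=> iw w0; rewrite (_ : _ \o _ = (fun y => (layer u n w y)%:E - (An n.+1 (layer u n w) y)%:E)%E)//.
by apply: integrableB => //; [exact: il|exact: (An_integrable _ (il n iw w0)).1].
Qed.

(** Slicing is 1-Lipschitz, so the slices of [W] and [WN N] differ by at most the distance of [u] to
    its average; this is paid twice, once for the slices and once for their averages. *)
Let dev_approx n N : dev n W <= dev n (WN N) + 2 * \int[mu]_x `|u x - An N u x|.
Proof.
have iA := (An_integrable N iu).1.
have [iD _] := An_L1 iu iv uv N.
have idw := idev n iW W0; have idn := idev n (iWN N) (WN0 N).
apply: (le_trans (Rintegral_addB_le idw idn)); rewrite lerD2l.
set f1 := layer u n W; set f2 := layer u n (WN N).
have if1 : mu.-integrable setT (EFin \o f1) by exact: il.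
have if2 : mu.-integrable setT (EFin \o f2) by exact: il.
have if12 : mu.-integrable setT (EFin \o (fun x => f1 x - f2 x)).
  rewrite (_ : _ \o _ = (fun y => (f1 y)%:E - (f2 y)%:E)%E)//.
  by apply: integrableB.
have if12N := integrable_norm if12.
have iA12 := (An_integrable n.+1 if12).1.
have iA12N := integrable_norm iA12.
have f12 : \int[mu]_x `|f1 x - f2 x| <= \int[mu]_x `|u x - An N u x|.
  apply: le_Rintegral => //; first exact: integrable_norm.
  move=> x _; apply: (le_trans (clip_lip _ _ (qmax_nd u n x))).
  exact: ler_dist_dist.
apply: (@le_trans _ _ (\int[mu]_x (`|f1 x - f2 x| + `|An n.+1 (fun x => f1 x - f2 x) x|))).
  apply: le_Rintegral => //.
  - apply: integrable_norm.
    rewrite (_ : _ \o _ = (fun y => (f1 y - An n.+1 f1 y)%R%:E - (f2 y - An n.+1 f2 y)%R%:E)%E)//.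
    by apply: integrableB.
  - rewrite (_ : _ \o _ = (fun y => (`|f1 y - f2 y|%R)%:E + (`|An n.+1 (fun x => f1 x - f2 x) y|%R)%:E)%E)//.
    by apply: integrableD.
  move=> x _; rewrite AnB//.
  rewrite (_ : _ - _ - _ = (f1 x - f2 x) - (An n.+1 f1 x - An n.+1 f2 x)); last by ring.
  exact: ler_normB.
rewrite RintegralD// mulr_natl mulr2n lerD// (le_trans _ f12)//.
exact: (An_integrable n.+1 if12).2.
Qed.

Let dev_level n N : (n < N)%N -> dev n (WN N) <=
  2 * qS * qr ^+ n.+1 * \sum_i (side N i)^-1 * var n.+1 (side N i *: dir i) (layer u n (WN N)).
Proof.
move=> nN; apply: leveled_var_bound => //; last exact: il.
apply: layer_leveled => //; apply: (leveled_comp (f := An N u) Num.norm).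
exact: An_leveled.
Qed.

(** The oscillations of the slices add up pointwise to at most one jump of [|An N u|] along its own
    grid, which [An_hop_L1] bounds. The bound is the same for every number [L] of slices. *)
Let sum_var L N i : \sum_(n < L) var n.+1 (side N i *: dir i) (layer u n (WN N)) <=
  2 * side N i * \int[mu]_x `|v i x|.
Proof.
set h := side N i *: dir i.
have iA := (An_integrable N iu).1.
apply: le_trans (An_hop_L1 iu iv uv N i).
have io n : mu.-integrable setT (EFin \o osc n.+1 h (layer u n (WN N))).
  by apply: osc_integrable; exact: il.
rewrite /var -Rintegral_sum//; apply: le_Rintegral => //.
- rewrite (_ : _ \o _ = (fun x => \sum_(n < L) (osc n.+1 h (layer u n (WN N)) x)%:E)%E).
    by apply: integrable_sum => // n _; exact: io.
  by apply/funext => x /=; rewrite sumEFin.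
- exact: diff_integrable.
move=> x _; apply: (le_trans (sum_osc_layer _ _ _ _ _)); exact: ler_dist_dist.
Qed.

Let sum_dev L : \sum_(n < L) qr ^- n.+1 * dev n W <= 4 * qS * G.
Proof.
(* [L] stays fixed while [N] grows: the approximation error carries [qr ^+ N] and meets only
   finitely many weights, so it disappears in the limit. *)
apply: (@ler_geometric_limit _ _ (4 * qS * G * \sum_(n < L) qr ^- n.+1) L) => N LN.
have q0 n : 0 <= qr ^- n by rewrite invr_ge0 exprn_ge0// qr_ge0.
apply: (@le_trans _ _ (\sum_(n < L) (qr ^- n.+1 * dev n (WN N) +
    qr ^- n.+1 * (2 * (2 * qS * qr ^+ N * G))))).
  apply: ler_sum => n _; rewrite -mulrDr ler_wpM2l//.
  apply: (le_trans (dev_approx n N)); rewrite lerD2l ler_wpM2l//.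
  exact: (An_L1 iu iv uv N).2.
rewrite big_split/= -mulr_suml; apply: lerD; last first.
  by rewrite le_eqVlt; apply/orP; left; apply/eqP; ring.
apply: (@le_trans _ _ (\sum_(n < L) 2 * qS *
   \sum_i (side N i)^-1 * var n.+1 (side N i *: dir i) (layer u n (WN N)))).
  apply: ler_sum => n _; have nN := leq_trans (ltn_ord n) LN.
  rewrite -(ler_pM2l (_ : 0 < qr ^+ n.+1)) ?exprn_gt0 ?qr_gt0//.
  rewrite mulrA divff ?mul1r ?gt_eqF ?exprn_gt0 ?qr_gt0//.
  by apply: (le_trans (dev_level nN)); rewrite mulrCA !mulrA.
rewrite -mulr_sumr exchange_big/=.
rewrite (_ : 4 * qS * G = 2 * qS * (2 * G)); last by ring.
rewrite ler_wpM2l//; first by rewrite mulr_ge0// qS_ge0.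
rewrite G_sum mulr_sumr; apply: ler_sum => i _.
rewrite -mulr_sumr mulrC ler_pdivrMr ?side_gt0//.
apply: (le_trans (sum_var L N i)); rewrite mulrAC; exact: lexx.
Qed.

Let qinc_integrable n : mu.-integrable setT (EFin \o qinc u n) /\
  \int[mu]_x qinc u n x <= (if n is m.+1 then 24 * dev m W else 4 * \int[mu]_x `|u x|).
Proof.
have mq : measurable_fun setT (EFin \o qinc u n).
  by apply/measurable_EFinP; exact: (leveled_measurable (@qinc_leveled _ _ u n)).
have H (c : R) (f : rV -> R) : 0 <= c -> mu.-integrable setT (EFin \o f) -> (forall x, 0 <= f x) ->
    (forall x, qinc u n x <= c * An n f x) ->
    mu.-integrable setT (EFin \o qinc u n) /\ \int[mu]_x qinc u n x <= c * \int[mu]_x f x.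
  move=> c0 if_ f0 qf; have [iA EA] := ge0_An_integrable n if_ f0.
  have icA : mu.-integrable setT (EFin \o (fun x => c * An n f x)).
    rewrite (_ : _ \o _ = (fun x => c%:E * (EFin \o An n f) x)%E).
      exact: integrableZl.
    by apply/funext => x /=; rewrite EFinM.
  have iq : mu.-integrable setT (EFin \o qinc u n).
    apply: (le_integrable _ _ _ icA) => // x _ /=.
    rewrite lee_fin ger0_norm ?qinc_ge0//; exact: le_trans (qf x) (ler_norm _).
  split => //; rewrite -EA -RintegralZl//; apply: le_Rintegral => // x _; exact: qf.
case: n mq H => [|n] mq H.
  by apply: (H 4 W) => // x; rewrite /qinc /=; exact: quantile_le.
apply: (H 24 (fun y => `|layer u n W y - An n.+1 (layer u n W) y|)) => //.
  by apply: integrable_norm; exact: idev.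
by move=> x; exact: qinc_gap.
Qed.

(** The mean deviations have integrals bounded by a geometric sequence, so their series converges
    almost everywhere. *)
Let tail_vanish : {ae mu, forall x,
  An n (fun y => `|u y - An n u y|) x @[n --> \oo] --> (0 : R)}.
Proof.
pose e n x := An n (fun y => `|u y - An n u y|) x.
have e0 n x : 0 <= e n x by exact: An_ge0.
have me n : measurable_fun setT (fun x => (e n x)%:E).
  by apply/measurable_EFinP; exact: An_measurable.
have ie n : (\int[mu]_x (e n x)%:E <= (2 * qS * G)%:E * (qr ^+ n)%:E)%E.
  have [iD bD] := An_L1 iu iv uv n.
  have [iA EA] := ge0_An_integrable n (integrable_norm iD) (fun x => normr_ge0 _).
  rewrite -EFinM -(fineK (integrable_fin_num measurableT iA)) lee_fin mulrAC.
  by move: EA; rewrite {1}/Rintegral /= => ->.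
have mS : measurable_fun setT (fun x => \sum_(n <oo) (e n x)%:E)%E.
  by apply: emeasurable_nneseries => // n x; rewrite lee_fin.
have iS : mu.-integrable setT (fun x => \sum_(n <oo) (e n x)%:E)%E.
  apply/integrableP; split => //.
  rewrite (eq_integral (fun x => \sum_(n <oo) (e n x)%:E)%E); last first.
    by move=> x _; rewrite gee0_abs// nneseries_ge0// => n _ _; rewrite lee_fin.
  rewrite integral_nneseries; [|exact: measurableT|exact: me|by move=> n x _; rewrite lee_fin].
  have c0 : 0 <= 2 * qS * G.
    by rewrite mulr_ge0 ?mulr_ge0 ?qS_ge0//; apply: Rintegral_ge0 => x _; exact: grad_ge0.
  have q0 n : (0 <= (qr ^+ n)%:E)%E by rewrite lee_fin exprn_ge0// qr_ge0.
  apply: (@le_lt_trans _ _ (\sum_(n <oo) (2 * qS * G)%:E * (qr ^+ n)%:E)%E).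
    apply: lee_nneseries => [n _ _|n _]; last exact: ie.
    by apply: integral_ge0 => x _; rewrite lee_fin.
  rewrite nneseriesZl//.
  apply: (@le_lt_trans _ _ ((2 * qS * G)%:E * (qS * qr ^+ 0)%:E)%E); last by rewrite -EFinM ltry.
  by apply: lee_wpmul2l; [rewrite lee_fin|exact: nneseries_qr_le].
apply: filterS (integrable_ae measurableT iS) => x /(_ I) Sx.
apply: cvg_series_cvg_0; apply: nondecreasing_is_cvgn.
  by apply: nondecreasing_series => n _ _; exact: e0.
exists (fine (\sum_(n <oo) (e n x)%:E)%E) => _ [n _ <-].
rewrite -lee_fin fineK// /series/= -sumEFin.
apply: (@nneseries_lim_ge _ (fun k => (e k x)%:E) xpredT 0%N n) => k _ _.
by rewrite lee_fin; exact: e0.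
Qed.

(** The 4 is Chebyshev's inequality for the quantile at level 0. The 96 is 24 from [qinc_gap] times
    4 from [sum_dev], itself 2 from [leveled_var_bound] times 2 from [An_hop_L1]. *)
Lemma boxing : dominated 1 u (4 * \int[mu]_x `|u x| + 96 * qS * \int[mu]_x grad v x).
Proof.
exists (fun n => EFin \o qinc u n); split.
- split=> [n|n x]; last by rewrite lee_fin qinc_ge0.
  by apply: leveled_comp; exact: qinc_leveled.
- apply: filterS2 (An_cvg iu iv uv) tail_vanish => x ux ex.
  have : (`|An n u x| - 2 * An n (fun y => `|u y - An n u y|) x)%:E @[n --> \oo] --> `|u x|%:E.
    apply: cvg_EFin; first exact: nearW.
    rewrite -[X in _ --> X]subr0 -(mulr0 2); apply: cvgB; first exact: cvg_norm.
    by apply: cvgM => //; exact: cvg_cst.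
  move/cvge_to_le; apply; apply: nearW => n.
  rewrite (le_trans _ (nneseries_lim_ge n.+1 _))//; last by move=> k _ _; rewrite lee_fin qinc_ge0.
  rewrite big_mkord sumEFin sum_qinc lee_fin.
  by rewrite (le_trans (quantile_ge iu n x))// quantile_qmax.
- have h0 n : (0 <= \int[mu]_x (EFin \o qinc u n) x)%E.
    by apply: integral_ge0 => x _; rewrite lee_fin qinc_ge0.
  have fin n := integrable_fin_num measurableT (qinc_integrable n).1.
  have q0 n : 0 <= qr ^- n by rewrite invr_ge0 exprn_ge0// qr_ge0.
  apply: lime_le.
    by apply: is_cvg_nneseries => n _ _; rewrite mule_ge0// lee_fin.
  apply: nearW => -[|N].
    rewrite big_geq// lee_fin; apply: addr_ge0; rewrite !mulr_ge0 ?qS_ge0//.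
      exact: Rintegral_ge0.
    by apply: Rintegral_ge0 => x _; exact: grad_ge0.
  rewrite big_mkord (eq_bigr (fun n : 'I__ => (qr ^- n * \int[mu]_x qinc u n x)%:E)); last first.
    by move=> n _; rewrite muln1 EFinM -(fineK (fin n)).
  rewrite sumEFin lee_fin big_ord_recl expr0 invr1 mul1r; apply: lerD.
    exact: (qinc_integrable 0).2.
  rewrite -/G (_ : 96 * qS * G = 24 * (4 * qS * G)); last by ring.
  apply: le_trans (_ : 24 * \sum_(n < N) qr ^- n.+1 * dev n W <= _); last by rewrite ler_wpM2l.
  rewrite mulr_sumr; apply: ler_sum => n _; rewrite mulrCA ler_wpM2l//.
  exact: (qinc_integrable n.+1).2.
Qed.

End boxing.

(** * The induction step and the induction over jets *)

Section dominated_jet.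
Context {R : realType} {d' : nat}.
Local Notation d := d'.+1.
Local Notation rV := 'rV[R]_d.
Local Notation mu := (@lebesgue_rV R d).
Local Notation qr := (@qr R d').
Local Notation qS := (@qS R d').
Implicit Types (u w : rV -> R).

Lemma dominated_le k u w A B : (forall x, `|w x| <= `|u x|) -> A <= B ->
  dominated k u A -> dominated k w B.
Proof.
move=> wu AB [g [lg ug gA]]; exists g; split => //.
  by apply: filterS ug => x; apply: le_trans; rewrite lee_fin.
by apply: le_trans gA _; rewrite lee_fin.
Qed.

Lemma dominated0 k : dominated k (cst 0 : rV -> R) 0.
Proof.
exists (fun _ _ => 0%E); split => //.
  by apply: aeW => x; rewrite normr0 nneseries_ge0.
by rewrite /weight eseries0// => n _ _; rewrite integral0 mule0.
Qed.

Lemma dominatedD k u w A B : dominated k u A -> dominated k w B ->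
  dominated k (fun x => `|u x| + `|w x|) (A + B).
Proof.
move=> [g [lg ug gA]] [h [lh wh hB]].
exists (fun n x => g n x + h n x)%E; split; first exact: layersD.
  apply: filterS2 ug wh => x ux wx.
  rewrite ger0_norm ?addr_ge0// EFinD nneseriesD; [exact: leeD|..].
    by move=> n _ _; exact: lg.2.
  by move=> n _ _; exact: lh.2.
by rewrite weightD// EFinD leeD.
Qed.

Lemma dominated_grad k (v : 'I_d -> rV -> R) (A : 'I_d -> R) :
  (forall i, dominated k (v i) (A i)) -> dominated k (grad v) (\sum_(i < d) A i).
Proof.
move=> vA; rewrite /grad; elim: (index_enum _) => [|i r IH].
  rewrite big_nil (_ : (fun x => _) = cst 0); first exact: dominated0.
  by apply/funext => x; rewrite big_nil.
rewrite big_cons; apply: dominated_le (lexx _) (dominatedD (vA i) IH) => x.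
by rewrite big_cons (@ger0_norm _ (\sum_(j <- r) `|v j x|)) ?sumr_ge0.
Qed.

(** In [4 * qS], a factor 2 comes from [An_grad]; the other one counts the two families of layers,
    the layers of the gradient kept at their level and the coarsened ones, each contributing
    [qS * A]. Multiplying a layer of level [n] by [qr ^+ n] is what raises the order by one. *)
Lemma dominated_step m u (v : 'I_d -> rV -> R) A : (0 < m)%N ->
  mu.-integrable setT (EFin \o u) -> (forall i, mu.-integrable setT (EFin \o v i)) ->
  (forall i, is_weak_partial u [:: i] (v i)) -> dominated m (grad v) A ->
  dominated m.+1 u (\int[mu]_x `|u x| + 4 * qS * A).
Proof.
move=> m0 iu iv uv [g [lg vg gA]].
have [lev0 g0] := lg; have lc := layers_coarsen lg; have [_ c0] := lc.
have q0 n : 0 <= qr ^+ n by rewrite exprn_ge0// qr_ge0.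
have iG := grad_integrable iv; have iau := integrable_norm iu.
pose f := En 0 (EFin \o (fun x => `|u x|)).
have f0 x : (0 <= f x)%E by apply: En_ge0 => y; rewrite lee_fin.
have lf : leveled 0 f by exact: En_leveled.
have lt : layers (fun n x => qS%:E * ((qr ^+ n)%:E * g n x) + (qr ^+ n)%:E * coarsen g n x)%E.
  by apply: layersD; [apply: layersZ; [exact: qS_ge0|exact: layers_rate]|exact: layers_rate].
exists (fun n x => first_layer f n x +
  2%:E * (qS%:E * ((qr ^+ n)%:E * g n x) + (qr ^+ n)%:E * coarsen g n x))%E; split.
- by apply: layersD; [exact: layers_first|apply: layersZ].
- apply: filterS2 (vg) (An_cvg iu iv uv) => x _ ux.
  have : (`|An n u x|)%:E @[n --> \oo] --> `|u x|%:E.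
    by apply: cvg_EFin; [exact: nearW|exact: cvg_norm].
  move/cvge_to_le; apply; apply: nearW => N.
  rewrite nneseriesD; last 2 first.
  + by move=> n _ _; exact: (layers_first lf f0).2.
  + by move=> n _ _; rewrite mule_ge0//; exact: lt.2.
  rewrite nneseriesZl; last by move=> n _; exact: lt.2.
  have step n : `|An n.+1 u x| <= `|An n u x| + 2 * qr ^+ n * An n (grad v) x.
    rewrite -lerBlDl; apply: le_trans (An_grad iu iv uv n x).
    by rewrite lerBlDl -[X in `|X| <= _](subrK (An n u x)) addrC ler_normD.
  have tele : `|An N u x| <= `|An 0 u x| + \sum_(n < N) 2 * qr ^+ n * An n (grad v) x.
    elim: N => [|N IH]; first by rewrite big_ord0 addr0.
    by rewrite big_ord_recr addrA/= (le_trans (step N))// lerD2r.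
  apply: le_trans (_ : ((`|An 0 u x| + \sum_(n < N) 2 * qr ^+ n * An n (grad v) x)%:E <= _)%E).
    by rewrite lee_fin.
  rewrite EFinD; apply: leeD.
    rewrite nneseries_recl//; last by move=> n _; exact: (layers_first lf f0).2.
    apply: le_trans (leeDl _ _); last first.
      by apply: nneseries_ge0 => n _ _; exact: (layers_first lf f0).2.
    by rewrite /= /f -EFin_An// lee_fin An_norm.
  apply: (@le_trans _ _ (2%:E * (\sum_(n <oo) (qr ^+ n)%:E * (\sum_(k <oo) En n (g k) x)))%E); last first.
    by rewrite lee_wpmul2l// sum_rate_En.
  rewrite -nneseriesZl; last first.
    move=> n _; rewrite mule_ge0 ?lee_fin//; apply: nneseries_ge0 => k _ _; exact: En_ge0.
  apply: le_trans (nneseries_lim_ge N _); last first.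
    move=> n _ _; rewrite !mule_ge0 ?lee_fin//; apply: nneseries_ge0 => k _ _; exact: En_ge0.
  rewrite big_mkord -sumEFin; apply: lee_sum => n _.
  rewrite -mulrA EFinM lee_wpmul2l// EFinM lee_wpmul2l ?lee_fin//.
  have mg k : measurable_fun setT (g k) by exact: layers_measurable.
  rewrite EFin_An// -En_nneseries//; apply: En_le.
  + by have /integrableP[] := iG.
  + exact: emeasurable_nneseries.
  + by move=> y; rewrite lee_fin grad_ge0.
  + by move=> y; apply: nneseries_ge0.
  + apply: filterS vg => y /=; by rewrite ger0_norm ?grad_ge0.
- rewrite weightD; [|exact: layers_first|exact: layersZ].
  rewrite weight_first// weightZ// weightD; last 2 first.
  + by apply: layersZ; [exact: qS_ge0|exact: layers_rate].
  + exact: layers_rate.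
  rewrite weightZ ?qS_ge0//; last exact: layers_rate.
  rewrite !weight_rate// [leRHS]EFinD; apply: leeD.
    rewrite integral_En//; last 2 first.
    + by have /integrableP[] := iau.
    + by move=> x; rewrite lee_fin.
    by rewrite /Rintegral fineK// integrable_fin_num.
  rewrite (_ : 4 * qS * A = 2 * (qS * A + qS * A)); last by ring.
  rewrite [leRHS]EFinM lee_wpmul2l// [leRHS]EFinD [(qS * A)%:E]EFinM; apply: leeD.
    by rewrite lee_wpmul2l// lee_fin qS_ge0.
  apply: le_trans (weight_coarsen m0 lg) _.
  by rewrite lee_wpmul2l// lee_fin qS_ge0.
Qed.

(** Only first-order relations between consecutive derivatives. New directions are appended at the
    end, so [D (i :: s)] is, as a function of [s], again a jet with base [D [:: i]] and one order
    less: this is the form that the induction uses. *)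
Definition jet k (D : seq 'I_d -> rV -> R) :=
  (forall s, (size s <= k)%N -> mu.-integrable setT (EFin \o D s)) /\
  (forall s i, (size s < k)%N -> is_weak_partial (D s) [:: i] (D (rcons s i))).

Lemma jet_dominated k : exists2 C : R, 0 <= C & forall D N, jet k.+1 D ->
  (forall s, (size s <= k.+1)%N -> \int[mu]_x `|D s x| <= N) ->
  dominated k.+1 (D [::]) (C * N).
Proof.
elim: k => [|k [C C0 IH]].
  exists (4 + 96 * qS * d%:R); first by rewrite addr_ge0// !mulr_ge0// qS_ge0.
  move=> D N [iD wD] DN.
  have iv i : mu.-integrable setT (EFin \o D [:: i]) by exact: iD.
  apply: dominated_le (boxing (iD [::] isT) iv _) => //; last by move=> i; exact: (wD [::]).
  rewrite [leRHS]mulrDl lerD ?ler_wpM2l ?DN// -[leRHS]mulrA; apply: ler_wpM2l; first by rewrite mulr_ge0 ?qS_ge0.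
  rewrite Rintegral_sum//; last by move=> i; exact: integrable_norm.
  rewrite mulr_natl -[X in _ *+ X]card_ord -sumr_const; apply: ler_sum => i _; exact: DN.
exists (1 + 4 * qS * (d%:R * C)).
  by rewrite addr_ge0// mulr_ge0 ?mulr_ge0 ?qS_ge0.
move=> D N [iD wD] DN.
have iv i : mu.-integrable setT (EFin \o D [:: i]) by exact: iD.
have := dominated_step (ltn0Sn k) (iD [::] isT) iv (fun i => wD [::] i isT)
  (dominated_grad (fun i => IH (fun s => D (i :: s)) N _ _)).
move=> h; apply: dominated_le (h _ _) => //.
- rewrite [leRHS]mulrDl mul1r lerD ?DN// -[leRHS]mulrA ler_wpM2l ?mulr_ge0 ?qS_ge0//.
  by rewrite sumr_const card_ord -[leLHS]mulr_natl mulrA.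
- by move=> i; split => [s sk|s j sk]; [exact: iD|exact: (wD (i :: s))].
- by move=> i s sk; exact: DN.
Qed.

End dominated_jet.

(** * From layers to Sobolev functions *)

Section series_L1.
Context d0 (T : measurableType d0) {R : realType}.
Variable mu : {measure set T -> \bar R}.

(** Partial sums are dominated by the integrable sum of absolute values. The convergence against
    bounded [w] is meant for test functions and their derivatives. *)
Lemma series_L1 (f : nat -> T -> R) (B : R) :
  (forall m, mu.-integrable setT (EFin \o f m)) ->
  (\sum_(m <oo) \int[mu]_x `|f m x|%:E <= B%:E)%E ->
  exists V : T -> R,
  [/\ mu.-integrable setT (EFin \o V), \int[mu]_x `|V x| <= B,
      {ae mu, forall x, \sum_(m < N) f m x @[N --> \oo] --> V x} &
      forall (w : T -> R) C, measurable_fun setT w -> (forall x, `|w x| <= C) ->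
        \sum_(m < N) \int[mu]_x (f m x * w x) @[N --> \oo] --> \int[mu]_x (V x * w x)].
Proof.
move=> if_ fB; have mf m : measurable_fun setT (f m) by have /integrableP[/measurable_EFinP] := if_ m.
pose S N x := \sum_(m < N) f m x; pose D x := (\sum_(m <oo) `|f m x|%:E)%E.
have mS N : measurable_fun setT (S N) by apply: measurable_sum.
have mn m : measurable_fun setT (fun x => `|f m x|%:E).
  by apply/measurable_EFinP; exact: measurableT_comp.
have D0 x : (0 <= D x)%E by apply: nneseries_ge0.
have mD : measurable_fun setT D.
  exact: emeasurable_nneseries.
have DB : (\int[mu]_x D x <= B%:E)%E by rewrite integral_nneseries.
have iD : mu.-integrable setT D.
  apply/integrableP; split => //; apply: le_lt_trans (ltry B).
  by rewrite (eq_integral D) => // x _; rewrite gee0_abs.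
have SD N x : (`|(S N x)%:E| <= D x)%E.
  rewrite /= /S; apply: le_trans (nneseries_lim_ge N _) => //.
  by rewrite big_mkord sumEFin lee_fin ler_norm_sum.
pose V x := fine (limn_esup (fun N => (S N x)%:E)).
have mV : measurable_fun setT V.
  apply: measurableT_comp => //; apply: measurable_fun_limn_esup => N.
  exact/measurable_EFinP.
have cV : {ae mu, forall x, S N x @[N --> \oo] --> V x}.
  apply: filterS (integrable_ae measurableT iD) => x /(_ I) Dx.
  have cS : cvgn (fun N => S N x).
    have : cvgn (series (fun m => f m x)).
      apply: normed_cvg; apply: nondecreasing_is_cvgn.
        by apply: nondecreasing_series => n _ _ /=.
      exists (fine (D x)) => _ [n _ <-].
      rewrite -lee_fin fineK// /series/= -sumEFin.
      exact: (@nneseries_lim_ge _ (fun k => `|f k x|%:E) xpredT 0%N n).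
    by rewrite /series/=; under eq_fun do rewrite big_mkord.
  have h : (S N x)%:E @[N --> \oo] --> (limn (fun N => S N x))%:E.
    by apply: cvg_EFin; [exact: nearW|exact: cS].
  rewrite /V is_cvg_limn_esupE; last by apply/cvg_ex; exists (limn (fun N => S N x))%:E.
  by rewrite (cvg_lim _ h).
have VD : {ae mu, forall x, (`|V x|%:E <= D x)%E}.
  apply: filterS cV => x cx.
  have : (`|S N x|)%:E @[N --> \oo] --> `|V x|%:E.
    by apply: cvg_EFin; [exact: nearW|exact: cvg_norm].
  by move/cvge_to_le; apply; apply: nearW => N; exact: SD.
have mnV : measurable_fun setT (fun x => `|V x|%:E).
  by apply/measurable_EFinP; exact: measurableT_comp.
have nVD : (\int[mu]_x `|V x|%:E <= B%:E)%E.
  apply: le_trans DB; apply: ae_ge0_le_integral => //.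
  by apply: filterS VD => x h _.
have iV : mu.-integrable setT (EFin \o V).
  apply/integrableP; split; first exact/measurable_EFinP.
  exact: le_lt_trans nVD (ltry B).
exists V; split => //.
  rewrite -lee_fin /Rintegral fineK//; apply: integrable_fin_num => //.
  exact: (integrable_norm iV).
move=> w C mw wC.
have C0 : 0 <= C by rewrite (le_trans _ (wC point)).
have ifw m : mu.-integrable setT (EFin \o (fun x => f m x * w x)).
  have iCf : mu.-integrable setT (fun x => C%:E * (EFin \o f m) x)%E by exact: integrableZl.
  apply: le_integrable iCf => //; first by apply/measurable_EFinP; exact: measurable_funM.
  move=> x _ /=; rewrite lee_fin !normrM mulrC ler_wpM2r//.
  by rewrite (ger0_norm C0).
have Esum N : \sum_(m < N) \int[mu]_x (f m x * w x) = \int[mu]_x (S N x * w x).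
  by rewrite -Rintegral_sum//; apply: eq_Rintegral => x _; rewrite mulr_suml.
under eq_fun do rewrite Esum.
have iCD : mu.-integrable setT (fun x => C%:E * D x)%E by exact: integrableZl.
have [||||_ _ h] := @dominated_convergence _ _ _ mu setT measurableT
  (fun N x => (S N x * w x)%:E) (fun x => (V x * w x)%:E) _ _ _ _ iCD.
- by move=> N; apply/measurable_EFinP; exact: measurable_funM.
- by apply/measurable_EFinP; exact: measurable_funM.
- apply: filterS cV => x cx _; apply: cvg_EFin; first exact: nearW.
  by apply: cvgMl.
- apply: aeW => x N _; rewrite EFinM abseM muleC; apply: lee_pmul => //.
  by rewrite lee_fin.
have fin : (\int[mu]_x (V x * w x)%:E)%E \is a fin_num.
  apply: integrable_fin_num => //.
  have iCV : mu.-integrable setT (fun x => C%:E * (EFin \o V) x)%E by exact: integrableZl.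
  apply: le_integrable iCV => //; first by apply/measurable_EFinP; exact: measurable_funM.
  move=> x _ /=; rewrite lee_fin !normrM mulrC ler_wpM2r//.
  by rewrite (ger0_norm C0).
by move: h; rewrite -(fineK fin) => /fine_cvg.
Qed.

End series_L1.

Section weak_jets.
Context {R : realType} {d' : nat}.
Local Notation d := d'.+1.
Local Notation rV := 'rV[R]_d.
Local Notation mu := (@lebesgue_rV R d).

(** Unlike in [jet], every [D s] is tied directly to the base function; this is the form that passes
    to linear combinations and series, and that [sobolev_W1] provides. *)
Definition wjet k (D : seq 'I_d -> rV -> R) := forall s, (size s <= k)%N ->
  mu.-integrable setT (EFin \o D s) /\ is_weak_partial (D [::]) s (D s).

(** Both sides of the weak derivative identity are integrals against a bounded function, so they
    pass to the limit along an absolutely convergent series. *)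
Lemma series_wjet k (D : nat -> seq 'I_d -> rV -> R) (B : R) : (forall m, wjet k (D m)) ->
  (forall s, (size s <= k)%N -> (\sum_(m <oo) \int[mu]_x `|D m s x|%:E <= B%:E)%E) ->
  exists V, [/\ wjet k V, forall s, (size s <= k)%N -> \int[mu]_x `|V s x| <= B &
    {ae mu, forall x, \sum_(m < N) D m [::] x @[N --> \oo] --> V [::] x}].
Proof.
move=> jD DB.
have h s : exists Vs : rV -> R, (size s <= k)%N ->
  [/\ mu.-integrable setT (EFin \o Vs), \int[mu]_x `|Vs x| <= B,
      {ae mu, forall x, \sum_(m < N) D m s x @[N --> \oo] --> Vs x} &
      forall (w : rV -> R) C, measurable_fun setT w -> (forall x, `|w x| <= C) ->
        \sum_(m < N) \int[mu]_x (D m s x * w x) @[N --> \oo] --> \int[mu]_x (Vs x * w x)].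
  have [sk|sk] := leqP (size s) k; last by exists (cst 0).
  have [Vs ?] := series_L1 (fun m => (jD m s sk).1) (DB s sk).
  by exists Vs.
pose V s := sval (cid (h s)).
have HV s : (size s <= k)%N ->
  [/\ mu.-integrable setT (EFin \o V s), \int[mu]_x `|V s x| <= B,
      {ae mu, forall x, \sum_(m < N) D m s x @[N --> \oo] --> V s x} &
      forall (w : rV -> R) C, measurable_fun setT w -> (forall x, `|w x| <= C) ->
        \sum_(m < N) \int[mu]_x (D m s x * w x) @[N --> \oo] --> \int[mu]_x (V s x * w x)].
  exact: (svalP (cid (h s))).
have [i0 b0 c0 w0] := HV [::] isT.
exists V; split => [s sk|s sk|//]; last by have [] := HV s sk.
have [is_ bs cs ws] := HV s sk; split => //; split.
- exact: integrable_locally_rV i0.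
- exact: integrable_locally_rV is_.
move=> phi tphi.
have [_ [C phiC]] := test_integrable tphi.
have tp := test_partial s tphi; have [_ [C' pC]] := test_integrable tp.
have L := w0 _ _ (test_measurable tp) pC.
have Rr := ws _ _ (test_measurable tphi) phiC.
have Rr' : (-1) ^+ size s * (\sum_(m < N) \int[mu]_x (D m s x * phi x)) @[N --> \oo] -->
    (-1) ^+ size s * \int[mu]_x (V s x * phi x).
  by apply: cvgM => //; exact: cvg_cst.
apply: (cvg_unique _ L); first exact: norm_hausdorff.
apply: cvg_trans Rr'; apply: near_eq_cvg; apply: nearW => N.
rewrite mulr_sumr; apply: eq_bigr => m _.
by have [_ [_ _ ->]] := jD m s sk.
Qed.

Lemma wjet_test k psi : test_function psi -> wjet k (fun s => partial (rev s) psi).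
Proof.
move=> tpsi s _; split; first exact: (test_integrable (test_partial _ tpsi)).1.
exact: test_weak_partial.
Qed.

End weak_jets.

(** * A smooth cutoff of one variable and its derivatives *)

Section cutoff.
Context {R : realType}.
Implicit Types (f : R -> R) (a b t : R).

Lemma derive1n_eq0 f a b n : (forall t, ~~ (a <= t <= b) -> f t = 0) ->
  forall t, ~~ (a <= t <= b) -> derive1n n f t = 0.
Proof.
move=> f0; elim: n => [//|n IH] t tab; rewrite derive1nS derive1E.
have oU : open (~` `[a, b]%classic) by exact/closed_openC/interval_closed.
have : \forall s \near t, cst 0 s = derive1n n f s.
  apply: (@filterS _ _ _ (~` `[a, b]%classic)).
    by move=> s /= /negP; rewrite in_itv/= => /IH ->.
  by apply: open_nbhs_nbhs; split => //=; rewrite in_itv/=; exact/negP.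
by move/(near_eq_derive (1 : R)) => <-; rewrite derive_cst.
Qed.

Lemma derive1n_bounded f a b k : a <= b -> smooth1 f ->
  (forall t, ~~ (a <= t <= b) -> f t = 0) ->
  exists2 M, 1 <= M & forall m t, (m <= k)%N -> `|derive1n m f t| <= M.
Proof.
move=> ab sf f0.
have bd m : exists2 M, 0 <= M & forall t, `|derive1n m f t| <= M.
  have cf : {within `[a, b], continuous (fun t => `|derive1n m f t|)}.
    apply: continuous_subspaceT => t; apply: continuous_comp; last exact: norm_continuous.
    exact: smooth1_continuous.
  have [c _ h] := EVT_max ab cf.
  exists `|derive1n m f c| => // t; have [tab|tab] := boolP (a <= t <= b).
    by apply: h; rewrite in_itv.
  by rewrite (derive1n_eq0 m f0 tab) normr0.
elim: k => [|k [M M1 IH]].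
  have [M M0 h] := bd 0%N; exists (1 + M); first by rewrite lerDl.
  by move=> m t; rewrite leqn0 => /eqP ->; rewrite (le_trans (h t))// lerDr.
have [M' M0 h] := bd k.+1; exists (M + M'); first by rewrite (le_trans M1)// lerDl.
move=> m t; rewrite leq_eqVlt ltnS => /orP[/eqP ->|mk].
  by rewrite (le_trans (h t))// lerDr (le_trans ler01).
by rewrite (le_trans (IH _ _ mk))// lerDl.
Qed.

Lemma smooth_cutoff : exists th : R -> R, [/\ smooth1 th, forall t, 0 <= th t,
  forall t, 0 <= t <= 1 -> 1 <= th t & forall t, ~~ (-1 < t < 2) -> th t = 0].
Proof.
have p : 0 < flat 1 (1 : R) by exact: flat1_gt0.
(* On the unit interval both factors of [bell (-1) 2] have an argument at least 1, so [c] brings the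
   product up to 1 there. *)
pose c := (flat 1 (1 : R) * flat 1 1)^-1.
have c0 : 0 < c by rewrite invr_gt0 mulr_gt0.
exists (fun t => cst c t * bell (-1) 2 t); split.
- by apply: smooth1M; [exact: smooth1_cst|exact: smooth1_bump].
- by move=> t; rewrite mulr_ge0 ?bump_ge0// ltW.
- move=> t t01; rewrite /= -[leLHS](mulVf (lt0r_neq0 (mulr_gt0 p p))).
  apply: ler_wpM2l; first exact: ltW.
  by rewrite /bell; apply: ler_pM; rewrite ?flat1_ge0// flat1_nd//; lra.
- by move=> t ht; rewrite bump_eq0// mulr0.
Qed.

End cutoff.

(** * Bumps adapted to dyadic boxes *)

Section atoms.
Context {R : realType} {d' : nat}.
Local Notation d := d'.+1.
Local Notation rV := 'rV[R]_d.
Local Notation mu := (@lebesgue_rV R d).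
Local Notation side := (@side R d').
Local Notation qr := (@qr R d').

Lemma prod_count (c : R) (s : seq 'I_d) : \prod_i c ^+ count_mem i s = c ^+ size s.
Proof.
elim: s => [|j s IH] /=; first by rewrite big1.
under eq_bigr do rewrite exprD; rewrite big_split/= IH exprS; congr (_ * _).
by rewrite (bigD1 j)//= eqxx expr1 big1 ?mulr1// => i /negbTE ij; rewrite eq_sym ij expr0.
Qed.

Lemma Rintegral_le_box (f : rV -> R) (B : set rV) c m : mu.-integrable setT (EFin \o f) ->
  measurable B -> mu B = m%:E -> 0 <= c -> (forall x, B x -> `|f x| <= c) ->
  (forall x, ~ B x -> f x = 0) -> \int[mu]_x `|f x| <= c * m.
Proof.
move=> if_ mB Bm c0 fc f0; have inf_ := integrable_norm if_.
rewrite -lee_fin /Rintegral fineK; last exact: integrable_fin_num.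
have mI : measurable_fun setT (EFin \o (\1_B : rV -> R)).
  by apply/measurable_EFinP; exact: measurable_indic.
apply: (@le_trans _ _ (\int[mu]_x (c%:E * (EFin \o \1_B) x))%E).
  apply: ge0_le_integral => //.
  - by have /integrableP[] := inf_.
  - by apply: emeasurable_funM => //.
  - move=> x _ /=; rewrite -EFinM lee_fin indicE.
    have [xB|xB] := boolP (x \in B); first by rewrite mulr1 fc//; exact/set_mem.
    by rewrite f0 ?normr0 ?mulr0//; move=> Bx; move: xB; rewrite mem_set.
rewrite ge0_integralZl_EFin//; last by move=> x _; rewrite /= lee_fin.
have := Bm; rewrite -[in X in X -> _](setIT B) -integral_indic// => ->; by rewrite EFinM.
Qed.

Lemma atoms k : exists2 K : R, 0 <= K & forall n (z : 'I_d -> int), exists phi : rV -> R,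
  [/\ test_function phi, forall x, 0 <= phi x, forall x, dbox n z x -> 1 <= phi x &
      forall s, (size s <= k)%N ->
        \int[mu]_x `|partial s phi x| <= K * 2 ^- n * qr ^- (n * k)].
Proof.
have [th [sth th0 th1 thz]] := @smooth_cutoff R.
have thz' t : ~~ (-1 <= t <= 2) -> th t = 0.
  by move=> h; apply: thz; apply: contra h => /andP[/ltW -> /ltW ->].
have [M M1 thM] := derive1n_bounded k (ltac:(lra) : (-1 : R) <= 2) sth thz'.
have M0 := le_trans ler01 M1.
(* Each derivative costs an inverse side, at most [2 * qr ^- n]; each of the [d] factors is bounded
   by [M]; the support lies in a box with sides multiplied by 4. *)
exists (2 ^+ k * M ^+ d * 4 ^+ d); first by rewrite !mulr_ge0 ?exprn_ge0.
move=> n z; pose f (i : 'I_d) t := th (2 ^+ lev n i * t + - (z i)%:~R).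
have sf i : smooth1 (f i) by exact: smooth1_affine.
have s0 (i : 'I_d) : 0 < 2 ^+ lev n i :> R by rewrite exprn_gt0.
have tf : test_function (prodf f).
  apply: (test_prodf (a := fun i => ((z i)%:~R - 1) * side n i)
    (b := fun i => ((z i)%:~R + 2) * side n i)) => // i t h.
  rewrite /f thz//; apply: contra h; rewrite /side ltr_pdivrMr// ltr_pdivlMr//.
  by rewrite mulrC => /andP[h1 h2]; apply/andP; split; lra.
exists (prodf f); split => //.
- by move=> x; apply: prodr_ge0 => i _; exact: th0.
- move=> x xz; rewrite /prodf; apply: (@le_trans _ _ (\prod_(i < d) (1 : R))).
    by rewrite big1.
  apply: ler_prod => i _; rewrite ler01 th1//.
  have := floor_itv (2 ^+ lev n i * x ord0 i); rewrite -/(cell n x i) xz intrD.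
  by move=> /andP[h1 h2]; apply/andP; split; lra.
move=> s sk; set c := 2 ^+ k * M ^+ d * qr ^- (n * k).
have qn : 1 <= 2 * qr ^- n.
  rewrite -[leLHS]mulr1; apply: ler_pM => //; first by rewrite ler1n.
  by rewrite invf_ge1 ?exprn_gt0 ?qr_gt0// exprn_ile1 ?qr_ge0// ltW// qr_lt1.
have i0 : 0 <= qr ^- n by rewrite invr_ge0 exprn_ge0// qr_ge0.
rewrite (_ : _ * 2 ^- n * _ = c * (4 ^+ d * 2 ^- n)); last by rewrite /c; ring.
rewrite partial_prodf//.
(* The derivatives are known to vanish outside a closed box of three sides; a half open box of four
   sides contains it, endpoints included. *)
apply: (@Rintegral_le_box _ (rbox (fun i => ((z i)%:~R - 1) * side n i)
  (fun i => ((z i)%:~R - 1) * side n i + 4 * side n i))).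
- by rewrite -partial_prodf//; exact: (test_integrable (test_partial _ tf)).1.
- exact: measurable_rbox.
- rewrite /rbox (mu_itv_prod _ (h := fun i => 4 * side n i)); last first.
    by move=> i; rewrite mulr_ge0// ltW// side_gt0.
  by rewrite big_split/= prod_side prodr_const card_ord.
- by rewrite /c !mulr_ge0 ?exprn_ge0// invr_ge0 exprn_ge0// qr_ge0.
- move=> x _; rewrite /prodf normr_prod.
  apply: (@le_trans _ _ (\prod_(i < d) ((2 * qr ^- n) ^+ count_mem i s * M))).
    apply: ler_prod => i _; rewrite normr_ge0/= /dern /f derive1n_affine// normrM.
    have ci : (count_mem i s <= k)%N by rewrite (leq_trans (count_size _ _)).
    apply: ler_pM => //; last exact: thM.
    rewrite normrX (ger0_norm (ltW (s0 i))); apply: lerXn2r; rewrite ?nnegrE ?(ltW (s0 i))//.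
      by rewrite (le_trans _ qn).
    have := @side_ge R d' n i; rewrite /side ler_pdivlMr// => h.
    by rewrite ler_pdivlMr ?exprn_gt0 ?qr_gt0// mulrC.
  rewrite big_split/= prod_count prodr_const card_ord /c mulrAC ler_wpM2r ?exprn_ge0//.
  apply: (@le_trans _ _ ((2 * qr ^- n) ^+ k)); first by rewrite ler_weXn2l.
  by rewrite exprMn exprVn exprM.
- move=> x /existsNP[i hi]; rewrite /prodf (bigD1 i)//= /dern /f derive1n_affine//.
  rewrite (@derive1n_eq0 _ th (-1) 2) ?mulr0 ?mul0r//; apply/negP => /andP[h1 h2].
  apply: hi; rewrite /= in_itv/= /side -mulrDl ler_pdivrMr// ltr_pdivlMr//.
  by rewrite mulrC; apply/andP; split; lra.
Qed.

End atoms.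

(** * A smooth majorant from the layers *)

Section synthesis.
Context {R : realType} {d' : nat}.
Local Notation d := d'.+1.
Local Notation rV := 'rV[R]_d.
Local Notation mu := (@lebesgue_rV R d).
Local Notation qr := (@qr R d').

Lemma wjet_lin k (a b : R) (D D' : seq 'I_d -> rV -> R) : wjet k D -> wjet k D' ->
  wjet k (fun s x => a * D s x + b * D' s x).
Proof.
move=> jD jD'.
have iab (f f' : rV -> R) : mu.-integrable setT (EFin \o f) -> mu.-integrable setT (EFin \o f') ->
    mu.-integrable setT (EFin \o (fun x => a * f x + b * f' x)).
  move=> if_ if'; rewrite (_ : _ \o _ = (fun x => a%:E * (EFin \o f) x + b%:E * (EFin \o f') x)%E)//.
  by apply: integrableD => //; exact: integrableZl.
have Iab (f f' p : rV -> R) : mu.-integrable setT (EFin \o f) -> mu.-integrable setT (EFin \o f') ->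
    test_function p -> \int[mu]_x ((a * f x + b * f' x) * p x) =
    a * \int[mu]_x (f x * p x) + b * \int[mu]_x (f' x * p x).
  move=> if_ if' tp; have h1 := integrableM_test if_ tp; have h2 := integrableM_test if' tp.
  rewrite -!RintegralZl// -RintegralD//; last 2 first.
  - by rewrite (_ : _ \o _ = (fun x => a%:E * (EFin \o (fun x => (f x * p x)%R)) x)%E)//; exact: integrableZl.
  - by rewrite (_ : _ \o _ = (fun x => b%:E * (EFin \o (fun x => (f' x * p x)%R)) x)%E)//; exact: integrableZl.
  by apply: eq_Rintegral => x _; rewrite mulrDl !mulrA.
have [i0 _] := jD [::] isT; have [i0' _] := jD' [::] isT.
move=> s sk; have [is_ [_ _ ws]] := jD s sk; have [is' [_ _ ws']] := jD' s sk.
split; first exact: iab.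
split; [by apply: integrable_locally_rV; exact: iab..|].
move=> phi tphi; rewrite !Iab// ?ws ?ws'//; first by ring.
exact: test_partial.
Qed.

Lemma wjetZ k (c : R) (D : seq 'I_d -> rV -> R) : wjet k D -> wjet k (fun s x => c * D s x).
Proof.
move=> jD; have := wjet_lin c 0 jD jD.
by under eq_fun do under eq_fun do rewrite mul0r addr0.
Qed.

Lemma sum_le_limit (a : nat -> R) l N : (forall n, 0 <= a n) ->
  \sum_(m < N) a m @[N --> \oo] --> l -> \sum_(m < N) a m <= l.
Proof.
move=> a0 al; rewrite -(cvg_lim _ al)//.
apply: (nondecreasing_cvgn_le (u_ := fun N => \sum_(m < N) a m)).
  apply/nondecreasing_seqP => n; by rewrite big_ord_recr lerDl.
by apply/cvg_ex; exists l.
Qed.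

Lemma atom_pbox k : exists2 K : R, 0 <= K & forall n j, exists phi : rV -> R,
  [/\ test_function phi, forall x, 0 <= phi x, forall x, pbox n j x -> 1 <= phi x &
      forall s, (size s <= k)%N ->
        \int[mu]_x `|partial s phi x| <= K * 2 ^- n * qr ^- (n * k)].
Proof.
have [K K0 h] := @atoms R d' k; exists K => // n j; rewrite /pbox.
case: pickle_inv => [z|]; first exact: h.
by have [phi [h1 h2 h3 h4]] := h n (fun=> 0); exists phi; split.
Qed.

(** The majorant is the sum over the boxes of the value of [g] times the atom. Neighbouring atoms
    overlap, but the triangle inequality is enough for the norm, and non-negative atoms can only
    help the lower bound. *)
Lemma layer_wjet k : exists2 K : R, 0 <= K & forall n (g : rV -> \bar R),
  leveled n g -> (forall x, 0 <= g x)%E -> (\int[mu]_x g x < +oo)%E ->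
  exists V, [/\ wjet k V,
    forall s, (size s <= k)%N ->
      (\int[mu]_x `|V s x|%:E <= K%:E * ((qr ^- (n * k))%:E * \int[mu]_x g x))%E &
    {ae mu, forall x, (g x <= (V [::] x)%:E)%E}].
Proof.
have [K K0 hK] := atom_pbox k; exists K => // n g lg g0 gfin.
pose phi j := sval (cid (hK n j)); have hphi j := svalP (cid (hK n j)).
have mg : measurable_fun setT g by exact: leveled_measurable lg.
pose I j := (\int[mu]_(x in pbox n j) g x)%E.
have I0 j : (0 <= I j)%E by exact: integral_ge0.
have Ile j : (I j <= \int[mu]_x g x)%E.
  by apply: ge0_subset_integral => //; exact: measurable_pbox.
have Ifin j : I j \is a fin_num by rewrite ge0_fin_numE// (le_lt_trans (Ile j)).
have Gfin : (\int[mu]_x g x)%E \is a fin_num by rewrite ge0_fin_numE// integral_ge0.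
(* The constant value of [g] on the box [j], and 0 when [pbox n j] is empty. The factor [2 ^+ n]
   cancels the volume in the norm of the atom. *)
pose c j := 2 ^+ n * fine (I j).
have c0 j : 0 <= c j by rewrite mulr_ge0 ?exprn_ge0// fine_ge0.
pose D j s x := c j * partial (rev s) (phi j) x.
have jD j : wjet k (D j) by apply/wjetZ/wjet_test; have [] := hphi j.
pose B := K * (qr ^- (n * k) * fine (\int[mu]_x g x)%E).
have DB s : (size s <= k)%N -> (\sum_(j <oo) \int[mu]_x `|D j s x|%:E <= B%:E)%E.
  move=> sk; have -> : (B%:E = (K * qr ^- (n * k))%:E * \sum_(j <oo) I j)%E.
    by rewrite /I -integral_pbox// -(fineK Gfin) -EFinM /B mulrA.
  rewrite -nneseriesZl; last by move=> j _; exact: I0.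
  apply: lee_nneseries => [j _ _|j _]; first exact: integral_ge0.
  have [tphi _ _ hb] := hphi j.
  have ip := integrable_norm (test_integrable (test_partial (rev s) tphi)).1.
  rewrite (eq_integral (fun x => (c j)%:E * (`|partial (rev s) (phi j) x|)%:E)%E); last first.
    by move=> x _; rewrite /D normrM (ger0_norm (c0 j)).
  rewrite ge0_integralZl_EFin//; last by have /integrableP[] := ip.
  rewrite -(fineK (integrable_fin_num measurableT ip)) -(fineK (Ifin j)) -!EFinM lee_fin.
  have sk' : (size (rev s) <= k)%N by rewrite size_rev.
  apply: (le_trans (ler_wpM2l (c0 j) (hb _ sk'))); rewrite /c.
  rewrite (_ : _ * _ * _ = (2 ^+ n * 2 ^- n) * (K * qr ^- (n * k) * fine (I j))); last by ring.
  by rewrite divff ?mul1r// expf_neq0.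
have [V [jV VB cV]] := series_wjet jD DB.
exists V; split => // [s sk|].
  have iV := integrable_norm (jV s sk).1.
  rewrite -(fineK (integrable_fin_num measurableT iV)) -(fineK Gfin) -!EFinM lee_fin.
  exact: VB.
apply: filterS cV => x cx.
have [j _ xj] : (\bigcup_j pbox n j) x by rewrite pbox_cover.
have D0 j' : 0 <= D j' [::] x by rewrite mulr_ge0//; have [_ h _ _] := hphi j'; exact: h.
have gc : g x = (c j)%:E.
  rewrite /c EFinM fineK// /I (pbox_box xj) integral_box_leveled// muleA.
  by rewrite exp2_fact mul1e.
rewrite gc lee_fin; apply: le_trans (sum_le_limit j.+1 D0 cx).
rewrite big_ord_recr/=; apply: (@le_trans _ _ (D j [::] x)); last by rewrite lerDr sumr_ge0.
rewrite /D ler_peMr//; have [_ _ h _] := hphi j; exact: h.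
Qed.

Lemma synthesis k : exists2 K : R, 0 <= K & forall (u : rV -> R) A, dominated k u A ->
  exists V, [/\ wjet k V, forall s, (size s <= k)%N -> \int[mu]_x `|V s x| <= K * A &
    {ae mu, forall x, `|u x| <= V [::] x}].
Proof.
have [K K0 hK] := layer_wjet k; exists K => // u A [g [lg ug gA]].
have [lev0 g0] := lg.
have t0 n : (0 <= (qr ^- (n * k))%:E * \int[mu]_x g n x)%E.
  by rewrite mule_ge0 ?qrV_ge0// integral_ge0.
(* A single term of the weight is finite and its coefficient is positive. *)
have gfin n : (\int[mu]_x g n x < +oo)%E.
  have : ((qr ^- (n * k))%:E * \int[mu]_x g n x < +oo)%E.
    apply: le_lt_trans (ltry A); apply: le_trans gA.
    apply: (@le_trans _ _ (\sum_(0 <= m < n.+1) (qr ^- (m * k))%:E * \int[mu]_x g m x)%E).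
      by rewrite big_nat_recr//= leeDr// sume_ge0.
    exact: nneseries_lim_ge.
  apply: contraTlt; rewrite leye_eq => /eqP ->.
  by rewrite gt0_muley// lte_fin invr_gt0 exprn_gt0// qr_gt0.
have h n := cid (hK n (g n) (lev0 n) (g0 n) (gfin n)).
pose V n := sval (h n); have hV n := svalP (h n).
have jV n : wjet k (V n) by have [] := hV n.
have VB s : (size s <= k)%N -> (\sum_(n <oo) \int[mu]_x `|V n s x|%:E <= (K * A)%:E)%E.
  move=> sk; rewrite EFinM; apply: (@le_trans _ _ (K%:E * weight k g)%E); last by rewrite lee_wpmul2l.
  rewrite /weight -nneseriesZl//; apply: lee_nneseries => [n _ _|n _]; first exact: integral_ge0.
  by have [_ hb _] := hV n; exact: hb.
have [W [jW WB cW]] := series_wjet jV VB.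
exists W; split => //.
have aV : {ae mu, forall x, forall n, (g n x <= (V n [::] x)%:E)%E}.
  by apply/ae_foralln => n; have [] := hV n.
apply: filterS3 ug aV cW => x ux gx cx.
rewrite -lee_fin (le_trans ux)//; apply: lime_le.
  by apply: is_cvg_nneseries => n _ _; exact: g0.
have V0 n : 0 <= V n [::] x by rewrite -lee_fin (le_trans (g0 n x)).
apply: nearW => N; apply: (@le_trans _ _ (\sum_(n < N) (V n [::] x)%:E)%E).
  by rewrite big_mkord; apply: lee_sum => n _.
by rewrite sumEFin lee_fin; exact: (sum_le_limit N V0 cx).
Qed.

End synthesis.

(** * Between jets and the Sobolev norm *)

Section sobolev_jets.
Context {R : realType} {d' : nat}.
Local Notation d := d'.+1.
Local Notation rV := 'rV[R]_d.
Local Notation mu := (@lebesgue_rV R d).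

(** The identity for [s] is tested on the derivative of [phi] along [i] and compared with the
    identity for [rcons s i]: the left sides coincide and the signs [(-1) ^+ size s] cancel. *)
Lemma wjet_jet k (D : seq 'I_d -> rV -> R) : wjet k D -> jet k D.
Proof.
move=> jD; split => [s sk|s i sk]; first by have [] := jD s sk.
have [is_ [_ _ ws]] := jD s (ltnW sk).
have sk' : (size (rcons s i) <= k)%N by rewrite size_rcons.
have [is' [_ _ ws']] := jD (rcons s i) sk'.
split; [exact: integrable_locally_rV|exact: integrable_locally_rV|] => phi tphi.
have := ws _ (test_derive i tphi); rewrite -partial_rcons ws'// size_rcons => /(congr1 ( *%R ((-1) ^+ size s))).
by rewrite !mulrA -!expr2 sqrr_sign mul1r /= => <-; rewrite exprS mulrCA -expr2 sqrr_sign mulr1 expr1.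
Qed.

(** The majorant is non-negative only almost everywhere, while the two parts have to be so at every
    point; this allows the base function to be corrected on a null set. *)
Lemma wjet_ae k (D : seq 'I_d -> rV -> R) (f : rV -> R) : wjet k D -> measurable_fun setT f ->
  {ae mu, forall x, f x = D [::] x} -> wjet k (fun s => if s is [::] then f else D s).
Proof.
move=> jD mf fD; have [i0 _] := jD [::] isT.
have fD' : {ae mu, forall x, D [::] x = f x} by apply: filterS fD => x ->.
have jf : mu.-integrable setT (EFin \o f) := integrable_eq_ae mf fD' i0.
have mD : measurable_fun setT (D [::]) by have /integrableP[/measurable_EFinP] := i0.
have jf0 : is_weak_partial f [::] f.
  by split; [exact: integrable_locally_rV..|move=> phi _; rewrite expr0 mul1r].
move=> [|i s] sk; first by [].
have [is_ [_ ls ws]] := jD (i :: s) sk; split => //; split => //.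
  exact: integrable_locally_rV.
move=> phi tphi; rewrite -ws//.
have mp : measurable_fun setT (partial (i :: s) phi).
  exact: (test_measurable (test_partial (i :: s) tphi)).
apply: eq_Rintegral_ae; [exact: measurable_funM|exact: measurable_funM|].
by apply: filterS fD => x ->.
Qed.

Lemma weak_partialP (u : rV -> R) s v : is_weak_partial u s v ->
  is_weak_partial u s (weak_partial u s).
Proof.
by move=> h; exact: (@xgetPex _ (fun=> 0) [set v | is_weak_partial u s v] (ex_intro _ v h)).
Qed.

(** [weak_partial] is a chosen representative; uniqueness identifies it with [D s] almost
    everywhere, so integrals may be computed on [D s]. *)
Lemma wjet_sobolev k (D : seq 'I_d -> rV -> R) : wjet k D -> sobolev_W1 k (D [::]) /\
  forall s, (0 < size s <= k)%N ->
    \int[mu]_x `|weak_partial (D [::]) s x| = \int[mu]_x `|D s x|.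
Proof.
move=> jD; have h s : (0 < size s <= k)%N -> [/\ is_weak_partial (D [::]) s (D s),
    mu.-integrable setT (EFin \o D s), measurable_fun setT (weak_partial (D [::]) s) &
    {ae mu, forall x, D s x = weak_partial (D [::]) s x}].
  move=> /andP[_ sk]; have [is_ ws] := jD s sk; have wp := weak_partialP ws.
  by split => //; [have [_ []] := wp|exact: weak_partial_unique ws wp].
split; last first.
  move=> s /h[_ /integrableP[/measurable_EFinP mD _] mw Dw].
  apply: eq_Rintegral_ae; [exact: measurableT_comp|exact: measurableT_comp|].
  by apply: filterS Dw => x ->.
split; first by have [] := jD [::] isT.
move=> s /h[ws is_ mw Dw]; split; first by exists (D s).
exact: integrable_eq_ae mw Dw is_.
Qed.

Lemma sobolev_wjet k (u : rV -> R) : sobolev_W1 k u ->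
  wjet k (fun s => if s is [::] then u else weak_partial u s).
Proof.
move=> [iu wu] [|i s] sk.
  split => //; split; [exact: integrable_locally_rV|exact: integrable_locally_rV|].
  by move=> phi _; rewrite expr0 mul1r.
have [[v wv] iv] := wu (i :: s) sk; split => //; exact: weak_partialP wv.
Qed.

Lemma sqrt_sum_sqr_le (I : Type) (r : seq I) (a : I -> R) :
  Num.sqrt (\sum_(i <- r) a i ^+ 2) <= \sum_(i <- r) `|a i|.
Proof.
have S0 (r' : seq I) : 0 <= \sum_(i <- r') `|a i| by apply: sumr_ge0.
rewrite -[leRHS]ger0_norm// -sqrtr_sqr ler_wsqrtr//.
elim: r => [|i r IH]; first by rewrite !big_nil expr0n.
rewrite !big_cons sqrrD real_normK ?num_real// -addrA lerD2l (le_trans IH)// lerDr.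
by rewrite mulrn_wge0// mulr_ge0.
Qed.

Lemma norm_le_sqrt_sum (I : finType) (a : I -> R) i : `|a i| <= Num.sqrt (\sum_j a j ^+ 2).
Proof.
rewrite -sqrtr_sqr ler_wsqrtr// (bigD1 i)//= lerDl; apply: sumr_ge0 => j _; exact: sqr_ge0.
Qed.

Lemma tensor_measurable k (u : rV -> R) i : sobolev_W1 k u -> (0 < i <= k)%N ->
  measurable_fun setT (weak_tensor_norm u i).
Proof.
move=> [_ wu] ik; apply: measurableT_comp.
  apply: continuous_measurable_fun; exact: sqrt_continuous.
apply: measurable_sum => t; apply: measurable_funX.
have st : (0 < size t <= k)%N by rewrite size_tuple.
by have [_ /integrableP[/measurable_EFinP]] := wu t st.
Qed.

Lemma Lnorm1_tensor k (u : rV -> R) i : sobolev_W1 k u -> (0 < i <= k)%N ->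
  ('N[mu]_1[EFin \o weak_tensor_norm u i] <=
   (\sum_(t : i.-tuple 'I_d) \int[mu]_x `|weak_partial u t x|)%:E)%E.
Proof.
move=> su ik; have mt := tensor_measurable su ik; have [_ wu] := su.
have iw (t : i.-tuple 'I_d) : mu.-integrable setT (fun x => `|weak_partial u t x|%:E).
  by apply: integrable_norm; apply: (wu t _).2; rewrite size_tuple.
rewrite Lnorm1 -sumEFin (eq_bigr (fun t : i.-tuple 'I_d => \int[mu]_x `|weak_partial u t x|%:E)%E); last first.
  by move=> t _; rewrite /Rintegral fineK// integrable_fin_num.
rewrite -ge0_integral_sum//; last by move=> t; have /integrableP[] := iw t.
apply: ge0_le_integral => //.
- by apply: measurableT_comp => //; exact/measurable_EFinP.
- by apply: emeasurable_sum => t; have /integrableP[] := iw t.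
- move=> x _; rewrite /= sumEFin lee_fin ger0_norm ?sqrtr_ge0//.
  exact: sqrt_sum_sqr_le.
Qed.

Lemma Lnorm1E (f : rV -> R) : mu.-integrable setT (EFin \o f) ->
  ('N[mu]_1[EFin \o f] = (\int[mu]_x `|f x|)%:E)%E.
Proof.
by move=> if_; rewrite Lnorm1 /Rintegral fineK// integrable_fin_num//; exact: integrable_norm.
Qed.

(** The Euclidean norm of a tensor is at most the sum of the absolute values of its entries, and
    [d ^ i] is the number of entries at order [i]. *)
Lemma sobolev_norm_le k (D : seq 'I_d -> rV -> R) (N : R) : wjet k D ->
  (forall s, (size s <= k)%N -> \int[mu]_x `|D s x| <= N) ->
  (sobolev_W1_norm k (D [::]) <= ((1 + \sum_(1 <= i < k.+1) (d ^ i)%:R) * N)%:E)%E.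
Proof.
move=> jD DN; have [su wu] := wjet_sobolev jD.
rewrite /sobolev_W1_norm mulrDl mul1r EFinD; apply: leeD.
  by rewrite Lnorm1E ?lee_fin ?DN//; have [] := jD [::] isT.
rewrite mulr_suml -sumEFin big_nat_cond [leRHS]big_nat_cond; apply: lee_sum => i /andP[ik _].
apply: le_trans (Lnorm1_tensor su ik) _; rewrite lee_fin.
rewrite mulr_natl -[X in (X ^ i)%N]card_ord -card_tuple -sumr_const; apply: ler_sum => t _.
by rewrite wu ?DN ?size_tuple//; case/andP: ik.
Qed.

Lemma sobolev_norm_fin k (u : rV -> R) : sobolev_W1 k u -> sobolev_W1_norm k u \is a fin_num.
Proof.
move=> su; have [iu _] := su.
rewrite /sobolev_W1_norm Lnorm1E// fin_numD/= big_nat_cond.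
elim/big_ind: _ => // [x y xf yf|i /andP[ik _]]; first by rewrite fin_numD xf.
by rewrite ge0_fin_numE ?Lnorm_ge0// (le_lt_trans (Lnorm1_tensor su ik))// ltry.
Qed.

Lemma le_sobolev_norm k (u : rV -> R) s : sobolev_W1 k u -> (size s <= k)%N ->
  \int[mu]_x `|(if s is [::] then u else weak_partial u s) x| <= fine (sobolev_W1_norm k u).
Proof.
move=> su sk; have [iu wu] := su; rewrite -lee_fin (fineK (sobolev_norm_fin su)).
have S0 : (0 <= \sum_(1 <= i < k.+1) 'N[mu]_1[EFin \o weak_tensor_norm u i])%E.
  by apply: sume_ge0 => i _; exact: Lnorm_ge0.
case: s sk => [_|i s sk]; first by rewrite -(Lnorm1E iu) leeDl.
apply: (@le_trans _ _ ('N[mu]_1[EFin \o weak_tensor_norm u (size (i :: s))])%E); last first.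
  rewrite /sobolev_W1_norm (big_rem (size (i :: s))) /=; last by rewrite mem_index_iota.
  rewrite addeCA leeDl// adde_ge0 ?Lnorm_ge0//; apply: sume_ge0 => j _; exact: Lnorm_ge0.
have iw := (wu (i :: s) sk).2; have mt := tensor_measurable su (sk : (0 < size (i :: s) <= k)%N).
rewrite -Lnorm1E// !Lnorm1; apply: ge0_le_integral => //.
- by have /integrableP[? _] := iw; apply: measurableT_comp.
- by apply: measurableT_comp => //; exact/measurable_EFinP.
- move=> x _; rewrite /= lee_fin (ger0_norm (sqrtr_ge0 _)).
  exact: (norm_le_sqrt_sum (fun t : (size (i :: s)).-tuple 'I_d => weak_partial u t x) (in_tuple (i :: s))).
Qed.

End sobolev_jets.

Theorem theorem1p1 (R : realType) (d k : nat) (d_ge1 : (1 <= d)%N)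
    (k_ge1 : (1 <= k)%N) :
  exists C : R, 0 < C /\
    forall u : 'rV[R]_d -> R, sobolev_W1 k u ->
    exists uplus uminus : 'rV[R]_d -> R,
      [/\ sobolev_W1 k uplus /\ sobolev_W1 k uminus,
          forall x, 0 <= uplus x /\ 0 <= uminus x,
          {ae lebesgue_rV d, forall x, u x = uplus x - uminus x} &
          (sobolev_W1_norm k uplus + sobolev_W1_norm k uminus
             <= C%:E * sobolev_W1_norm k u)%E].
Proof.
case: d d_ge1 => [//|d' _]; case: k k_ge1 => [//|k _].
have [C1 C10 hC1] := @jet_dominated R d' k; have [K K0 hK] := @synthesis R d' k.+1.
pose c : R := 1 + \sum_(1 <= i < k.+2) (d'.+1 ^ i)%:R.
have c0 : 0 <= c by rewrite addr_ge0// sumr_ge0.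
(* [K * C1] bounds the derivatives of the majorant, [K * C1 + 1] those of the majorant minus [u],
   and [c] counts the derivatives. The last [+ 1] only makes the constant positive. *)
exists (c * (K * C1 + (K * C1 + 1)) + 1); split.
  by rewrite ltr_wpDl// mulr_ge0// !addr_ge0// mulr_ge0.
move=> u su; have [iu _] := su.
pose D s := if s is [::] then u else weak_partial u s.
pose N := fine (sobolev_W1_norm k.+1 u).
have Nfin : sobolev_W1_norm k.+1 u = N%:E by rewrite fineK// sobolev_norm_fin.
have jD : wjet k.+1 D := sobolev_wjet su.
have DN s : (size s <= k.+1)%N -> \int[lebesgue_rV d'.+1]_x `|D s x| <= N.
  exact: le_sobolev_norm.
have N0 : 0 <= N by apply: le_trans (DN [::] isT); exact: Rintegral_ge0.
have [V [jV VN uV]] := hK _ _ (hC1 D N (wjet_jet jD) DN).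
have mu_ : measurable_fun setT u by have /integrableP[/measurable_EFinP] := iu.
have mV : measurable_fun setT (V [::]).
  by have [/integrableP[/measurable_EFinP]] := jV [::] isT.
(* Since [|u| <= V [::]] almost everywhere, both maxima are attained by their first argument almost
   everywhere: derivatives are untouched and the sign holds at every point. *)
pose up x := Num.max (V [::] x) 0; pose um x := Num.max (V [::] x - u x) 0.
have jW := wjet_lin 1 (-1) jV jD; set W := (fun s x => _) in jW.
have WN s : (size s <= k.+1)%N -> \int[lebesgue_rV d'.+1]_x `|W s x| <= (K * C1 + 1) * N.
  move=> sk; rewrite mulrDl mul1r -mulrA; apply: le_trans (lerD (VN s sk) (DN s sk)).
  have iV := integrable_norm (jV s sk).1; have iD := integrable_norm (jD s sk).1.
  rewrite -RintegralD//; apply: le_Rintegral => //.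
  - exact: integrable_norm (jW s sk).1.
  - rewrite (_ : _ \o _ = (fun x => `|V s x|%:E + `|D s x|%:E)%E)//; exact: integrableD.
  - by move=> x _; rewrite /W mul1r mulN1r ler_normB.
have aep : {ae lebesgue_rV d'.+1, forall x, up x = V [::] x}.
  by apply: filterS uV => x h; rewrite /up max_l// (le_trans _ h).
have aem : {ae lebesgue_rV d'.+1, forall x, um x = W [::] x}.
  apply: filterS uV => x h; rewrite /W mul1r mulN1r /um max_l//.
  by rewrite subr_ge0 (le_trans _ h)// ler_norm.
have jp := wjet_ae jV (measurable_maxr mV (measurable_cst _)) aep.
have jm := wjet_ae jW (measurable_maxr (measurable_funB mV mu_) (measurable_cst _)) aem.
have eqN (f g : 'rV[R]_d'.+1 -> R) : measurable_fun setT f -> measurable_fun setT g ->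
    {ae lebesgue_rV d'.+1, forall x, f x = g x} ->
    \int[lebesgue_rV d'.+1]_x `|f x| = \int[lebesgue_rV d'.+1]_x `|g x|.
  move=> mf mg fg; apply: eq_Rintegral_ae; [exact: measurableT_comp|exact: measurableT_comp|].
  by apply: filterS fg => x ->.
exists up, um; split.
- by split; [exact: (wjet_sobolev jp).1|exact: (wjet_sobolev jm).1].
- by move=> x; rewrite !le_max lexx !orbT.
- by apply: filterS2 aep aem => x -> ->; rewrite /W mul1r mulN1r opprB addrC subrK.
rewrite Nfin -EFinM; apply: (@le_trans _ _ ((c * (K * C1 * N))%:E + (c * ((K * C1 + 1) * N))%:E)%E).
  apply: leeD.
  - apply: (sobolev_norm_le jp) => -[_|i s sk]; last by rewrite -mulrA; exact: VN.
    rewrite (eqN _ (V [::]))// -?mulrA; [exact: VN|exact: measurable_maxr].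
  - apply: (sobolev_norm_le jm) => -[_|i s sk]; last exact: WN.
    rewrite (eqN _ (W [::]))//; first exact: WN.
      by apply: measurable_maxr => //; exact: measurable_funB.
    by have [/integrableP[/measurable_EFinP]] := jW [::] isT.
rewrite -EFinD lee_fin -subr_ge0 (_ : _ - _ = N)//; by ring.
Qed.
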